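(* Let $\Gamma$ be an orderable Fuchsian group and $s>1$ a real number. Suppose $O_1,\dots,O_n$ are disjoint orbits of $\Gamma$ in $\mathbb D$, let $v_1,\dots,v_n$ be positive integers, and let $f\in A^2_{s-2}$ be non-zero with a zero of order at least $v_i$ at every point of $O_i$, for each $i$. Then there is a wandering subspace $W\subseteq A^2_{s-2}$ for $\pi_s$ restricted to $\Gamma$, of dimension $t=\sum_{i=1}^n v_i$, such that $\pi_s(\gamma)(f)\in W^\perp$ for all $\gamma\in\Gamma$.
   Context: A Fuchsian group is a discrete finite-covolume subgroup of $PSL_2(\mathbb R)$; it acts on the upper half plane $\mathbb H$ by $g(z)=\frac{az+b}{cz+d}$ and on the unit disc $\mathbb D$ by conjugating with the Cayley transform $C(z)=\frac{z-i}{z+i}$. A group is orderable if it admits a total order $<$ invariant under left translation: $\alpha<\beta\iff\gamma\alpha<\gamma\beta$ for all $\gamma$. For real $s>1$, $A^2_{s-2}$ is the weighted Bergman space: holomorphic functions on $\mathbb D$ square integrable for $(1-r^2)^{s-2}r\,dr\,d\theta$, equivalently holomorphic functions on $\mathbb H$ square integrable for $y^{s-2}dx\,dy$, the two models being identified by $f\mapsto\check f$, $\check f(z)=\left(\frac{2}{z+i}\right)^s f\left(\frac{z-i}{z+i}\right)$. The projective unitary representation $\pi_s$ of $PSL_2(\mathbb R)$ on $A^2_{s-2}$ is given in the $\mathbb H$ model by $$(\pi_s(g^{-1})f)(z)=\frac{1}{(cz+d)^s}f(g(z)),\qquad g=\begin{pmatrix}a&b\\c&d\end{pmatrix},$$ where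 $(cz+d)^s$ is defined by a fixed choice, for each $g$, of a branch of $\log(cz+d)$ on $\mathbb H$ (other choices change $\pi_s(g)$ by a scalar of modulus one). A subspace $V$ of the Hilbert space of a projective unitary representation $\pi$ of $\Gamma$ is wandering if $\pi(\gamma)(V)\perp V$ for all $\gamma\ne 1$ in $\Gamma$. *)

(* Defs.v *)
From HB Require Import structures.
From mathcomp Require Import all_boot all_order all_algebra.
From mathcomp Require Import complex.
From mathcomp Require Import all_classical all_reals all_analysis.

Set Implicit Arguments.
Unset Strict Implicit.
Unset Printing Implicit Defensive.

Import Order.TTheory GRing.Theory Num.Theory numFieldNormedType.Exports.

Local Open Scope classical_set_scope.
Local Open Scope ring_scope.
Local Open Scope complex_scope.
Local Open Scope quotient_scope.

Record SL2 (R : realType) := MkSL2 { SL2val :> 'M[R]_2; _ : \det SL2val == 1 }.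

HB.instance Definition _ (R : realType) := [isSub for @SL2val R].
HB.instance Definition _ (R : realType) := [Choice of SL2 R by <:].

Section SL2_group.
Variable R : realType.
Implicit Types x y z : SL2 R.

Lemma det_SL2 x : \det x = 1.
Proof. by case: x => m /= /eqP. Qed.

Lemma unit_SL2 x : SL2val x \is a GRing.unit.
Proof. by rewrite -[_ \is a _]/(_ \in unitmx) unitmxE det_SL2 unitr1. Qed.

Fact SL2_one_subproof : \det (1 : 'M[R]_2) == 1.
Proof. by rewrite det1. Qed.

Fact SL2_mul_subproof x y : \det (SL2val x * SL2val y) == 1.
Proof. by rewrite det_mulmx !det_SL2 mulr1. Qed.

Fact SL2_inv_subproof x : \det (SL2val x)^-1 == 1.
Proof. by rewrite det_inv det_SL2 invr1. Qed.

Definition SL2_one := MkSL2 SL2_one_subproof.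
Definition SL2_mul x y := MkSL2 (SL2_mul_subproof x y).
Definition SL2_inv x := MkSL2 (SL2_inv_subproof x).

Fact SL2_mulA : associative SL2_mul.
Proof. by move=> x y z; apply/val_inj; rewrite /= mulrA. Qed.

Fact SL2_mul1 : left_id SL2_one SL2_mul.
Proof. by move=> x; apply/val_inj; rewrite /= mul1r. Qed.

Fact SL2_mul1r : right_id SL2_one SL2_mul.
Proof. by move=> x; apply/val_inj; rewrite /= mulr1. Qed.

Fact SL2_mulV : left_inverse SL2_one SL2_inv SL2_mul.
Proof. by move=> x; apply/val_inj; rewrite /= mulVr// unit_SL2. Qed.

Fact SL2_mulVr : right_inverse SL2_one SL2_inv SL2_mul.
Proof. by move=> x; apply/val_inj; rewrite /= mulrV// unit_SL2. Qed.

HB.instance Definition _ := isGroup.Build (SL2 R)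
  SL2_mulA SL2_mul1 SL2_mul1r SL2_mulV SL2_mulVr.

HB.instance Definition _ := Topological.copy (SL2 R)
  (initial_topology (@SL2val R)).

Definition PSL2_eqv x y := (SL2val x == SL2val y) || (SL2val x == - SL2val y).

Fact PSL2_eqv_refl : reflexive PSL2_eqv.
Proof. by move=> x; rewrite /PSL2_eqv eqxx. Qed.

Fact PSL2_eqv_sym : symmetric PSL2_eqv.
Proof.
by move=> x y; rewrite /PSL2_eqv eq_sym [X in _ || X]eq_sym eqr_oppLR.
Qed.

Fact PSL2_eqv_trans : transitive PSL2_eqv.
Proof.
move=> y x z; rewrite /PSL2_eqv.
move=> /orP[]/eqP-> /orP[]/eqP->; rewrite ?opprK ?eqxx ?orbT//.
Qed.

Canonical PSL2_equiv := EquivRel PSL2_eqv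
  PSL2_eqv_refl PSL2_eqv_sym PSL2_eqv_trans.

End SL2_group.

Definition PSL2 (R : realType) := {eq_quot (@PSL2_equiv R)}.

HB.instance Definition _ (R : realType) := Choice.on (PSL2 R).
HB.instance Definition _ (R : realType) := EqQuotient.on (PSL2 R).

Section PSL2_group.
Variable R : realType.
Implicit Types (x y : SL2 R) (g h : PSL2 R).

Definition PSL2_class x : PSL2 R := \pi x.

Lemma PSL2_classK g : PSL2_class (repr g) = g.
Proof. exact: reprK. Qed.

Lemma PSL2_classP x y :
  PSL2_class x = PSL2_class y <->
  SL2val x = SL2val y \/ SL2val x = - SL2val y.
Proof.
split=> [/eqmodP /orP[]/eqP|H]; [by left|by right|].
by apply/eqmodP; apply/orP; case: H => ->; rewrite eqxx; [left|right].
Qed.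

Definition PSL2_mul g h := PSL2_class (repr g * repr h)%g.
Definition PSL2_inv g := PSL2_class (repr g)^-1%g.
Definition PSL2_one := PSL2_class 1%g.

Lemma repr_PSL2_class x :
  SL2val (repr (PSL2_class x)) = SL2val x \/
  SL2val (repr (PSL2_class x)) = - SL2val x.
Proof. by apply/PSL2_classP; rewrite PSL2_classK. Qed.

Lemma PSL2_classM x y :
  PSL2_mul (PSL2_class x) (PSL2_class y) = PSL2_class (x * y)%g.
Proof.
apply/PSL2_classP => /=.
case: (repr_PSL2_class x) => ->; case: (repr_PSL2_class y) => ->;
  rewrite ?mulNr ?mulrN ?opprK; by [left|right].
Qed.

Lemma PSL2_classV x : PSL2_inv (PSL2_class x) = PSL2_class x^-1%g.
Proof.
apply/PSL2_classP => /=.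
by case: (repr_PSL2_class x) => ->; rewrite ?invrN; [left|right].
Qed.

Fact PSL2_mulA : associative PSL2_mul.
Proof.
move=> g h k; rewrite -(PSL2_classK g) -(PSL2_classK h) -(PSL2_classK k).
by rewrite !PSL2_classM mulgA.
Qed.

Fact PSL2_mul1 : left_id PSL2_one PSL2_mul.
Proof. by move=> g; rewrite -(PSL2_classK g) PSL2_classM mul1g. Qed.

Fact PSL2_mul1r : right_id PSL2_one PSL2_mul.
Proof. by move=> g; rewrite -(PSL2_classK g) PSL2_classM mulg1. Qed.

Fact PSL2_mulV : left_inverse PSL2_one PSL2_inv PSL2_mul.
Proof.
by move=> g; rewrite -(PSL2_classK g) PSL2_classV PSL2_classM mulVg.
Qed.

Fact PSL2_mulVr : right_inverse PSL2_one PSL2_inv PSL2_mul.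
Proof.
by move=> g; rewrite -(PSL2_classK g) PSL2_classV PSL2_classM mulgV.
Qed.

HB.instance Definition _ := isGroup.Build (PSL2 R)
  PSL2_mulA PSL2_mul1 PSL2_mul1r PSL2_mulV PSL2_mulVr.

End PSL2_group.

Section Bergman.
Variable R : realType.
Local Notation C := R[i].

Definition upper_half_plane : set C := [set z | 0 < complex.Im z].

Definition unit_disc : set C := [set z | `|z| < 1].

Definition cayley (z : C) : C := (z - 'i) / (z + 'i).

Definition cayley_inv (w : C) : C := 'i * (1 + w) / (1 - w).

(* The factor [c z + d] of the matrix [[a, b], [c, d]]. *)
Definition cocycle (m : 'M[R]_2) (z : C) : C := (m 1 0)%:C * z + (m 1 1)%:C.

(* Independent of the representative: both terms change sign with the matrix. *)
Definition mobius (g : PSL2 R) (z : C) : C :=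
  let m := SL2val (repr g) in
  ((m 0 0)%:C * z + (m 0 1)%:C) / cocycle m z.

Definition disc_mobius (g : PSL2 R) (w : C) : C :=
  cayley (mobius g (cayley_inv w)).

Definition is_disc_orbit (G : set (PSL2 R)) (O : set C) : Prop :=
  exists2 w, unit_disc w & O = [set disc_mobius g w | g in G].

Definition leb2 := (@lebesgue_measure R \x @lebesgue_measure R)%E.

Definition coords (A : set C) : set (measurableTypeR R * measurableTypeR R) :=
  [set p | A (p.1 +i* p.2)].

Definition hyperbolic_area (A : set C) : \bar R :=
  (\int[leb2]_(p in coords A) ((p.2 ^+ 2)^-1)%:E)%E.

Definition fundamental_domain (G : set (PSL2 R)) (F : set C) : Prop :=
  [/\ measurable (coords F),
      F `<=` upper_half_plane,
      forall z, upper_half_plane z -> exists2 g, G g & F (mobius g z) &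
      forall g, G g -> g <> 1%g ->
        leb2.-negligible (coords (F `&` mobius g @` F))].

Definition finite_covolume (G : set (PSL2 R)) : Prop :=
  exists2 F, fundamental_domain G F & (hyperbolic_area F < +oo)%E.

Definition is_subgroup (G : set (PSL2 R)) : Prop :=
  G 1%g /\ forall g h, G g -> G h -> G (g * h^-1)%g.

Definition discrete_subset (G : set (PSL2 R)) : Prop :=
  forall g, G g -> exists2 U : set (quotient_topology (PSL2 R)),
    open U & U `&` G = [set g].

Definition fuchsian (G : set (PSL2 R)) : Prop :=
  [/\ is_subgroup G, discrete_subset G & finite_covolume G].

Definition orderable (G : set (PSL2 R)) : Prop :=
  exists lt : PSL2 R -> PSL2 R -> Prop,
  [/\ forall a, G a -> ~ lt a a,
      forall a b c, G a -> G b -> G c -> lt a b -> lt b c -> lt a c,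
      forall a b, G a -> G b -> a <> b -> lt a b \/ lt b a &
      forall a b c, G a -> G b -> G c ->
        (lt a b <-> lt (c * a)%g (c * b)%g)].

Definition holomorphic_at (f : C -> C) (z : C) : Prop :=
  derivable (f : C^o -> C^o) z 1.

Definition zero_order_ge (f : C -> C) (p : C) (v : nat) : Prop :=
  exists h : C -> C,
    (\forall z \near (p : C^o), holomorphic_at h z) /\
    (\forall z \near (p : C^o), f z = (z - p) ^+ v * h z).

Definition cexp (z : C) : C :=
  (expR (complex.Re z))%:C *
  (cos (complex.Im z) +i* sin (complex.Im z)).

Definition is_log_branch (U : set C) (h l : C -> C) : Prop :=
  (forall z, U z -> {for z, continuous (l : C^o -> C^o)}) /\
  (forall z, U z -> cexp (l z) = h z).

(* [h z ^ s] for the branch [l] of [log h]. *)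
Definition cpow (l : C -> C) (s : R) (z : C) : C := cexp (s%:C * l z).

(* A choice, for each [g] in PSL_2(R), of a matrix [[a, b], [c, d]] of [g] and
   of a branch of [log (c z + d)] on the upper half-plane. *)
Definition is_cocycle_log (l : PSL2 R -> C -> C) : Prop :=
  forall g, exists2 m : SL2 R, PSL2_class m = g &
    is_log_branch upper_half_plane (cocycle m) (l g).

(* A branch of [log (2 / (z + i))], used to pass between the two models. *)
Definition is_cayley_log (l0 : C -> C) : Prop :=
  is_log_branch upper_half_plane (fun z => 2 / (z + 'i)) l0.

Definition polar (p : R * R) : C := (p.1 * cos p.2) +i* (p.1 * sin p.2).

Definition polar_disc : set (measurableTypeR R * measurableTypeR R) :=
  `[0, 1[%classic `*` `[0, 2 * pi[%classic.

(* Density of the weighted measure in polar coordinates [p = (r, theta)]. *)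
Definition bergman_weight (s : R) (p : R * R) : R :=
  (1 - p.1 ^+ 2) `^ (s - 2) * p.1.

(* The weighted Bergman space on the disc. Its elements are represented by
   functions on the whole plane that vanish outside the disc, so that equality
   in the space is equality of functions. *)
Definition bergman (s : R) : set (C -> C) := [set f |
  [/\ forall w, ~ unit_disc w -> f w = 0,
      forall w, unit_disc w -> holomorphic_at f w &
      leb2.-integrable polar_disc
        (fun p => (complex.Re `|f (polar p)| ^+ 2 * bergman_weight s p)%:E)]].

Definition bergman_inner (s : R) (f g : C -> C) : C :=
  (\int[leb2]_(p in polar_disc)
     (complex.Re (f (polar p) * (g (polar p))^*) * bergman_weight s p))%R +i*
  (\int[leb2]_(p in polar_disc)
     (complex.Im (f (polar p) * (g (polar p))^*) * bergman_weight s p))%R.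

Definition orthocomplement (s : R) (V : set (C -> C)) : set (C -> C) :=
  [set f | bergman s f /\ forall g, V g -> bergman_inner s f g = 0].

(* [f |-> \check f], from the disc to the half-plane model, and its inverse *)
Definition to_half_plane (s : R) (l0 : C -> C) (f : C -> C) (z : C) : C :=
  cpow l0 s z * f (cayley z).

Definition to_disc (s : R) (l0 : C -> C) (f : C -> C) (w : C) : C :=
  if w \in unit_disc then (cpow l0 s (cayley_inv w))^-1 * f (cayley_inv w)
  else 0.

Definition half_plane_rep (s : R) (l : PSL2 R -> C -> C) (g : PSL2 R)
    (f : C -> C) (z : C) : C :=
  (cpow (l g^-1%g) s z)^-1 * f (mobius g^-1%g z).

Definition bergman_rep (s : R) (l0 : C -> C) (l : PSL2 R -> C -> C)
    (g : PSL2 R) (f : C -> C) : C -> C :=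
  to_disc s l0 (half_plane_rep s l g (to_half_plane s l0 f)).

Definition subspace_of_dim (W : set (C -> C)) (t : nat) : Prop :=
  exists e : 'I_t -> C -> C,
    (forall c : 'I_t -> C,
       (forall w, \sum_i c i * e i w = 0) -> forall i, c i = 0) /\
    W = [set f | exists c : 'I_t -> C, forall w, f w = \sum_i c i * e i w].

Definition wandering (s : R) (rep : PSL2 R -> (C -> C) -> C -> C)
    (G : set (PSL2 R)) (V : set (C -> C)) : Prop :=
  forall g, G g -> g <> 1%g -> rep g @` V `<=` orthocomplement s V.

End Bergman.

(* Main.v *)
(** Let [p_1, .., p_n] be base points of the orbits. Consider the closed subspace
    [M] of functions with a zero of order at least [v_i] at [g p_i] for all
    [g <= 1] in [G], and the larger space [M'] where only [g < 1] is required. By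
    left invariance of the order, [pi_s g] maps [M'] into [M] for [g > 1], hence
    any subspace of the orthocomplement of [M] in [M'] is wandering (for [g < 1]
    one uses the adjoint), and it is orthogonal to [M], which contains the whole
    orbit of [f]. Dividing [f] by powers of the Blaschke factor of [p_i] gives, for
    [j < v_i], a function of [M'] with a zero of order exactly [j] at [p_i] and of
    order at least [v_k] at the other [p_k]; comparing orders, these
    [\sum_i v_i] functions are independent modulo [M]. This uses that [G] acts
    freely: by discreteness the stabiliser of a point consists of elements of finite
    order, and an orderable group is torsion free.

    Unitarity of [pi_s] comes from the reproducing kernel
    [K(a, b) = (1 - a conj(b))^(-s)], up to a constant: if
    [K(phi a, phi b) J(a) conj(J(b)) = K(a, b)] then [f |-> J (f o phi)] permutes
    the kernel functions up to scalars and is therefore unitary. *)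
Require Import Defs.
From HB Require Import structures.
From mathcomp Require Import all_boot all_order all_algebra.
From mathcomp Require Import ring lra.
From mathcomp Require Import complex.
From mathcomp Require Import all_classical all_reals all_analysis.
From mathcomp Require Import measurable_realfun.

Set Implicit Arguments.
Unset Strict Implicit.
Unset Printing Implicit Defensive.

Import Order.TTheory GRing.Theory Num.Theory numFieldNormedType.Exports.
Import ComplexField.Normc.

Local Open Scope classical_set_scope.
Local Open Scope ring_scope.
Local Open Scope complex_scope.

(** * Complex numbers and complex derivatives *)

(** The disc integrals serve to show that the squared norm of a function with Taylor coefficients
    a_n is the sum of [bweight n] times |a_n|^2. The space thus becomes a weighted l2 space, in
    which completeness, projections and the reproducing kernel are statements about sequences; this
    is why unitarity is read off from kernel functions instead of from a change of variables in a
    double integral. As membership in the space only gives differentiability at each point, the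
    Taylor expansion has to start from Goursat's lemma.

    Since [s] is real, the kernel identity does not follow from the rational identity for 1 - a
    conj(b): logarithms have to be added, and their branches might differ by multiples of 2 pi i.
    Deforming the two points to the origin excludes this.

    Orders of zeros are treated as growth estimates. An operator attached to some element of the
    whole group PSL_2(R) moves the point to 0, where the estimate says that the first Taylor
    coefficients vanish. These are bounded functionals, so M and M' are closed and orthogonal
    projections onto them exist. *)

Section ComplexModulus.
Variable R : realType.
Local Notation C := R[i].
Implicit Types (z w : C) (x : R).

Lemma normcE z : `|z| = (normc z)%:C.
Proof. by case: z => a b; rewrite normc_def. Qed.

Lemma normc_ge0 z : 0 <= normc z.
Proof. by case: z => a b; apply: sqrtr_ge0. Qed.

Lemma normc_eq0 z : (normc z == 0) = (z == 0).
Proof. by apply/eqP/eqP => [/eq0_normc//|->]; rewrite normc0. Qed.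

Lemma normc_gt0 z : (0 < normc z) = (z != 0).
Proof. by rewrite lt_def normc_ge0 andbT normc_eq0. Qed.

Lemma normcBC z w : normc (z - w) = normc (w - z).
Proof. by rewrite -normcN opprB. Qed.

Lemma normcB z w : normc (z - w) <= normc z + normc w.
Proof. by rewrite -(normcN w); exact: le_normcD. Qed.

Lemma normcX z n : normc (z ^+ n) = normc z ^+ n.
Proof. by elim: n => [|n IH]; rewrite ?expr0 ?normc1// !exprS normcM IH. Qed.

Lemma normcR x : normc x%:C = `|x|.
Proof. by rewrite /= expr0n/= addr0 sqrtr_sqr. Qed.

Lemma normcJ z : normc (conjc z) = normc z.
Proof. by case: z => a b /=; rewrite sqrrN. Qed.

Lemma sqr_normc z : normc z ^+ 2 = complex.Re z ^+ 2 + complex.Im z ^+ 2.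
Proof. by case: z => a b /=; rewrite sqr_sqrtr// addr_ge0// sqr_ge0. Qed.

Lemma mulcJ z : z * conjc z = (normc z ^+ 2)%:C.
Proof. by rewrite sqr_normc; case: z => a b /=; simpc; congr (_ +i* _); ring. Qed.

Lemma normRe_le z : `|complex.Re z| <= normc z.
Proof.
rewrite -(@ler_pXn2r _ 2)// ?nnegrE ?normc_ge0//.
by rewrite sqr_normc real_normK ?num_real// lerDl sqr_ge0.
Qed.

Lemma normIm_le z : `|complex.Im z| <= normc z.
Proof.
rewrite -(@ler_pXn2r _ 2)// ?nnegrE ?normc_ge0//.
by rewrite sqr_normc real_normK ?num_real// lerDr sqr_ge0.
Qed.

Lemma normc_leD z : normc z <= `|complex.Re z| + `|complex.Im z|.
Proof.
rewrite -(@ler_pXn2r _ 2)// ?nnegrE ?normc_ge0// ?addr_ge0//.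
rewrite sqr_normc sqrrD !real_normK ?num_real//.
by rewrite lerD2r lerDl mulrn_wge0// mulr_ge0.
Qed.

Lemma ReB z w : complex.Re (z - w) = complex.Re z - complex.Re w.
Proof. by case: z w => a b [c d]. Qed.
Lemma ImB z w : complex.Im (z - w) = complex.Im z - complex.Im w.
Proof. by case: z w => a b [c d]. Qed.
Lemma ReD z w : complex.Re (z + w) = complex.Re z + complex.Re w.
Proof. by case: z w => a b [c d]. Qed.
Lemma ImD z w : complex.Im (z + w) = complex.Im z + complex.Im w.
Proof. by case: z w => a b [c d]. Qed.
Lemma ReM z w : complex.Re (z * w) =
  complex.Re z * complex.Re w - complex.Im z * complex.Im w.
Proof. by case: z w => a b [c d]. Qed.
Lemma ImM z w : complex.Im (z * w) =
  complex.Re z * complex.Im w + complex.Im z * complex.Re w.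
Proof. by case: z w => a b [c d]. Qed.

Lemma normc_sum_le (I : Type) (r : seq I) (P : pred I) (F : I -> C) :
  normc (\sum_(i <- r | P i) F i) <= \sum_(i <- r | P i) normc (F i).
Proof.
elim/big_rec2: _ => [|i y x Pi le]; first by rewrite normc0.
by rewrite (le_trans (le_normcD _ _))// lerD2l.
Qed.

Lemma unit_discE z : unit_disc z <-> normc z < 1.
Proof. by rewrite /unit_disc/= normcE -[1]/(1%:C) ltcR. Qed.

Lemma normc_small_eq0 z : (forall e, 0 < e -> normc z <= e) -> z = 0.
Proof.
move=> h; apply/eqP; rewrite -normc_eq0 eq_le normc_ge0 andbT.
by apply/ler_addgt0Pr => e e0; rewrite add0r h.
Qed.

End ComplexModulus.

(** * Complex limits and derivatives through real error bounds *)

Section ComplexLimits.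
Variable R : realType.
Local Notation C := R[i].
Implicit Types (f g : C -> C) (z w d : C).

Lemma gt0_complexP z : 0 < z -> exists2 x : R, 0 < x & z = x%:C.
Proof.
by rewrite ltcE => /andP[/eqP zi z0]; exists (complex.Re z); case: z zi z0 => a b //= ->.
Qed.

(** Radii in [C^o] are elements of [R[i]], and positivity there forces them to be real. From here on
    all estimates are made in [R], where [lra] and [nra] apply. *)
Lemma nbhs_complexP z (P : C -> Prop) :
  (\forall w \near (z : C^o), P w) <->
  exists2 e : R, 0 < e & forall w, normc (w - z) < e -> P w.
Proof.
split=> [/nbhs_normP[e /= e0 H]|[e e0 H]].
  move: e0 H => /gt0_complexP[x x0 ->] H.
  exists x => // w wz; apply: H => /=.
  by rewrite normcE ltcR normcBC.
apply/nbhs_normP; exists e%:C => /=; first by rewrite ltcR.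
by move=> w /=; rewrite normcE ltcR normcBC => /H.
Qed.

Lemma continuous_complexP f z :
  {for z, continuous (f : C^o -> C^o)} <->
  forall e, 0 < e -> exists2 d : R, 0 < d &
    forall w, normc (w - z) < d -> normc (f w - f z) < e.
Proof.
split=> [/cvgrPdist_lt H e e0|H].
  have /H/nbhs_complexP[d d0 Hd] : 0 < e%:C :> C by rewrite ltcR.
  by exists d => // w /Hd; rewrite normcE ltcR normcBC.
apply: (proj2 (@cvgrPdist_lt C C^o _ (nbhs (z : C^o)) (nbhs_filter _)
  (f : C -> C^o) (f z))) => _ /gt0_complexP[e e0 ->].
have [d d0 Hd] := H _ e0; apply/nbhs_complexP; exists d => // w /Hd.
by rewrite normcE ltcR normcBC.
Qed.

(** The difference quotient is multiplied out by [h], with a non-strict bound, so that [h = 0] is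
    allowed; the chain rule then needs no case distinction. *)
Definition cderiv f z d := forall e, 0 < e -> exists2 dl : R, 0 < dl &
  forall h, normc h < dl -> normc (f (z + h) - f z - d * h) <= e * normc h.

Lemma normc_growth f z d h : h != 0 ->
  normc (d - h^-1 *: ((f (h *: (1 : C^o) + z) : C^o) - f z)) * normc h =
  normc (f (z + h) - f z - d * h).
Proof.
move=> h0; rewrite -normcM -normcN; congr normc.
by rewrite /GRing.scale/= mulr1 (addrC h); field.
Qed.

Lemma is_derive_cderiv f z d :
  is_derive (z : C^o) (1 : C^o) (f : C^o -> C^o) d <-> cderiv f z d.
Proof.
have eqv : (h^-1 *: ((f (h *: 1 + z) : C^o) - f z) @[h --> (0 : C^o)^'] --> (d : C^o))
    <-> cderiv f z d.
  split=> [/cvgrPdist_lt H e e0|H].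
    have /H/nbhs_complexP[dl dl0 Hd] : 0 < e%:C :> C by rewrite ltcR.
    exists dl => // h hd; have [->|h0] := eqVneq h 0.
      by rewrite addr0 mulr0 subrr subr0 normc0 mulr0.
    have := Hd h; rewrite subr0 => /(_ hd h0).
    rewrite normcE ltcR => /ltW le.
    by rewrite -normc_growth// ler_wpM2r// normc_ge0.
  apply/(@cvgrPdist_lt C C^o) => _ /gt0_complexP[e e0 ->].
  have [dl dl0 Hd] := H _ (divr_gt0 e0 (ltr0n _ 2)).
  apply/nbhs_complexP; exists dl => // h; rewrite subr0 => /Hd le h0.
  rewrite normcE ltcR; apply: (@le_lt_trans _ _ (e / 2)); last lra.
  by rewrite -normc_growth// ler_pM2r ?normc_gt0 in le.
split=> [[ex ed]|/eqv H]; first by apply/eqv; rewrite -ed; exact: ex.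
apply: DeriveDef; first by apply/cvg_ex; exists d.
by apply/cvg_lim => //; exact: norm_hausdorff.
Qed.

Lemma holomorphic_atP f z : holomorphic_at f z <-> exists d, cderiv f z d.
Proof.
split=> [/derivableP/is_derive_cderiv H|[d /is_derive_cderiv[//]]].
by eexists; exact: H.
Qed.

Lemma cderiv_holo f z d : cderiv f z d -> holomorphic_at f z.
Proof. by move=> H; apply/holomorphic_atP; exists d. Qed.

Lemma cderiv_ext f g z d (r : R) : 0 < r ->
  (forall w, normc (w - z) < r -> f w = g w) -> cderiv f z d -> cderiv g z d.
Proof.
move=> r0 fg H e e0; have [dl dl0 Hd] := H _ e0.
exists (Num.min dl r) => [|h]; first by rewrite lt_min dl0.
rewrite lt_min => /andP[h1 h2]; rewrite -!fg ?subrr ?normc0//; last first.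
  by rewrite [z + h]addrC addrK.
exact: Hd.
Qed.

Lemma cderiv_cst z (c : C) : cderiv (fun=> c) z 0.
Proof. by apply/is_derive_cderiv; exact: is_derive_cst. Qed.

Lemma cderiv_id z : cderiv id z 1.
Proof. by apply/is_derive_cderiv; exact: is_derive_id. Qed.

Lemma cderivD f g z df dg : cderiv f z df -> cderiv g z dg ->
  cderiv (fun w => f w + g w) z (df + dg).
Proof.
move=> /is_derive_cderiv hf /is_derive_cderiv hg.
by apply/is_derive_cderiv; exact: is_deriveD.
Qed.

Lemma cderivN f z df : cderiv f z df -> cderiv (fun w => - f w) z (- df).
Proof.
by move=> /is_derive_cderiv hf; apply/is_derive_cderiv; exact: is_deriveN.
Qed.

Lemma cderivB f g z df dg : cderiv f z df -> cderiv g z dg ->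
  cderiv (fun w => f w - g w) z (df - dg).
Proof. by move=> hf hg; apply: cderivD => //; exact: cderivN. Qed.

Lemma cderivM f g z df dg : cderiv f z df -> cderiv g z dg ->
  cderiv (fun w => f w * g w) z (f z * dg + g z * df).
Proof.
move=> /is_derive_cderiv hf /is_derive_cderiv hg.
exact/is_derive_cderiv.
Qed.

Lemma cderivX f z df n : cderiv f z df ->
  exists d, cderiv (fun w => f w ^+ n) z d.
Proof.
move=> hf; elim: n => [|n [d IH]].
  exists 0; exact: (cderiv_cst z 1).
exists (f z * d + f z ^+ n * df).
apply: (cderiv_ext ltr01 (f := fun w => f w * f w ^+ n)); last exact: cderivM.
by move=> w _; rewrite exprS.
Qed.

Lemma cderivV f z df : f z != 0 -> cderiv f z df ->
  exists d, cderiv (fun w => (f w)^-1) z d.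
Proof.
move=> f0 /is_derive_cderiv [hf _]; apply/holomorphic_atP.
exact: (@derivableV _ C^o (f : C^o -> C)).
Qed.

Lemma cderiv_lip f z d : cderiv f z d -> exists2 dl : R, 0 < dl &
  forall h, normc h < dl -> normc (f (z + h) - f z) <= (normc d + 1) * normc h.
Proof.
move=> H; have [dl dl0 Hd] := H _ ltr01; exists dl => // h /Hd le.
rewrite -[f (z + h) - f z](subrK (d * h)) (le_trans (le_normcD _ _))//.
by rewrite normcM mulrDl addrC lerD2l.
Qed.

Lemma cderiv_cont f z d : cderiv f z d -> {for z, continuous (f : C^o -> C^o)}.
Proof.
move=> /cderiv_lip[dl dl0 Hd]; apply/continuous_complexP => e e0.
have m0 : 0 < normc d + 1 by rewrite ltr_wpDl// normc_ge0.
exists (Num.min dl (e / (normc d + 1))) => [|w].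
  by rewrite lt_min dl0 divr_gt0.
rewrite lt_min => /andP[/Hd]; rewrite [z + _]addrC subrK => le we.
by apply: le_lt_trans le _; rewrite mulrC -ltr_pdivlMr.
Qed.

Lemma cderiv_comp f g z df dg : cderiv f z df -> cderiv g (f z) dg ->
  cderiv (fun w => g (f w)) z (dg * df).
Proof.
move=> hf hg e e0.
set M := normc df + 1; have M0 : 0 < M by rewrite ltr_wpDl// normc_ge0.
set N := normc dg + 1; have N0 : 0 < N by rewrite ltr_wpDl// normc_ge0.
have e1 : 0 < e / 2 / M by rewrite !divr_gt0.
have e2 : 0 < e / 2 / N by rewrite !divr_gt0.
have [d1 d10 H1] := hg _ e1.
have [d2 d20 H2] := hf _ e2.
have [d3 d30 H3] := cderiv_lip hf.
exists (Num.min (Num.min d2 d3) (d1 / M)) => [|h].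
  by rewrite !lt_min d20 d30 divr_gt0.
rewrite !lt_min => /andP[/andP[/H2 h2 /H3 h3] h1].
have := H1 (f (z + h) - f z).
rewrite [f z + _]addrC subrK => /(_ _)/wrap[].
  by apply: le_lt_trans h3 _; rewrite mulrC -ltr_pdivlMr.
move=> le.
rewrite (_ : _ - _ = (g (f (z + h)) - g (f z) - dg * (f (z + h) - f z)) +
   dg * (f (z + h) - f z - df * h)); last ring.
rewrite (le_trans (le_normcD _ _))// normcM.
rewrite (_ : e * normc h = e / 2 / M * (M * normc h) + N * (e / 2 / N * normc h)).
  apply: lerD.
    by apply: le_trans le _; apply: ler_wpM2l => //; exact: ltW.
  by apply: ler_pM; rewrite ?normc_ge0// /N lerDl.
by field; rewrite !gt_eqF.
Qed.

End ComplexLimits.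

Lemma cderiv_unique (R : realType) (f : R[i] -> R[i]) z d d' :
  cderiv f z d -> cderiv f z d' -> d = d'.
Proof.
move=> /is_derive_cderiv h /is_derive_cderiv h'.
by rewrite -(@derive_val _ _ _ _ _ _ _ h) -(@derive_val _ _ _ _ _ _ _ h').
Qed.

(** * The complex exponential *)

Section ComplexExponential.
Variable R : realType.
Local Notation C := R[i].
Implicit Types (f g L : C -> C) (z w : C) (x y : R).

Lemma cexpD z w : cexp (z + w) = cexp z * cexp w.
Proof.
case: z w => [a b] [c d]; rewrite /cexp /= expRD sinD cosD; simpc.
by congr (_ +i* _); ring.
Qed.

Lemma cexp0 : cexp 0 = 1 :> C.
Proof. by rewrite /cexp /= expR0 cos0 sin0; simpc. Qed.

Lemma cexpR x : cexp x%:C = (expR x)%:C.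
Proof. by rewrite /cexp /= cos0 sin0; simpc. Qed.

Lemma normc_cexp z : normc (cexp z) = expR (complex.Re z).
Proof.
rewrite /cexp normcM normcR ger0_norm ?expR_ge0//= cos2Dsin2 sqrtr1.
by rewrite mulr1.
Qed.

Lemma cexp_neq0 z : cexp z != 0.
Proof. by rewrite -normc_gt0 normc_cexp expR_gt0. Qed.

Lemma cexpN z : cexp (- z) = (cexp z)^-1.
Proof.
by apply: (mulfI (cexp_neq0 z)); rewrite -cexpD subrr cexp0 divff// cexp_neq0.
Qed.

Lemma cexpB z w : cexp (z - w) = cexp z / cexp w.
Proof. by rewrite cexpD cexpN. Qed.

Lemma cexpJ z : cexp (conjc z) = conjc (cexp z).
Proof. by case: z => a b; rewrite /cexp /= cosN sinN; simpc. Qed.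

Lemma cexpMn z n : cexp (z *+ n) = cexp z ^+ n.
Proof. by elim: n => [|n IH]; rewrite ?mulr0n ?cexp0// mulrS cexpD IH exprS. Qed.

Lemma is_derive_real (f : R -> R) x d : is_derive x 1 f d ->
  forall e, 0 < e -> exists2 dl : R, 0 < dl &
  forall h, `|h| < dl -> `|f (x + h) - f x - d * h| <= e * `|h|.
Proof.
move=> [ex <-] e e0.
have : h^-1 *: (f (h *: 1 + x) - f x) @[h --> 0^'] --> 'D_1 f x by exact: ex.
move: ('D_1 f x) => D /cvgrPdist_lt/(_ e e0)/nbhs_normP[dl /= dl0 Hd].
exists dl => // h hd; have [->|h0] := eqVneq h 0.
  by rewrite addr0 mulr0 subrr subr0 normr0 mulr0.
have := Hd h; rewrite /ball_ /= sub0r normrN => /(_ hd h0)/ltW le.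
apply: le_trans (ler_wpM2r (normr_ge0 h) le).
rewrite -normrM -normrN le_eqVlt; apply/orP; left; apply/eqP; congr `|_|.
have -> : h *: (1 : R) = h by exact: mulr1.
by rewrite (addrC h) /GRing.scale/=; field.
Qed.

Lemma cderiv_cexp0 : cderiv (@cexp R) 0 1.
Proof.
(* The four error terms [a1], [a2], [a4], [a3] below cost 1, 2, 4 and 1 eighths of [e * N]. *)
move=> e e0; have e1 : 0 < e / 8 by rewrite divr_gt0.
have [d1 d10 H1] := is_derive_real (is_derive_expR 0) e1.
have [d2 d20 H2] := is_derive_real (is_derive_sin 0) e1.
have [d3 d30 H3] := is_derive_real (is_derive_cos 0) e1.
exists (Num.min (Num.min (Num.min d1 d2) d3) (Num.min 1 (e / 8))) => [|z].
  by rewrite !lt_min d10 d20 d30 e1 ltr01.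
have hx := normRe_le z; have hy := normIm_le z.
rewrite !lt_min => /andP[/andP[/andP[z1 z2] z3] /andP[z4 z5]].
have := H1 _ (le_lt_trans hx z1); have := H2 _ (le_lt_trans hy z2).
have := H3 _ (le_lt_trans hy z3).
rewrite !add0r expR0 cos0 sin0 !mul1r oppr0 mul0r !subr0.
set N := normc z in hx hy z1 z2 z3 z4 z5 *.
have N0 : 0 <= N := normc_ge0 z.
set x := complex.Re z in hx *; set y := complex.Im z in hy *.
have -> : cexp z - cexp 0 - z = ((expR x - 1 - x) * cos y + (1 + x) * (cos y - 1))
    +i* ((expR x - 1) * sin y + (sin y - y)).
  rewrite cexp0 /cexp /x /y; case: (z) => a b /=.
  by rewrite /real_complex_def; simpc; congr (_ +i* _); ring.
move=> hc; rewrite addr0 => hs hE.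
apply: le_trans (normc_leD _) _ => /=.
have c1 := cos_max y; have s1 := sin_max y.
have hE' : `|expR x - 1| <= (e / 8 + 1) * `|x|.
  by rewrite mulrDl mul1r -[expR x - 1](subrK x) (le_trans (ler_normD _ _))// lerD2r.
have hs' : `|sin y| <= (e / 8 + 1) * `|y|.
  by rewrite mulrDl mul1r -[sin y](subrK y) (le_trans (ler_normD _ _))// lerD2r.
have a1 : `|(expR x - 1 - x) * cos y| <= e / 8 * N.
  rewrite normrM -[leRHS]mulr1; apply: ler_pM => //.
  by apply: le_trans hE _; rewrite ler_pM2l.
have a2 : `|(1 + x) * (cos y - 1)| <= 2 * (e / 8 * N).
  rewrite normrM; apply: ler_pM => //.
    by apply: le_trans (ler_normD _ _) _; rewrite normr1; lra.
  by apply: le_trans hc _; rewrite ler_pM2l.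
have a3 : `|sin y - y| <= e / 8 * N.
  by apply: le_trans hs _; rewrite ler_pM2l.
(* A product of two terms of first order. If [e / 8 <= 1], both are at most [2 * N], and one factor
   [N] is below [e / 8]; otherwise the sine is bounded by 1 and [e / 8] absorbs the constant. *)
have a4 : `|(expR x - 1) * sin y| <= 4 * (e / 8 * N).
  have [e8|e8] := leP (e / 8) 1.
    rewrite normrM (@le_trans _ _ ((2 * N) * (2 * N)))//.
      apply: ler_pM => //.
        apply: le_trans hE' _; apply: ler_pM => //; last by rewrite lerD2r.
        by rewrite addr_ge0// ltW.
      apply: le_trans hs' _; apply: ler_pM => //; last by rewrite lerD2r.
      by rewrite addr_ge0// ltW.
    by nra.
  rewrite normrM (@le_trans _ _ ((e / 8 + 1) * N * 1))//.
    apply: ler_pM => //.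
    by apply: le_trans hE' _; apply: ler_pM => //; rewrite addr_ge0// ltW.
  by nra.
have := ler_normD ((expR x - 1 - x) * cos y) ((1 + x) * (cos y - 1)).
have := ler_normD ((expR x - 1) * sin y) (sin y - y).
by lra.
Qed.

Lemma cderiv_cexp z : cderiv (@cexp R) z (cexp z).
Proof.
move=> e e0; have n0 : 0 < normc (cexp z) by rewrite normc_gt0 cexp_neq0.
have [dl dl0 H] := cderiv_cexp0 (divr_gt0 e0 n0).
exists dl => // h /H; rewrite add0r cexp0 mul1r cexpD => le.
rewrite (_ : _ - _ = cexp z * (cexp h - 1 - h)); last ring.
rewrite normcM -ler_pdivlMl// mulrA [_^-1 * e]mulrC; exact: le.
Qed.

(** Continuity makes the increment t of [L] small, so that [cexp t - 1 - t] is at most half of t.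
    Hence t is at most twice [cexp t - 1], which is the relative increment of [f] and of first order
    in h. *)
Lemma cderiv_log f L z df : {for z, continuous (L : C^o -> C^o)} ->
  (\forall w \near (z : C^o), cexp (L w) = f w) -> cderiv f z df ->
  cderiv L z (df / f z).
Proof.
move=> /continuous_complexP cL /nbhs_complexP[r r0 Lf] hf e e0.
have fz : cexp (L z) = f z by apply: Lf; rewrite subrr normc0.
have f0 : f z != 0 by rewrite -fz cexp_neq0.
have n0 : 0 < normc (f z) by rewrite normc_gt0.
set K := (normc df + 1) / normc (f z).
have K0 : 0 < K by rewrite divr_gt0// ltr_wpDl// normc_ge0.
(* The bound 1/2 yields [b2]; the bound [e / 4 / K] turns the estimate [2 * K * normc h] of the
   increment into [e / 2 * normc h]. *)
set e1 := Num.min (1 / 2) (e / 4 / K).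
have e10 : 0 < e1 by rewrite lt_min; apply/andP; split; [lra|rewrite divr_gt0// divr_gt0].
have [d1 d10 H1] := cderiv_cexp0 e10.
have [d2 d20 H2] := cL _ d10.
have [d3 d30 H3] := cderiv_lip hf.
have e20 : 0 < e / 2 * normc (f z) by rewrite mulr_gt0// divr_gt0.
have [d4 d40 H4] := hf _ e20.
exists (Num.min (Num.min d2 d3) (Num.min d4 r)) => [|h].
  by rewrite !lt_min d20 d30 d40.
rewrite !lt_min => /andP[/andP[h2 h3] /andP[h4 hr]].
set t := L (z + h) - L z.
have td : normc t < d1 by apply: H2; rewrite [z + h]addrC addrK.
have Et : cexp t = f (z + h) / f z.
  by rewrite cexpB fz Lf// [z + h]addrC addrK.
have := H1 _ td; rewrite add0r cexp0 mul1r => h1.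
have b1 : normc (cexp t - 1) <= K * normc h.
  rewrite Et (_ : _ - 1 = (f (z + h) - f z) / f z); last by field.
  by rewrite normcM normcV /K mulrAC ler_pM2r ?invr_gt0// H3.
have b2 : normc t <= 2 * K * normc h.
  have : normc t <= normc (cexp t - 1) + normc (cexp t - 1 - t).
    rewrite -{1}(subKr (cexp t - 1) t) (le_trans (normcB _ _))//.
  have : e1 * normc t <= 1 / 2 * normc t.
    by rewrite ler_wpM2r ?normc_ge0// ge_min lexx.
  by lra.
rewrite (_ : _ - _ = - (cexp t - 1 - t) + (f (z + h) - f z - df * h) / f z); last first.
  by rewrite Et; field.
rewrite (le_trans (le_normcD _ _))// normcN.
have : normc ((f (z + h) - f z - df * h) / f z) <= e / 2 * normc h.
  by rewrite normcM normcV ler_pdivrMr// mulrAC; exact: H4.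
have : e1 * normc t <= e / 4 / K * (2 * K * normc h).
  apply: ler_pM => //; [exact: ltW|exact: normc_ge0|].
  by rewrite ge_min lexx orbT.
rewrite (_ : e / 4 / K * (2 * K * normc h) = e / 2 * normc h); last by field; rewrite gt_eqF.
by lra.
Qed.

Lemma cos_eq1_lt y : 0 < `|y| -> `|y| <= pi -> cos y != 1.
Proof.
move=> y0 ypi; have -> : cos y = cos `|y|.
  by have [//|_] := ger0P y; rewrite cosN.
by rewrite -cos0 lt_eqF// ltr_cos// in_itv/= ?lexx ?normr_ge0 ?pi_ge0.
Qed.

(* On a segment a continuous function with values in 2 pi Z is constant. *)
Lemma cexp_eq1_const (E : R -> C) :
  {within `[0, 1], continuous (fun t => complex.Im (E t))} ->
  (forall t, 0 <= t <= 1 -> cexp (E t) = 1) ->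
  E 0 = 0 -> E 1 = 0.
Proof.
move=> cE E1 E0.
have re t : 0 <= t <= 1 -> complex.Re (E t) = 0.
  move=> /E1 h; have := normc_cexp (E t); rewrite h normc1 => /esym/eqP.
  by rewrite -expR0 => /eqP/expR_inj.
have co t : 0 <= t <= 1 -> cos (complex.Im (E t)) = 1.
  move=> t01; have := E1 t t01; rewrite /cexp re// expR0.
  by rewrite mul1r => -[].
suff im : complex.Im (E 1) = 0.
  have := re 1; rewrite ler01 lexx => /(_ isT).
  by case: (E 1) im => a b /= -> ->.
apply/eqP; rewrite -normr_eq0; apply: contraT => ne0.
set y := complex.Im (E 1) in ne0 *.
have y0 : 0 < `|y| by rewrite lt_def ne0 normr_ge0.
(* A nonzero end value would force the intermediate value plus or minus [c]. Capping by pi keeps it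
   in the range where the cosine differs from 1. *)
set c := Num.min `|y| pi.
have c0 : 0 < c by rewrite lt_min y0 pi_gt0.
have [t t01 Et] : exists2 t, t \in `[0, 1] & complex.Im (E t) = Num.sg y * c.
  apply: IVT => //; rewrite E0 /= -/y.
  have [yp|yn|y00] := ltgtP 0 y; last by rewrite -y00 normr0 ltxx in y0.
    by rewrite gtr0_sg// mul1r (ltW c0) /= /c gtr0_norm// ge_min lexx.
  rewrite ltr0_sg// mulN1r oppr_le0 (ltW c0) andbT.
  by rewrite lerNr /c ltr0_norm// ge_min lexx.
have cc : `|Num.sg y * c| = c.
  by rewrite normrM normr_sg -normr_eq0 ne0 mul1r gtr0_norm.
have := @cos_eq1_lt (Num.sg y * c); rewrite cc c0 => /(_ isT).
by rewrite ge_min lexx orbT -Et co ?eqxx// => /(_ isT).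
Qed.

End ComplexExponential.

(** * Goursat's lemma on rectangles *)

Section SegmentIntegral.
Variable R : realType.
Implicit Types (p q : R -> R) (a b c M : R).

Definition cont_seg a b p := forall x, a <= x <= b -> {for x, continuous p}.

Definition rint a b p := \int[@lebesgue_measure R]_(x in `[a, b]) p x.

Lemma cont_seg_integrable a b p : cont_seg a b p ->
  (@lebesgue_measure R).-integrable `[a, b] (EFin \o p).
Proof.
move=> cp; apply: continuous_compact_integrable; first exact: segment_compact.
apply: continuous_in_subspaceT => x; rewrite inE/= in_itv/=; exact: cp.
Qed.

Lemma sub_cont_seg a b c d p : a <= c -> d <= b ->
  cont_seg a b p -> cont_seg c d p.
Proof. by move=> ac db cp x /andP[cx xd]; apply: cp; lra. Qed.

Lemma eq_rint a b p q : (forall x, a <= x <= b -> p x = q x) ->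
  rint a b p = rint a b q.
Proof. by move=> pq; apply: eq_Rintegral => x; rewrite inE/= in_itv/=; exact: pq. Qed.

Lemma rint_split a b c p : a <= b -> b <= c -> cont_seg a c p ->
  rint a c p = rint a b p + rint b c p.
Proof.
move=> ab bc cp; have ip := cont_seg_integrable cp.
have := Rintegral_itvB ip (x := b); rewrite !bnd_simp => /(_ ab bc).
rewrite Rintegral_itv_obnd_cbnd => [e|]; first by rewrite /rint -e addrC subrK.
by apply: integrableS ip => //; apply: subset_itvr; rewrite bnd_simp.
Qed.

Lemma rintD a b p q : cont_seg a b p -> cont_seg a b q ->
  rint a b (fun x => p x + q x) = rint a b p + rint a b q.
Proof. by move=> cp cq; apply: RintegralD => //; exact: cont_seg_integrable. Qed.

Lemma rintB a b p q : cont_seg a b p -> cont_seg a b q ->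
  rint a b (fun x => p x - q x) = rint a b p - rint a b q.
Proof. by move=> cp cq; apply: RintegralB => //; exact: cont_seg_integrable. Qed.

Lemma rintZ a b p k : cont_seg a b p ->
  rint a b (fun x => k * p x) = k * rint a b p.
Proof. by move=> cp; apply: RintegralZl => //; exact: cont_seg_integrable. Qed.

Lemma rint_cst a b k : a <= b -> rint a b (fun=> k) = k * (b - a).
Proof.
move=> ab; rewrite /rint Rintegral_cst//= lebesgue_measure_itv/= lte_fin.
by move: ab; rewrite le_eqVlt => /predU1P[->|-> //]; rewrite ltxx subrr.
Qed.

Lemma cont_seg_cst a b k : cont_seg a b (fun=> k).
Proof. by move=> x _; exact: cvg_cst. Qed.

Lemma rint_le a b p q : cont_seg a b p -> cont_seg a b q ->
  (forall x, a <= x <= b -> p x <= q x) -> rint a b p <= rint a b q.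
Proof.
move=> cp cq pq; apply: le_Rintegral => //; try exact: cont_seg_integrable.
Qed.

Lemma rint_norm_le a b p M : a <= b -> cont_seg a b p ->
  (forall x, a <= x <= b -> `|p x| <= M) -> `|rint a b p| <= M * (b - a).
Proof.
move=> ab cp pM; rewrite ler_norml -mulNr -!rint_cst//.
apply/andP; split; apply: rint_le => //; try exact: cont_seg_cst.
  by move=> x /pM; rewrite ler_norml => /andP[].
by move=> x /pM; rewrite ler_norml => /andP[].
Qed.

Lemma rint_derive a b p (P : R -> R) : a < b -> cont_seg a b p ->
  (forall x : R, a <= x <= b -> is_derive x 1 P (p x)) ->
  rint a b p = P b - P a.
Proof.
move=> ab cp dP; rewrite /rint /Rintegral.
have cP x : a <= x <= b -> {for x, continuous P}.
  move=> /dP[dx _].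
  by apply: differentiable_continuous; apply/derivable1_diffP.
rewrite (@continuous_FTC2 _ p P)//.
- apply: continuous_in_subspaceT => x; rewrite inE/= in_itv/=; exact: cp.
- split.
  + by move=> x; rewrite in_itv/= => /andP[/ltW ax /ltW xb]; have [] := dP x; rewrite ?ax.
  + by apply/cvg_at_right_filter/cP; rewrite lexx ltW.
  + by apply/cvg_at_left_filter/cP; rewrite lexx ltW.
- move=> x; rewrite in_itv/= => /andP[/ltW ax /ltW xb].
  by rewrite derive1E; have [|_ ->] := dP x; rewrite ?ax.
Qed.

End SegmentIntegral.

Section Goursat.
Variable R : realType.
Implicit Types (p q : R -> R -> R).

(* The coefficient [c] shared by both expansions says that [p dx + q dy] is
   closed at the point. *)
Definition closed_form_at p q (x y : R) := exists px c qy : R,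
  forall e, 0 < e -> exists2 dl : R, 0 < dl &
    forall x' y', `|x' - x| < dl -> `|y' - y| < dl ->
    `|p x' y' - p x y - px * (x' - x) - c * (y' - y)| <=
      e * (`|x' - x| + `|y' - y|) /\
    `|q x' y' - q x y - c * (x' - x) - qy * (y' - y)| <=
      e * (`|x' - x| + `|y' - y|).

(** The integral of [p dx + q dy] counterclockwise around the rectangle with sides [[x1, x2]] and
    [[y1, y2]]. *)
Definition boundary_int p q (x1 x2 y1 y2 : R) :=
  rint x1 x2 (p^~ y1) - rint x1 x2 (p^~ y2) +
  (rint y1 y2 (q x2) - rint y1 y2 (q x1)).

Variables (p q : R -> R -> R) (X1 X2 Y1 Y2 : R).
Hypothesis X12 : X1 <= X2.
Hypothesis Y12 : Y1 <= Y2.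
Hypothesis pq_closed : forall x y, X1 <= x <= X2 -> Y1 <= y <= Y2 ->
  closed_form_at p q x y.

Let cont_small (f : R -> R) (x : R) (K : R) : 0 < K ->
  (exists2 dl : R, 0 < dl & forall x', `|x' - x| < dl ->
     `|f x' - f x| <= K * `|x' - x|) -> {for x, continuous f}.
Proof.
move=> K0 [dl dl0 H]; apply/cvgrPdist_lt => e e0.
apply/nbhs_normP; exists (Num.min dl (e / K)) => /=.
  by rewrite lt_min dl0 divr_gt0.
move=> x' /=; rewrite lt_min distrC => /andP[/H h1 h2].
by rewrite distrC; apply: le_lt_trans h1 _; rewrite mulrC -ltr_pdivlMr.
Qed.

Let cp y : Y1 <= y <= Y2 -> cont_seg X1 X2 (p^~ y).
Proof.
move=> hy x hx; have [px [c [qy H]]] := pq_closed hx hy.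
have [dl dl0 Hd] := H 1 ltr01.
apply: (@cont_small _ _ (1 + `|px|)); first by rewrite ltr_pwDl.
exists dl => // x' hx'; have [|+ _] := Hd x' y hx' => //.
  by rewrite subrr normr0.
rewrite subrr normr0 addr0 mulr0 subr0 => le.
rewrite -[p x' y - p x y](subrK (px * (x' - x))) (le_trans (ler_normD _ _))//.
by rewrite mulrDl normrM lerD.
Qed.

Let cq x : X1 <= x <= X2 -> cont_seg Y1 Y2 (q x).
Proof.
move=> hx y hy; have [px [c [qy H]]] := pq_closed hx hy.
have [dl dl0 Hd] := H 1 ltr01.
apply: (@cont_small _ _ (1 + `|qy|)); first by rewrite ltr_pwDl.
exists dl => // y' hy'; have [|_ +] := Hd x y' _ hy' => //.
  by rewrite subrr normr0.
rewrite subrr normr0 add0r mulr0 subr0 => le.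
rewrite -[q x y' - q x y](subrK (qy * (y' - y))) (le_trans (ler_normD _ _))//.
by rewrite mulrDl normrM lerD.
Qed.

Let B := boundary_int p q.

Lemma boundary_int_split x1 x2 x3 y1 y2 y3 :
  X1 <= x1 -> x1 <= x2 -> x2 <= x3 -> x3 <= X2 ->
  Y1 <= y1 -> y1 <= y2 -> y2 <= y3 -> y3 <= Y2 ->
  B x1 x3 y1 y3 = B x1 x2 y1 y2 + B x2 x3 y1 y2 +
                  (B x1 x2 y2 y3 + B x2 x3 y2 y3).
Proof.
move=> h1 h2 h3 h4 k1 k2 k3 k4; rewrite /B /boundary_int.
have sx y : Y1 <= y <= Y2 ->
    rint x1 x3 (p^~ y) = rint x1 x2 (p^~ y) + rint x2 x3 (p^~ y).
  move=> hy; apply: rint_split => //.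
  by apply: sub_cont_seg (cp hy).
have sy x : X1 <= x <= X2 ->
    rint y1 y3 (q x) = rint y1 y2 (q x) + rint y2 y3 (q x).
  move=> hx; apply: rint_split => //.
  by apply: sub_cont_seg (cq hx).
rewrite !sx ?sy; [ring|..]; lra.
Qed.

(** On opposite sides the affine parts of [p] and [q] differ by constants, and these cancel around
    the boundary because both expansions share the coefficient [c]. What remains is at most
    [2 * (e * D)] per unit of length, where [D] is half the perimeter. *)
Let local_small e x0 y0 : 0 < e -> X1 <= x0 <= X2 -> Y1 <= y0 <= Y2 ->
  exists2 dl : R, 0 < dl & forall x1 x2 y1 y2,
    X1 <= x1 -> x1 <= x0 -> x0 <= x2 -> x2 <= X2 ->
    Y1 <= y1 -> y1 <= y0 -> y0 <= y2 -> y2 <= Y2 ->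
    x2 - x1 < dl -> y2 - y1 < dl ->
    `|B x1 x2 y1 y2| <= 2 * e * ((x2 - x1) + (y2 - y1)) ^+ 2.
Proof.
move=> e0 hx0 hy0; have [px [c [qy H]]] := pq_closed hx0 hy0.
have [dl dl0 Hd] := H _ e0; exists dl => // x1 x2 y1 y2 h1 h2 h3 h4 k1 k2 k3 k4 dx dy.
set D := (x2 - x1) + (y2 - y1).
have D0 : 0 <= D by rewrite /D; lra.
have near x y : x1 <= x <= x2 -> y1 <= y <= y2 ->
   `|p x y - p x0 y0 - px * (x - x0) - c * (y - y0)| <= e * D /\
   `|q x y - q x0 y0 - c * (x - x0) - qy * (y - y0)| <= e * D.
  move=> hx hy.
  have ax : `|x - x0| <= x2 - x1 by rewrite ler_norml; lra.
  have ay : `|y - y0| <= y2 - y1 by rewrite ler_norml; lra.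
  have [] := Hd x y; [lra|lra|].
  have le : e * (`|x - x0| + `|y - y0|) <= e * D by rewrite ler_pM2l// lerD.
  by move=> le1 le2; split; [exact: le_trans le1 le|exact: le_trans le2 le].
have scp y : y1 <= y <= y2 -> cont_seg x1 x2 (p^~ y).
  by move=> hy; apply: sub_cont_seg (cp _) => //; lra.
have scq x : x1 <= x <= x2 -> cont_seg y1 y2 (q x).
  by move=> hx; apply: sub_cont_seg (cq _) => //; lra.
have y1in : y1 <= y1 <= y2 by lra.
have y2in : y1 <= y2 <= y2 by lra.
have x1in : x1 <= x1 <= x2 by lra.
have x2in : x1 <= x2 <= x2 by lra.
have cdp : cont_seg x1 x2 (fun x => p x y1 - p x y2).
  by move=> x hx; apply: cvgB; [exact: scp hx|exact: scp hx].
have cdq : cont_seg y1 y2 (fun y => q x2 y - q x1 y).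
  by move=> y hy; apply: cvgB; [exact: scq hy|exact: scq hy].
rewrite /B /boundary_int -rintB; [|exact: scp..].
rewrite -rintB; [|exact: scq..].
have : `|rint x1 x2 (fun x => p x y1 - p x y2 - c * (y1 - y2))| <= 2 * (e * D) * (x2 - x1).
  apply: rint_norm_le; first lra.
    by move=> x hx; apply: cvgB; [exact: cdp|exact: cvg_cst].
  move=> x hx; have [+ _] := near x y1 hx y1in; have [+ _] := near x y2 hx y2in.
  by rewrite !ler_norml; lra.
have : `|rint y1 y2 (fun y => q x2 y - q x1 y - c * (x2 - x1))| <= 2 * (e * D) * (y2 - y1).
  apply: rint_norm_le; first lra.
    by move=> y hy; apply: cvgB; [exact: cdq|exact: cvg_cst].
  move=> y hy; have [_ +] := near x1 y x1in hy; have [_ +] := near x2 y x2in hy.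
  by rewrite !ler_norml; lra.
rewrite rintB//; last exact: cont_seg_cst.
rewrite [in X in _ -> X -> _]rintB//; last exact: cont_seg_cst.
rewrite !rint_cst; [|lra..].
move: (rint x1 x2 _) (rint y1 y2 _) => I J hJ hI.
rewrite (_ : 2 * e * D ^+ 2 = 2 * (e * D) * (x2 - x1) + 2 * (e * D) * (y2 - y1)); last first.
  by rewrite /D; ring.
rewrite (_ : I + J = (I - c * (y1 - y2) * (x2 - x1)) + (J - c * (x2 - x1) * (y2 - y1))); last ring.
by rewrite (le_trans (ler_normD _ _))// lerD.
Qed.

Let side (k : nat) (A : R) := A / 2 ^+ k.

Let sideS k A : side k A = side k.+1 A + side k.+1 A.
Proof. by rewrite /side exprS; field; rewrite expf_neq0. Qed.

Let side_ge0 k A : 0 <= A -> 0 <= side k A.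
Proof. by move=> A0; rewrite /side divr_ge0// exprn_ge0. Qed.

Let a := X2 - X1.
Let b := Y2 - Y1.

Section Bisection.
Variable e : R.
Hypothesis e0 : 0 < e.

(** The threshold shrinks by 4 at each quartering, so that one of the four children inherits
    badness. As [(a + b) ^+ 2 / 4 ^+ k] is the square of half the perimeter at level [k], the
    threshold is exactly the bound of [local_small]. *)
Let bad k (z : R * R) :=
  2 * e * (a + b) ^+ 2 / 4 ^+ k < `|B z.1 (z.1 + side k a) z.2 (z.2 + side k b)|.

Let inside k (z : R * R) := [&& X1 <= z.1, z.1 + side k a <= X2, Y1 <= z.2 &
  z.2 + side k b <= Y2].

Let child k (z z' : R * R) :=
  [&& z.1 <= z'.1, z'.1 <= z.1 + side k.+1 a, z.2 <= z'.2 &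
      z'.2 <= z.2 + side k.+1 b].

Let bad_child k z : inside k z -> bad k z ->
  exists z', [&& child k z z', inside k.+1 z' & bad k.+1 z'].
Proof.
case: z => x y /and4P[/= h1 h2 k1 k2]; rewrite /bad /= => bd.
have a0 : 0 <= side k.+1 a by rewrite side_ge0// subr_ge0.
have b0 : 0 <= side k.+1 b by rewrite side_ge0// subr_ge0.
have hx : x + side k a = x + side k.+1 a + side k.+1 a by rewrite -addrA -sideS.
have hy : y + side k b = y + side k.+1 b + side k.+1 b by rewrite -addrA -sideS.
set sa := side k.+1 a in a0 hx *; set sb := side k.+1 b in b0 hy *.
rewrite hx hy in h2 k2 bd.
apply: contrapT => no.
have small z' : child k (x, y) z' -> inside k.+1 z' ->
    `|B z'.1 (z'.1 + sa) z'.2 (z'.2 + sb)| <= 2 * e * (a + b) ^+ 2 / 4 ^+ k.+1.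
  move=> h h'; rewrite leNgt; apply/negP => bd'; apply: no; exists z'.
  by rewrite h h'.
have := small (x, y); have := small (x + sa, y).
have := small (x, y + sb); have := small (x + sa, y + sb).
rewrite /child /inside /= -/sa -/sb.
do 4 (move=> /(_ _ _)/wrap[|| ?]; [lra|lra|]).
move: bd; apply/negP; rewrite -leNgt.
rewrite (@boundary_int_split x (x + sa) _ y (y + sb)) ?lerDl//.
have k4 : 4 ^+ k != 0 :> R by rewrite expf_neq0.
rewrite (_ : _ / 4 ^+ k = 4 * (2 * e * (a + b) ^+ 2 / 4 ^+ k.+1)); last first.
  by rewrite [4 ^+ k.+1]exprS; field.
apply: (le_trans (ler_normD _ _)).
by apply: (le_trans (lerD (ler_normD _ _) (ler_normD _ _))); lra.
Qed.

Let next k z := xget z [set z' | [&& child k z z', inside k.+1 z' & bad k.+1 z']].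

Fixpoint bad_seq k := if k is k'.+1 then next k' (bad_seq k') else (X1, Y1).

Let bad_seqP : bad 0 (X1, Y1) ->
  forall k, [/\ inside k (bad_seq k), bad k (bad_seq k) &
     child k (bad_seq k) (bad_seq k.+1)].
Proof.
move=> bad0.
have ib k : inside k (bad_seq k) && bad k (bad_seq k).
  elim: k => [|k /andP[ik bk]].
    rewrite bad0 andbT /inside /= !lexx /side expr0 !divr1 /a /b.
    by rewrite ![_ + (_ - _)]addrC !subrK !lexx.
  have [z' hz'] := bad_child ik bk.
  rewrite /= /next; case: xgetP => [y -> /and3P[_ -> ->]//|/(_ z')].
  by move=> /(_ hz').
move=> k; have /andP[ik bk] := ib k; split => //.
have [z' hz'] := bad_child ik bk.
rewrite /= /next; case: xgetP => [y -> /and3P[]//|/(_ z')].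
by move=> /(_ hz').
Qed.

(* The nested rectangles shrink to a point of the closed rectangle. *)
Let nested_point (u : nat -> R) A L : 0 <= A -> u 0 = L ->
  (forall k, u k <= u k.+1 <= u k + side k.+1 A) ->
  exists x, forall k, u k <= x <= u k + side k A.
Proof.
move=> A0 u0 hu.
have nd : nondecreasing_seq u by apply/nondecreasing_seqP => k; have /andP[] := hu k.
have ni : nonincreasing_seq (fun k => u k + side k A).
  by apply/nonincreasing_seqP => k; have /andP[_ h] := hu k; rewrite (sideS k) addrA lerD2r.
have ubd k j : u j <= u k + side k A.
  have [jk|/ltnW kj] := leqP j k.
    by apply: le_trans (nd _ _ jk) _; rewrite lerDl side_ge0.
  by apply: le_trans (ni _ _ kj); rewrite lerDl side_ge0.
exists (sup (range u)) => k; apply/andP; split.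
  apply: ub_le_sup; last by exists k.
  by exists (u 0%N + side 0 A) => _ [j _ <-]; exact: ubd.
by apply: ge_sup; [exists (u 0%N), 0%N|move=> _ [j _ <-]; exact: ubd].
Qed.

Let not_bad0 : ~~ bad 0 (X1, Y1).
Proof.
apply/negP => /bad_seqP H.
have a0 : 0 <= a by rewrite subr_ge0.
have b0 : 0 <= b by rewrite subr_ge0.
have [x hx] := @nested_point (fun k => (bad_seq k).1) a X1 a0 erefl
  (fun k => ltac:(by have [_ _ /and4P[-> ->]] := H k)).
have [y hy] := @nested_point (fun k => (bad_seq k).2) b Y1 b0 erefl
  (fun k => ltac:(by have [_ _ /and4P[_ _ -> ->]] := H k)).
have hx0 : X1 <= x <= X2.
  by have := hx 0%N; rewrite /= /side expr0 divr1 /a; lra.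
have hy0 : Y1 <= y <= Y2.
  by have := hy 0%N; rewrite /= /side expr0 divr1 /b; lra.
have [dl dl0 Hd] := local_small e0 hx0 hy0.
set k := Num.bound ((a + b) / dl).
have hk : (a + b) / 2 ^+ k < dl.
  by rewrite ltr_pdivrMr ?exprn_gt0// mulrC -ltr_pdivrMr// upper_nthrootP.
have [/and4P[i1 i2 i3 i4] + _] := H k.
have /andP[x1 x2] := hx k; have /andP[y1 y2] := hy k.
have sab : side k a + side k b = (a + b) / 2 ^+ k by rewrite /side -mulrDl.
have sa0 := side_ge0 k a0; have sb0 := side_ge0 k b0.
rewrite /bad ltNge; apply/negP; rewrite negbK.
apply: le_trans (Hd _ _ _ _ i1 x1 x2 i2 i3 y1 y2 i4 _ _) _; [lra|lra|].
rewrite ![_ + side _ _ - _]addrAC !subrr !add0r sab.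
rewrite expr_div_n -exprM mulnC exprM mulrA.
by rewrite (_ : 2 ^+ 2 = 4 :> R)//; ring.
Qed.

Lemma boundary_int_small :
  `|B X1 X2 Y1 Y2| <= 2 * e * (a + b) ^+ 2.
Proof.
have := not_bad0; rewrite /bad /= -leNgt /side expr0 !divr1 /a /b.
by rewrite ![X1 + _]addrC ![Y1 + _]addrC !subrK.
Qed.

End Bisection.

Theorem goursat : boundary_int p q X1 X2 Y1 Y2 = 0.
Proof.
apply/eqP; rewrite -normr_le0; apply/ler_addgt0Pr => e e0; rewrite add0r.
set K := 2 * (a + b) ^+ 2 + 1.
have K0 : 0 < K by rewrite ltr_wpDl// mulr_ge0// sqr_ge0.
apply: le_trans (boundary_int_small (divr_gt0 e0 K0)) _.
rewrite [2 * _]mulrC -mulrA mulrAC ler_pdivrMr// ler_pM2l//.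
by rewrite lerDl.
Qed.

End Goursat.

(** * Integrals over circles *)

Section CircleIntegrals.
Variable R : realType.
Local Notation C := R[i].
Implicit Types (F : R -> C) (f g : C -> C) (z w : C) (r t : R).

Definition ccont F := forall t : R,
  {for t, continuous (fun x => complex.Re (F x))} /\
  {for t, continuous (fun x => complex.Im (F x))}.

Definition cint F : C :=
  rint 0 (2 * pi) (fun t => complex.Re (F t)) +i*
  rint 0 (2 * pi) (fun t => complex.Im (F t)).

Lemma real_continuousP (p : R -> R) t : {for t, continuous p} <->
  forall e, 0 < e -> exists2 d : R, 0 < d &
    forall x, `|x - t| < d -> `|p x - p t| < e.
Proof.
split=> [/cvgrPdist_lt H e /H/nbhs_normP[d /= d0 Hd]|H].
  by exists d => // x; rewrite distrC => /Hd /=; rewrite distrC.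
apply/cvgrPdist_lt => e /H[d d0 Hd]; apply/nbhs_normP; exists d => // x /=.
by rewrite distrC => /Hd; rewrite distrC.
Qed.

Lemma ccontP F : ccont F <->
  forall t e, 0 < e -> exists2 d : R, 0 < d &
    forall x, `|x - t| < d -> normc (F x - F t) < e.
Proof.
split=> [H t e e0|H t].
  have [/real_continuousP H1 /real_continuousP H2] := H t.
  have e2 : 0 < e / 2 by rewrite divr_gt0.
  have [d1 d10 h1] := H1 _ e2; have [d2 d20 h2] := H2 _ e2.
  exists (Num.min d1 d2) => [|x]; first by rewrite lt_min d10.
  rewrite lt_min => /andP[/h1 k1 /h2 k2].
  apply: le_lt_trans (normc_leD _) _; rewrite ReB ImB.
  by rewrite [e]splitr ltrD.
split; apply/real_continuousP => e /(H t)[d d0 Hd]; exists d => // x /Hd;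
  apply: le_lt_trans.
  by rewrite -ReB normRe_le.
by rewrite -ImB normIm_le.
Qed.

Lemma ccontD F G : ccont F -> ccont G -> ccont (fun t => F t + G t).
Proof.
move=> cF cG t; have [f1 f2] := cF t; have [g1 g2] := cG t; split.
  by rewrite (_ : (fun x => _) = (fun x => complex.Re (F x) + complex.Re (G x)));
    [exact: cvgD|apply/funext => x; rewrite ReD].
by rewrite (_ : (fun x => _) = (fun x => complex.Im (F x) + complex.Im (G x)));
  [exact: cvgD|apply/funext => x; rewrite ImD].
Qed.

Lemma ccontM F G : ccont F -> ccont G -> ccont (fun t => F t * G t).
Proof.
move=> cF cG t; have [f1 f2] := cF t; have [g1 g2] := cG t; split.
  rewrite (_ : (fun x => _) = (fun x => complex.Re (F x) * complex.Re (G x) -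
      complex.Im (F x) * complex.Im (G x))); last by apply/funext => x; rewrite ReM.
  by apply: cvgB; exact: cvgM.
rewrite (_ : (fun x => _) = (fun x => complex.Re (F x) * complex.Im (G x) +
    complex.Im (F x) * complex.Re (G x))); last by apply/funext => x; rewrite ImM.
by apply: cvgD; exact: cvgM.
Qed.

Lemma ccont_cst c : ccont (fun=> c).
Proof. by move=> t; split; exact: cvg_cst. Qed.

Lemma ccontZ c F : ccont F -> ccont (fun t => c * F t).
Proof. by move=> cF; apply: ccontM => //; exact: ccont_cst. Qed.

Lemma ccontB F G : ccont F -> ccont G -> ccont (fun t => F t - G t).
Proof.
move=> cF cG; under eq_fun do rewrite -mulN1r.
by apply: ccontD => //; exact: ccontZ.
Qed.

Lemma ccont_sum (n : nat) (F : nat -> R -> C) : (forall i, ccont (F i)) ->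
  ccont (fun t => \sum_(i < n) F i t).
Proof.
move=> cF; elim: n => [|n IH].
  rewrite (_ : (fun t => _) = (fun=> 0)); first exact: ccont_cst.
  by apply/funext => t; rewrite big_ord0.
rewrite (_ : (fun t => _) = (fun t => \sum_(i < n) F i t + F n t)).
  exact: ccontD.
by apply/funext => t; rewrite big_ord_recr.
Qed.

Lemma ccontX F n : ccont F -> ccont (fun t => F t ^+ n).
Proof.
move=> cF; elim: n => [|n IH].
  by rewrite (_ : (fun t => _) = (fun=> 1)); first exact: ccont_cst.
rewrite (_ : (fun t => _) = (fun t => F t * F t ^+ n)); first exact: ccontM.
by apply/funext => t; rewrite exprS.
Qed.

Lemma ccont_comp F f : ccont F ->
  (forall t, {for F t, continuous (f : C^o -> C^o)}) -> ccont (fun t => f (F t)).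
Proof.
move=> /ccontP cF cf; apply/ccontP => t e e0.
have /continuous_complexP/(_ e e0)[d d0 Hd] := cf t.
have [d' d'0 Hd'] := cF t _ d0; exists d' => // x /Hd'; exact: Hd.
Qed.

Lemma cvgV_complex z : z != 0 -> {for z, continuous ((fun w : C => w^-1) : C^o -> C^o)}.
Proof.
move=> z0; have [d hd] := cderivV (f := id) z0 (cderiv_id z).
exact: cderiv_cont hd.
Qed.

Lemma ccontV F : ccont F -> (forall t, F t != 0) -> ccont (fun t => (F t)^-1).
Proof. by move=> cF F0; apply: (ccont_comp cF) => t; exact: cvgV_complex. Qed.

Lemma ccont_seg F a b : ccont F ->
  cont_seg a b (fun t => complex.Re (F t)) /\
  cont_seg a b (fun t => complex.Im (F t)).
Proof. by move=> cF; split => t _; have [] := cF t. Qed.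

Lemma cintD F G : ccont F -> ccont G ->
  cint (fun t => F t + G t) = cint F + cint G.
Proof.
move=> cF cG; rewrite /cint; simpc.
have [f1 f2] := ccont_seg 0 (2 * pi) cF; have [g1 g2] := ccont_seg 0 (2 * pi) cG.
rewrite -!rintD//.
by congr (_ +i* _); apply: eq_rint => t _; rewrite ?ReD ?ImD.
Qed.

Lemma cintZ c F : ccont F -> cint (fun t => c * F t) = c * cint F.
Proof.
move=> cF; have [f1 f2] := ccont_seg 0 (2 * pi) cF.
rewrite /cint [in RHS](complexE c); case: c => a b /=; simpc.
have zc p k : cont_seg 0 (2 * pi) p -> cont_seg 0 (2 * pi) (fun x : R => k * p x).
  by move=> cp x hx; apply: cvgM; [exact: cvg_cst|exact: cp].
rewrite -![a * _]rintZ// -![b * _]rintZ// -rintB; [|exact: zc..].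
rewrite -rintD; [|exact: zc..].
by congr (_ +i* _); apply: eq_rint => t _; rewrite ?ReM ?ImM.
Qed.

Lemma cintB F G : ccont F -> ccont G ->
  cint (fun t => F t - G t) = cint F - cint G.
Proof.
move=> cF cG; rewrite -[in RHS]mulN1r -cintZ// -cintD//; last exact: ccontZ.
by congr cint; apply/funext => t; rewrite mulN1r.
Qed.

Lemma cint0 : cint (fun=> 0) = 0.
Proof. by rewrite /cint !rint_cst ?mulr_ge0 ?pi_ge0//; simpc. Qed.

Lemma cint_cst c : cint (fun=> c) = (2 * pi)%:C * c.
Proof.
rewrite /cint !rint_cst ?mulr_ge0 ?pi_ge0// subr0; case: c => a b /=; simpc.
by congr (_ +i* _); rewrite mulrC.
Qed.

Lemma cint_sum n (F : nat -> R -> C) : (forall i, ccont (F i)) ->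
  cint (fun t => \sum_(i < n) F i t) = \sum_(i < n) cint (F i).
Proof.
move=> cF; elim: n => [|n IH].
  by rewrite big_ord0 -[RHS]cint0; congr cint; apply/funext => t; rewrite big_ord0.
rewrite big_ord_recr /= -IH -cintD//; last exact: ccont_sum.
by congr cint; apply/funext => t; rewrite big_ord_recr.
Qed.

(** The constant is 4 pi and not 2 pi because real and imaginary parts are bounded separately. *)
Lemma cint_norm_le F M : ccont F -> (forall t, 0 <= t <= 2 * pi -> normc (F t) <= M) ->
  normc (cint F) <= 4 * pi * M.
Proof.
move=> cF FM; have [f1 f2] := ccont_seg 0 (2 * pi) cF.
apply: le_trans (normc_leD _) _ => /=.
have p0 : 0 <= 2 * pi :> R by rewrite mulr_ge0// pi_ge0.
have := @rint_norm_le _ _ _ _ M p0 f1 (fun t ht => le_trans (normRe_le _) (FM t ht)).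
have := @rint_norm_le _ _ _ _ M p0 f2 (fun t ht => le_trans (normIm_le _) (FM t ht)).
by rewrite subr0; lra.
Qed.

Lemma polarE r t : polar (r, t) = r%:C * cexp (0 +i* t).
Proof. by rewrite /polar /cexp /= expR0 mul1r; simpc. Qed.

Lemma normc_polar r t : 0 <= r -> normc (polar (r, t)) = r.
Proof. by move=> r0; rewrite polarE normcM normcR ger0_norm// normc_cexp /= expR0 mulr1. Qed.

Lemma cexpi t : cexp (0 +i* t) = cos t +i* sin t.
Proof. by rewrite /cexp /= expR0 mul1r. Qed.

Lemma oppci t : - (0 +i* t) = 0 +i* (- t) :> C.
Proof. by apply/eqP; rewrite eq_complex /= oppr0 !eqxx. Qed.

Lemma ccont_cexpi (k : R) : ccont (fun t => cexp (0 +i* (k * t))).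
Proof.
rewrite (_ : (fun t => _) = (fun t => cos (k * t) +i* sin (k * t))); last first.
  by apply/funext => t; rewrite /cexp /= expR0 mul1r.
have km t : {for t, continuous (fun x : R => k * x)}.
  by apply: cvgM; [exact: cvg_cst|exact: cvg_id].
move=> t; split => /=.
  exact: (continuous_comp (km t) (@continuous_cos _ _)).
exact: (continuous_comp (km t) (@continuous_sin _ _)).
Qed.

Lemma ccont_polar r : ccont (fun t => polar (r, t)).
Proof.
rewrite (_ : (fun t => _) = (fun t => r%:C * cexp (0 +i* (1 * t)))); last first.
  by apply/funext => t; rewrite polarE mul1r.
by apply: ccontM; [exact: ccont_cst|exact: ccont_cexpi].
Qed.

Lemma polar_cont r0 t0 e : 0 < e -> exists2 d : R, 0 < d &
  forall r t, `|r - r0| < d -> `|t - t0| < d ->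
    normc (polar (r, t) - polar (r0, t0)) < e.
Proof.
move=> e0; have e2 : 0 < e / 2 by rewrite divr_gt0.
have /ccontP/(_ t0 _ e2)[d d0 Hd] := ccont_polar r0.
exists (Num.min d (e / 2)) => [|r t]; first by rewrite lt_min d0.
rewrite !lt_min => /andP[_ h1] /andP[/Hd h2 _].
rewrite -(subrK (polar (r0, t)) (polar (r, t))) -addrA.
apply: le_lt_trans (le_normcD _ _) _; rewrite [e]splitr ltrD//.
rewrite !polarE -mulrBl -rmorphB normcM normcR normc_cexp /= expR0 mulr1.
exact: h1.
Qed.

Lemma cexp_2pi_int (n : nat) : cexp (0 +i* (n%:R * (2 * pi))) = 1 :> C.
Proof.
rewrite (_ : 0 +i* _ = (0 +i* (2 * pi)) *+ n); last first.
  elim: n => [|n IH]; first by rewrite mul0r mulr0n.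
  by rewrite [RHS]mulrS -IH -natr1; simpc; congr (_ +i* _); ring.
rewrite cexpMn /cexp /= expR0 mul1r.
rewrite (_ : 2 * pi = pi *+ 2); last by rewrite mulr_natl.
by rewrite cos2pi sin2pi expr1n.
Qed.

Lemma cint_cexpi (k : R) : k != 0 -> cexp (0 +i* (k * (2 * pi))) = 1 :> C ->
  cint (fun t => cexp (0 +i* (k * t))) = 0 :> C.
Proof.
move=> k0; rewrite cexpi => -[ck sk].
have [] := ccont_seg 0 (2 * pi) (ccont_cexpi k).
rewrite /cint; under eq_fun do rewrite cexpi.
move=> c1; under eq_fun do rewrite cexpi.
move=> c2.
rewrite /= in c1 c2 *.
have pp : 0 < 2 * pi :> R by rewrite mulr_gt0// pi_gt0.
have dS (x : R) : is_derive x 1 (fun t => k^-1 * sin (k * t)) (cos (k * x)).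
  apply: is_derive_eq; rewrite /GRing.scale/=; simpc; field; exact: k0.
have dC (x : R) : is_derive x 1 (fun t => - (k^-1 * cos (k * t))) (sin (k * x)).
  apply: is_derive_eq; rewrite /GRing.scale/=; simpc; field; exact: k0.
rewrite (rint_derive pp c1 (fun x _ => dS x)) (rint_derive pp c2 (fun x _ => dC x)).
by rewrite sk ck !mulr0 sin0 cos0; simpc.
Qed.

Lemma cint_polarV r (n : nat) : 0 < r ->
  cint (fun t => (polar (r, t) ^+ n)^-1) = if n == 0%N then (2 * pi)%:C else 0.
Proof.
move=> r0; case: eqP => [->|/eqP n0].
  rewrite (_ : (fun t => _) = (fun=> 1)); first by rewrite cint_cst mulr1.
  by apply/funext => t; rewrite expr0 invr1.
rewrite (_ : (fun t => _) = (fun t => (r%:C ^+ n)^-1 * cexp (0 +i* (- n%:R * t)))).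
  rewrite cintZ; last exact: ccont_cexpi.
  rewrite cint_cexpi ?mulr0// ?oppr_eq0 ?pnatr_eq0//.
  by rewrite mulNr -oppci cexpN cexp_2pi_int invr1.
apply/funext => t; rewrite polarE exprMn invfM; congr (_ * _).
rewrite -cexpMn -cexpN; congr cexp.
rewrite mulNr -oppci; congr (- _).
elim: (n) => [|m IH]; first by rewrite mulr0n mul0r.
by rewrite mulrS IH -natr1; simpc; congr (_ +i* _); ring.
Qed.

(* Goursat for [g (exp z)] on the rectangle [ln r1, ln r2] x [0, 2 pi]. *)
Lemma circle_mean_Re g r1 r2 : 0 < r1 -> r1 <= r2 ->
  (forall z, r1 <= normc z <= r2 -> exists d, cderiv g z d) ->
  rint 0 (2 * pi) (fun t => complex.Re (g (polar (r1, t)))) =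
  rint 0 (2 * pi) (fun t => complex.Re (g (polar (r2, t)))).
Proof.
move=> r10 r12 hg; have r20 : 0 < r2 by exact: lt_le_trans r12.
have lr12 : ln r1 <= ln r2 by rewrite ler_ln ?posrE.
have pp : 0 <= 2 * pi :> R by rewrite mulr_ge0// pi_ge0.
pose G u t := g (cexp (u +i* t)).
have Gpol r t : 0 < r -> G (ln r) t = g (polar (r, t)).
  by move=> r0; rewrite /G polarE /cexp /= lnK ?posrE// expR0 mul1r.
have Gper u : G u (2 * pi) = G u 0.
  rewrite /G /cexp /= (_ : 2 * pi = pi *+ 2); last by rewrite mulr_natl.
  by rewrite cos2pi sin2pi cos0 sin0.
(* The form is the imaginary part of [G] times d(u + i t). Its integrals over the sides t = 0 and t
   = 2 pi cancel by periodicity, which leaves the real parts of the two circle integrals. *)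
have := @goursat R (fun u t => complex.Im (G u t)) (fun u t => complex.Re (G u t))
  _ _ _ _ lr12 pp.
rewrite /boundary_int.
under [X in rint _ _ X - _]eq_fun do rewrite -Gper.
rewrite subrr add0r.
under [X in rint _ _ X - _]eq_fun do rewrite Gpol//.
under [X in _ - rint _ _ X]eq_fun do rewrite Gpol//.
move=> H; apply/esym/subr0_eq/H => u t /andP[ur1 ur2] _.
have [|D hD] := @hg (cexp (u +i* t)).
  rewrite normc_cexp /= -(@lnK _ r1) ?posrE// -(@lnK _ r2) ?posrE//.
  by rewrite !ler_expR ur1 ur2.
have := cderiv_comp (cderiv_cexp (u +i* t)) hD.
move: (D * cexp _) => {hD}D hD.
(* The shared coefficient is [complex.Re D]: closedness of the form is one of the Cauchy-Riemann
   equations. *)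
exists (complex.Im D), (complex.Re D), (- complex.Im D) => e e0.
have [dl dl0 Hd] := hD _ e0.
exists (dl / 2) => [|u' t' hu ht]; first by rewrite divr_gt0.
have nh : normc ((u' - u) +i* (t' - t)) <= `|u' - u| + `|t' - t| by exact: normc_leD.
have /Hd : normc ((u' - u) +i* (t' - t)) < dl.
  by apply: le_lt_trans nh _; rewrite [dl]splitr ltrD.
rewrite (_ : u +i* t + _ = u' +i* t'); last first.
  by simpc; congr (_ +i* _); ring.
move=> le; have {}le := le_trans le (ler_wpM2l (ltW e0) nh).
rewrite -!/(G _ _) in le.
split.
  apply: le_trans le; apply: le_trans (normIm_le _).
  rewrite !ImB ImM /= le_eqVlt; apply/orP; left; apply/eqP.
  by congr `|_|; ring.
apply: le_trans le; apply: le_trans (normRe_le _).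
rewrite !ReB ReM /= le_eqVlt; apply/orP; left; apply/eqP.
by congr `|_|; ring.
Qed.

Lemma circle_mean g r1 r2 : 0 < r1 -> r1 <= r2 ->
  (forall z, r1 <= normc z <= r2 -> exists d, cderiv g z d) ->
  cint (fun t => g (polar (r1, t))) = cint (fun t => g (polar (r2, t))).
Proof.
move=> r10 r12 hg; rewrite /cint (circle_mean_Re r10 r12 hg).
congr (_ +i* _).
have ImE z : complex.Im z = complex.Re (0 -i* 1 * z).
  by rewrite ReM /=; ring.
under [LHS]eq_rint do rewrite ImE.
under [RHS]eq_rint do rewrite ImE.
apply: (@circle_mean_Re (fun z => 0 -i* 1 * g z)) => // z /hg[d hd].
exists (0 -i* 1 * d + g z * 0); exact: cderivM (cderiv_cst _ _) hd.
Qed.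

(** Compactness of the segment of angles makes the continuity of [g] in the radius uniform in the
    angle. *)
Lemma circle_int_continuous g r0 e : 0 <= r0 < 1 ->
  (forall z, normc z < 1 -> {for z, continuous (g : C^o -> C^o)}) -> 0 < e ->
  exists2 d : R, 0 < d & forall r, 0 <= r < 1 -> `|r - r0| < d ->
    normc (cint (fun t => g (polar (r, t))) - cint (fun t => g (polar (r0, t)))) <= e.
Proof.
move=> r01 cg e0; set e1 := e / (4 * pi).
have p4 : 0 < 4 * pi :> R by rewrite mulr_gt0// pi_gt0.
have e10 : 0 < e1 by rewrite divr_gt0.
have e2 : 0 < e1 / 2 by rewrite divr_gt0.
have cgp r : 0 <= r < 1 -> ccont (fun t => g (polar (r, t))).
  move=> /andP[h1 h2]; apply: (ccont_comp (ccont_polar r)) => t.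
  by apply: cg; rewrite normc_polar.
have K := @segment_compact R 0 (2 * pi).
have := (compact_near_coveringP _).1 K R (nbhs r0)
  (fun r t => 0 <= r < 1 -> normc (g (polar (r, t)) - g (polar (r0, t))) < e1) _.
case=> [t _|].
  have n0 : normc (polar (r0, t)) < 1 by rewrite normc_polar; case/andP: r01.
  have /continuous_complexP/(_ _ e2)[d d0 Hd] := cg _ n0.
  have [d' d'0 Hd'] := polar_cont r0 t d0.
  exists (ball t d', ball r0 d') => /=.
    by split; exact: nbhsx_ballx.
  case=> t' r' [/= bt br] r'01.
  rewrite /ball /= distrC in bt; rewrite /ball /= distrC in br.
  rewrite -(subrK (g (polar (r0, t))) (g (polar (r', t')))) -addrA.
  apply: le_lt_trans (le_normcD _ _) _; rewrite [e1]splitr ltrD//.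
    by apply: Hd; apply: Hd'.
  by rewrite normcBC; apply: Hd; apply: Hd' => //; rewrite subrr normr0.
move=> d d0 Hd; exists d => // r r01' rd.
rewrite -cintB; [|exact: cgp..].
have -> : e = 4 * pi * e1 by rewrite mulrC divfK// gt_eqF.
apply: cint_norm_le => [|t ht].
  by apply: ccontB; exact: cgp.
by apply/ltW; apply: Hd => //; rewrite /ball_ /= distrC.
Qed.

End CircleIntegrals.

(** * Taylor expansion on the disc *)

Section CauchyTaylor.
Variable R : realType.
Local Notation C := R[i].
Implicit Types (F : R -> C) (f g : C -> C) (z w : C) (r t : R).

(** Convergence of the partial sums in the given order. Where absolute convergence matters, it is
    recovered from the boundedness of the terms at a larger radius. *)
Definition csum (u : nat -> C) (l : C) := forall e : R, 0 < e -> exists N : nat,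
  forall n, (N <= n)%N -> normc (\sum_(k < n) u k - l) < e.

Lemma geometric_small (K q e : R) : 0 <= q < 1 -> 0 < e ->
  exists N : nat, forall n, (N <= n)%N -> K * q ^+ n < e.
Proof.
move=> /andP[q0 q1] e0; have q1' : `|q| < 1 by rewrite ger0_norm.
have /cvgrPdist_lt/(_ e e0)[N _ HN] := cvg_geometric K q1'.
exists N => n Nn; have := HN n Nn; rewrite sub0r normrN.
by apply: le_lt_trans; exact: ler_norm.
Qed.

Lemma ccont_bounded F : ccont F ->
  exists M, forall t, 0 <= t <= 2 * pi -> normc (F t) <= M.
Proof.
move=> cF; have p0 : 0 <= 2 * pi :> R by rewrite mulr_ge0// pi_ge0.
pose N t := `|complex.Re (F t)| + `|complex.Im (F t)|.
have cN : {within `[0, (2 * pi)], continuous N}.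
  apply: continuous_subspaceT => t; have [c1 c2] := cF t.
  by apply: cvgD; exact: cvg_norm.
have [c _ Hc] := EVT_max p0 cN; exists (N c) => t ht.
by apply: le_trans (normc_leD _) _; apply: Hc; rewrite in_itv.
Qed.

Section CircleMean.
Variables (g : C -> C) (w : C).
Hypothesis w1 : normc w < 1.
Hypothesis cg : forall z, normc z < 1 -> {for z, continuous (g : C^o -> C^o)}.
Hypothesis dg : forall z, normc z < 1 -> z != w -> exists d, cderiv g z d.

Let m r := cint (fun t => g (polar (r, t))).

Let const_closure (a b c x : R) : 0 <= a -> b <= 1 -> a <= c -> c <= b -> c < 1 ->
  (forall y z : R, a < y -> y <= z -> z < b -> m y = m z) ->
  a < x -> x < b -> m x = m c.
Proof.
move=> a0 b1 ac cb c1 H ax xb.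
apply/subr0_eq/normc_small_eq0 => e e0.
have c01 : 0 <= c < 1 by rewrite c1 (le_trans a0).
have [d d0 Hd] := circle_int_continuous c01 cg e0.
have ab : 0 < b - a by lra.
pose s := Num.min 1 (d / (b - a)).
have s0 : 0 < s by rewrite lt_min ltr01 divr_gt0.
have s1 : s <= 1 by rewrite ge_min lexx.
have sd : s * (b - a) <= d by rewrite -ler_pdivlMr// ge_min lexx orbT.
(* Moving [c] slightly towards the midpoint lands inside the open interval, even when [c] is one of
   its ends, and within the distance [d] given by continuity at [c]. *)
pose y := c + s * ((a + b) / 2 - c).
have ya : a < y by rewrite /y; nra.
have yb : y < b by rewrite /y; nra.
have -> : m x = m y.
  by have [xy|/ltW yx] := leP x y; [apply: H|apply/esym; apply: H].
apply: Hd; first by apply/andP; split; lra.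
have hc : `|(a + b) / 2 - c| < b - a by rewrite ltr_norml; apply/andP; split; lra.
rewrite /y addrC addKr normrM gtr0_norm//.
by apply: lt_le_trans sd; rewrite ltr_pM2l.
Qed.

Let const_off (y z : R) : 0 < y -> y <= z -> z < 1 ->
  (normc w < y) || (z < normc w) -> m y = m z.
Proof.
move=> y0 yz z1 hw; apply: circle_mean => // u /andP[h1 h2].
apply: dg; first lra.
by apply: contraTneq hw => <-; rewrite negb_or -!leNgt h1 h2.
Qed.

Lemma circle_mean_center r : 0 <= r < 1 ->
  cint (fun t => g (polar (r, t))) = (2 * pi)%:C * g 0.
Proof.
move=> /andP[r0 r1]; set rho := normc w; have rho1 : rho < 1 := w1.
have rho0 : 0 <= rho := normc_ge0 w.
have m0 : m 0 = (2 * pi)%:C * g 0.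
  rewrite /m -cint_cst; congr cint; apply/funext => t.
  by rewrite polarE mul0r.
rewrite -[LHS]/(m r) -m0.
have lo x : 0 < x -> x < rho -> m x = m 0.
  move=> x0 xr; apply: (@const_closure 0 rho) => // [|y z y0 yz zr]; first exact: ltW.
  by apply: const_off => //; [exact: lt_trans rho1|rewrite zr orbT].
have mid : m rho = m 0.
  move: rho0; rewrite le_eqVlt => /predU1P[<-//|rho0].
  rewrite -(lo (rho / 2)); [|lra|lra].
  apply/esym; apply: (@const_closure 0 rho) => //; [lra|lra|move=> y z y0 yz zr|lra|lra].
  by apply: const_off => //; [exact: lt_trans rho1|rewrite zr orbT].
have [rr|rr|->//] := ltgtP r rho.
  by move: r0; rewrite le_eqVlt => /predU1P[<-//|r0]; exact: lo.
rewrite -mid; apply: (@const_closure rho 1) => //; first exact: ltW.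
by move=> y z ry yz z1; apply: const_off => //; [lra|rewrite ry].
Qed.

End CircleMean.

Section Taylor.
Variable f : C -> C.
Hypothesis hf : forall z, normc z < 1 -> holomorphic_at f z.

Let df z : normc z < 1 -> exists d, cderiv f z d.
Proof. by move=> /hf/holomorphic_atP. Qed.

Let cf z : normc z < 1 -> {for z, continuous (f : C^o -> C^o)}.
Proof. by move=> /df[d]; exact: cderiv_cont. Qed.

(* Its circle means are constant on both sides of [normc z = normc w], and equal
   by continuity: comparing with the mean at 0 is Cauchy's formula for [f w]. *)
Let gw w d z := if z == w then d * w else (f z - f w) / (z - w) * z.

Let gw_deriv w d z : normc z < 1 -> z != w -> exists d', cderiv (gw w d) z d'.
Proof.
move=> z1 zw; have [d1 hd1] := df z1.
have zw0 : z - w != 0 by rewrite subr_eq0.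
have c1 := cderivB hd1 (cderiv_cst z (f w)).
have [d2 c2] := cderivV (f := fun u => u - w) zw0 (cderivB (cderiv_id z) (cderiv_cst z w)).
have c3 := cderivM (cderivM c1 c2) (cderiv_id z).
eexists; apply: (cderiv_ext (r := normc (z - w)) _ _ c3) => [|u]; first by rewrite normc_gt0.
by rewrite /gw; case: eqP => // ->; rewrite normcBC ltxx.
Qed.

Let gw_cont w d z : normc w < 1 -> cderiv f w d -> normc z < 1 ->
  {for z, continuous (gw w d : C^o -> C^o)}.
Proof.
move=> w1 hd z1; have [->|zw] := eqVneq z w; last first.
  by have [d' /cderiv_cont] := gw_deriv d z1 zw.
apply/continuous_complexP => e e0.
have e2 : 0 < e / 2 by rewrite divr_gt0.
have [dl dl0 Hd] := hd _ (divr_gt0 e2 (ltr0n _ 2)).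
have dn : 0 < e / 2 / (normc d + 1).
  by rewrite divr_gt0// ltr_wpDl// normc_ge0.
exists (Num.min 1 (Num.min dl (e / 2 / (normc d + 1)))) => [|u].
  by rewrite !lt_min ltr01 dl0.
rewrite !lt_min => /and3P[u1 udl ud].
rewrite /gw eqxx; case: eqP => [_|/eqP uw]; first by rewrite subrr normc0.
have uw0 : u - w != 0 by rewrite subr_eq0.
have n0 : 0 < normc (u - w) by rewrite normc_gt0.
have nu : normc u <= 2.
  by rewrite -(subrK w u) (le_trans (le_normcD _ _))//; lra.
rewrite (_ : _ - _ = (f u - f w - d * (u - w)) / (u - w) * u + d * (u - w)); last by field.
apply: le_lt_trans (le_normcD _ _) _.
have h1 : normc ((f u - f w - d * (u - w)) / (u - w) * u) <= e / 2.
  rewrite (_ : e / 2 = e / 2 / 2 * 2); last by rewrite divfK.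
  rewrite normcM; apply: ler_pM; rewrite ?normc_ge0//.
  rewrite normcM normcV ler_pdivrMr//.
  by have := Hd _ udl; rewrite [w + _]addrC subrK.
have h2 : normc (d * (u - w)) < e / 2.
  rewrite normcM; apply: le_lt_trans (_ : (normc d + 1) * normc (u - w) < _).
    by rewrite ler_wpM2r ?normc_ge0// lerDl.
  by rewrite mulrC -ltr_pdivlMr// ltr_wpDl// normc_ge0.
by rewrite [e]splitr ler_ltD.
Qed.

Definition taylor_coef r (n : nat) : C :=
  ((2 * pi)%:C)^-1 * cint (fun t => f (polar (r, t)) / polar (r, t) ^+ n).

(** The quotient [gw] is split by a finite geometric sum in w / z. The error after N terms is
    exactly the mean of [(w / z) ^+ N] times [gw], hence of order (|w| / r)^N, so that limit and
    integral are never interchanged. *)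
Lemma taylor_coefP r w : 0 < r -> r < 1 -> normc w < r ->
  csum (fun n => taylor_coef r n * w ^+ n) (f w).
Proof.
move=> r0 r1 wr; have w1 : normc w < 1 by exact: lt_trans r1.
have [d hd] := df w1.
pose zt t := polar (r, t).
have nz t : normc (zt t) = r by rewrite normc_polar// ltW.
have z0 t : zt t != 0 by rewrite -normc_gt0 nz.
have zw t : zt t - w != 0.
  by rewrite subr_eq0; apply/eqP => /(congr1 (@normc R)); rewrite nz => rw; lra.
have cz : ccont zt by exact: ccont_polar.
have cfz : ccont (fun t => f (zt t)).
  by apply: (ccont_comp cz) => t; apply: cf; rewrite nz.
have cg : ccont (fun t => gw w d (zt t)).
  by apply: (ccont_comp cz) => t; apply: gw_cont => //; rewrite nz.
have [M HM] := ccont_bounded cg.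
have mean0 : cint (fun t => gw w d (zt t)) = 0.
  have r01 : 0 <= r < 1 by rewrite r1 ltW.
  have := circle_mean_center w1 (fun z hz => gw_cont w1 hd hz)
    (fun z hz => gw_deriv d hz) r01.
  by rewrite /zt => ->; rewrite /gw; case: eqP => [<-|_]; rewrite !mulr0.
pose q := normc w / r.
have q01 : 0 <= q < 1 by rewrite divr_ge0 ?normc_ge0 ?ltW// ltr_pdivrMr// mul1r.
have czV n : ccont (fun t => (zt t ^+ n)^-1).
  by apply: ccontV => [|t]; [exact: ccontX|rewrite expf_neq0].
have pp : (2 * pi)%:C != 0 :> C.
  by rewrite -normc_gt0 normcR normr_gt0 mulf_neq0// gt_eqF// pi_gt0.
have cR N : ccont (fun t => (w / zt t) ^+ N * gw w d (zt t)).
  apply: ccontM => //; apply: ccontX; apply: ccontM; first exact: ccont_cst.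
  exact: ccontV.
pose T n t := w ^+ n * (f (zt t) / zt t ^+ n - f w * (zt t ^+ n)^-1).
have cT n : ccont (T n).
  by apply: ccontZ; apply: ccontB; [exact: ccontM|exact: ccontZ].
(* On the circle, [gw] is the sum of the [T n] for n < N and of the remainder, and its mean is zero.
   Only the term n = 0 contributes to [f w], whence the condition on [N]. *)
have key N : (0 < N)%N -> \sum_(n < N) taylor_coef r n * w ^+ n - f w =
    - (((2 * pi)%:C)^-1 * cint (fun t => (w / zt t) ^+ N * gw w d (zt t))).
  move=> N0; apply: (mulfI pp); rewrite mulrN mulrA divff// mul1r.
  apply/eqP; rewrite -subr_eq0 opprK; apply/eqP; rewrite -[RHS]mean0.
  transitivity (cint (fun t => \sum_(n < N) T n t + (w / zt t) ^+ N * gw w d (zt t))).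
    rewrite cintD//; last exact: ccont_sum cT.
    congr (_ + _); rewrite (cint_sum _ cT).
    rewrite mulrBr mulr_sumr.
    under [RHS]eq_bigr => n _.
      rewrite cintZ; last by apply: ccontB; [exact: ccontM|exact: ccontZ].
      rewrite cintB; [|exact: ccontM|exact: ccontZ].
      rewrite cintZ// cint_polarV// mulrBr.
      over.
    rewrite sumrB; congr (_ - _).
      apply: eq_bigr => n _; by rewrite /taylor_coef !mulrA divff// mul1r mulrC.
    case: N N0 => // N _; rewrite big_ord_recl /= expr0 mul1r big1 => [|i _].
      by rewrite addr0 mulrC.
    by rewrite !mulr0.
  congr cint; apply/funext => t.
  have ztw : (zt t == w) = false by apply/negbTE; rewrite -subr_eq0.
  rewrite /gw ztw; elim: (N) => [|k IH].
    by rewrite big_ord0 add0r expr0 mul1r.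
  rewrite -[RHS]IH big_ord_recr /= -addrA; congr (_ + _).
  rewrite /T !expr_div_n !exprS.
  have zk : zt t ^+ k != 0 by rewrite expf_neq0.
  field; do ![exact: z0|exact: zk|exact: zw|apply/andP; split].
move=> e e0; have [N HN] := geometric_small (2 * M) q01 e0.
exists (maxn 1 N) => n; rewrite geq_max => /andP[n0 Nn].
rewrite key// normcN normcM normcV normcR gtr0_norm ?mulr_gt0 ?pi_gt0//.
apply: le_lt_trans (HN n Nn).
rewrite ler_pdivrMl ?mulr_gt0 ?pi_gt0//.
have -> : 2 * pi * (2 * M * q ^+ n) = 4 * pi * (q ^+ n * M) by ring.
apply: cint_norm_le => // t ht.
rewrite normcM normcX normcM normcV nz.
by apply: ler_wpM2l (HM t ht); rewrite exprn_ge0//; case/andP: q01.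
Qed.

End Taylor.
End CauchyTaylor.

(** * Power series *)

Section ComplexSeries.
Variable R : realType.
Local Notation C := R[i].
Implicit Types (u v : nat -> C) (a l w z : C).

Lemma csum_unique u l l' : csum u l -> csum u l' -> l = l'.
Proof.
move=> h h'; apply/subr0_eq/normc_small_eq0 => e e0.
have e2 : 0 < e / 2 by rewrite divr_gt0.
have [N HN] := h _ e2; have [N' HN'] := h' _ e2.
have h1 := HN _ (leq_maxl N N'); have h2 := HN' _ (leq_maxr N N').
set S := \sum_(k < _) _ in h1 h2.
have -> : l - l' = - (S - l) + (S - l') by ring.
by apply: le_trans (le_normcD _ _) _; rewrite normcN; lra.
Qed.

Lemma eq_csum u v l : u =1 v -> csum u l -> csum v l.
Proof. by move=> /funext ->. Qed.

Lemma csumD u v l l' : csum u l -> csum v l' -> csum (fun n => u n + v n) (l + l').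
Proof.
move=> h h' e e0; have e2 : 0 < e / 2 by rewrite divr_gt0.
have [N HN] := h _ e2; have [N' HN'] := h' _ e2.
exists (maxn N N') => n; rewrite geq_max => /andP[/HN h1 /HN' h2].
rewrite big_split /=.
have -> : forall x y : C, x + y - (l + l') = (x - l) + (y - l') by move=> x y; ring.
by apply: le_lt_trans (le_normcD _ _) _; lra.
Qed.

Lemma csumZ a u l : csum u l -> csum (fun n => a * u n) (a * l).
Proof.
move=> h e e0; have a1 : 0 < normc a + 1 by rewrite ltr_wpDl ?normc_ge0.
have [N HN] := h _ (divr_gt0 e0 a1); exists N => n /HN.
rewrite -mulr_sumr -mulrBr normcM ltr_pdivlMr// => le.
by apply: le_lt_trans le; rewrite mulrC ler_wpM2l ?normc_ge0// lerDl.
Qed.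

Lemma csumB u v l l' : csum u l -> csum v l' -> csum (fun n => u n - v n) (l - l').
Proof.
move=> h h'; rewrite -[X in csum _ (_ + X)]mulN1r.
by apply: eq_csum (csumD h (csumZ (-1) h')) => n; rewrite mulN1r.
Qed.

Lemma csum0 : csum (fun=> 0 : C) 0.
Proof. by move=> e e0; exists 0%N => n _; rewrite big1// subrr normc0. Qed.

Lemma csum_shift u l k : csum u l ->
  csum (fun n => u (k + n)%N) (l - \sum_(j < k) u j).
Proof.
move=> h e /h[N HN]; exists N => n Nn.
have /HN : (N <= k + n)%N by rewrite (leq_trans Nn)// leq_addl.
rewrite big_split_ord /=; congr (normc _ < _).
by ring.
Qed.

Lemma csum_norm_le u l S : csum u l ->
  (forall N, normc (\sum_(k < N) u k) <= S) -> normc l <= S.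
Proof.
move=> h hS; apply/ler_addgt0Pr => e /h[N /(_ N (leqnn _))HN].
set s := \sum_(k < N) _ in HN; have := hS N; rewrite -/s => hs.
have -> : l = s - (s - l) by ring.
by apply: le_trans (normcB _ _) _; rewrite lerD// ltW.
Qed.

Lemma csum_terms_bounded u l : csum u l -> exists M, forall n, normc (u n) <= M.
Proof.
move=> /(_ 1 ltr01)[N HN].
have [M HM] : exists M, forall n, (n < N)%N -> normc (u n) <= M.
  elim: (N) => [|k [M HM]]; first by exists 0.
  exists (Num.max M (normc (u k))) => n; rewrite ltnS leq_eqVlt.
  by case/predU1P => [->|/HM le]; rewrite le_max ?lexx ?orbT// le.
exists (Num.max M 2) => n; have [Nn|/HM le] := leqP N n; last by rewrite le_max le.
have h1 := HN _ Nn; have h2 := HN _ (leqW Nn); rewrite le_max; apply/orP; right.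
move: h2; rewrite big_ord_recr /=; set s := \sum_(k < n) _ in h1 * => h2.
have -> : u n = (s + u n - l) - (s - l) by ring.
by apply: le_trans (normcB _ _) _; lra.
Qed.

Lemma real_geometric_cvg (x : nat -> R) (M q : R) : 0 <= q < 1 ->
  (forall n, `|x n| <= M * q ^+ n) -> exists l : R,
  forall e, 0 < e -> exists N : nat, forall n, (N <= n)%N ->
    `|\sum_(k < n) x k - l| < e.
Proof.
move=> /andP[q0 q1] hx; have q1' : `|q| < 1 by rewrite ger0_norm.
have cx : cvgn (series x).
  apply: normed_cvg; apply: (series_le_cvg (v_ := geometric M q)) => //.
  - by move=> n /=.
  - by move=> n; apply: le_trans (hx n).
  - exact: is_cvg_geometric_series.
exists (limn (series x)) => e e0.
have /cvgrPdist_lt/(_ e e0)[N _ HN] := cx; exists N => n Nn.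
have := HN n Nn; rewrite distrC /series /=.
by rewrite big_mkord.
Qed.

Lemma csum_geometric u (M q : R) : 0 <= q < 1 ->
  (forall n, normc (u n) <= M * q ^+ n) -> exists l, csum u l.
Proof.
move=> q01 hu.
have [a Ha] := real_geometric_cvg (x := fun n => complex.Re (u n)) q01
  (fun n => le_trans (normRe_le _) (hu n)).
have [b Hb] := real_geometric_cvg (x := fun n => complex.Im (u n)) q01
  (fun n => le_trans (normIm_le _) (hu n)).
exists (a +i* b) => e e0; have e2 : 0 < e / 2 by rewrite divr_gt0.
have [N HN] := Ha _ e2; have [N' HN'] := Hb _ e2.
exists (maxn N N') => n; rewrite geq_max => /andP[/HN h1 /HN' h2].
apply: le_lt_trans (normc_leD _) _; rewrite ReB ImB [e]splitr ltrD//.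
  by rewrite (big_morph _ (@ReD R) (erefl : complex.Re 0 = 0)).
by rewrite (big_morph _ (@ImD R) (erefl : complex.Im 0 = 0)).
Qed.

End ComplexSeries.

Section PowerSeries.
Variable R : realType.
Local Notation C := R[i].
Implicit Types (A B : nat -> C) (f : C -> C) (w z : C).

Definition psum A w l := csum (fun n => A n * w ^+ n) l.

Lemma psum_shift A w l k : w != 0 -> psum A w l ->
  psum (fun n => A (k + n)%N) w ((l - \sum_(j < k) A j * w ^+ j) / w ^+ k).
Proof.
move=> w0 h; have wk : w ^+ k != 0 by rewrite expf_neq0.
rewrite /psum mulrC; apply: eq_csum (csumZ _ (csum_shift k h)) => n.
by rewrite exprD; field.
Qed.

Lemma geometric_sum_le (q : R) (N : nat) : 0 <= q < 1 ->
  \sum_(k < N) q ^+ k <= (1 - q)^-1.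
Proof.
move=> /andP[q0 q1]; have q1' : 0 < 1 - q by rewrite subr_gt0.
rewrite -[leRHS]mul1r ler_pdivlMr//.
suff -> : (\sum_(k < N) q ^+ k) * (1 - q) = 1 - q ^+ N by rewrite gerBl exprn_ge0.
by elim: N => [|N IH]; rewrite ?big_ord0 ?big_ord_recr /= ?exprS ?mulrDl ?IH; ring.
Qed.

(** The terms at radius [rho / 2] have a common bound M, so at half that radius the k-th term is at
    most M / 2^k and the sum at most 2 M. *)
Lemma psum_bounded_near0 A f (rho : R) : 0 < rho ->
  (forall w, normc w < rho -> psum A w (f w)) ->
  exists2 M, 0 <= M & forall w, normc w < rho / 4 -> normc (f w) <= M.
Proof.
move=> rho0 hf; set t := rho / 2.
have t0 : 0 < t by rewrite divr_gt0.
have [|M HM] := csum_terms_bounded (hf t%:C _).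
  by rewrite normcR gtr0_norm// /t; lra.
have M0 : 0 <= M by apply: le_trans (HM 0%N); exact: normc_ge0.
exists (2 * M) => [|w wt]; first by rewrite mulr_ge0.
have h2 : 0 <= (1 / 2 : R) < 1 by apply/andP; split; lra.
apply: (csum_norm_le (hf w _)) => [|N]; first lra.
apply: le_trans (normc_sum_le _ _ _) _.
apply: le_trans (_ : \sum_(k < N) M * (1 / 2) ^+ k <= _).
  apply: ler_sum => k _; rewrite normcM normcX.
  apply: le_trans (_ : normc (A k) * (t * (1 / 2)) ^+ k <= _).
    apply: ler_wpM2l; first exact: normc_ge0.
    by apply: lerXn2r; rewrite ?nnegrE ?normc_ge0//; rewrite /t; lra.
  rewrite exprMn mulrA ler_wpM2r ?exprn_ge0//.
  by have := HM k; rewrite normcM normcX normcR gtr0_norm.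
rewrite -mulr_sumr mulrC ler_wpM2r//.
by apply: le_trans (geometric_sum_le N h2) _; rewrite [leLHS](_ : _ = 2)//; field.
Qed.

(** Once the lower coefficients vanish, [f w] differs from [A k * w ^+ k] by w^(k+1) times a bounded
    series. If [f] is of order v > k, then [A k * w ^+ k] is of order k + 1, which forces
    [A k = 0]. *)
Lemma psum_order A f (rho d M : R) v : 0 < rho -> 0 < d ->
  (forall w, normc w < rho -> psum A w (f w)) ->
  (forall w, normc w < d -> normc (f w) <= M * normc w ^+ v) ->
  forall k, (k < v)%N -> A k = 0.
Proof.
move=> rho0 d0 hf hM k; have [n] := ubnP k.
elim: n k => // n IH k; rewrite ltnS => kn kv.
have A0 j : (j < k)%N -> A j = 0.
  by move=> jk; apply: IH; [exact: leq_trans kn|exact: ltn_trans kv].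
(* The value at 0 is that of the shifted series, so that the expansion of [h] holds at every point
   of the disc. *)
pose h w := if w == 0 then A k.+1 else (f w - A k * w ^+ k) / w ^+ k.+1.
have hh w : normc w < rho -> psum (fun n => A (k.+1 + n)%N) w (h w).
  move=> wr; rewrite /h; case: eqP => [->|/eqP w0].
    move=> e e0; exists 1%N => -[//|m] _.
    rewrite big_ord_recl /= addn0 expr0 mulr1 big1 ?addr0 ?subrr ?normc0//.
    by move=> i _; rewrite exprS mul0r mulr0.
  have := psum_shift k.+1 w0 (hf w wr); congr (psum _ _ _).
  rewrite big_ord_recr /= big1 ?add0r// => i _.
  by rewrite A0// mul0r.
have [B B0 HB] := psum_bounded_near0 rho0 hh.
apply: normc_small_eq0 => e e0.
have MB : 0 < `|M| + B + 1 by rewrite ltr_wpDl// addr_ge0.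
pose x := Num.min (Num.min (d / 2) (rho / 8)) (Num.min (1 / 2) (e / (`|M| + B + 1))).
have x0 : 0 < x by rewrite !lt_min !divr_gt0.
have xd : x < d by apply: le_lt_trans (_ : d / 2 < _); [rewrite !ge_min lexx|lra].
have xr : x < rho / 4 by apply: le_lt_trans (_ : rho / 8 < _); [rewrite !ge_min lexx orbT|lra].
have x1 : x <= 1 by apply: le_trans (_ : 1 / 2 <= _); [rewrite !ge_min lexx !orbT|lra].
have xe : x * (`|M| + B + 1) <= e by rewrite -ler_pdivlMr// !ge_min lexx !orbT.
have nx : normc x%:C = x by rewrite normcR gtr0_norm.
have x0' : x%:C != 0 :> C by rewrite -normc_gt0 nx.
have := HB x%:C; rewrite nx => /(_ xr); rewrite /h (negbTE x0') => hb.
have := hM x%:C; rewrite nx => /(_ xd) hm.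
have hk : normc (A k * x%:C ^+ k) <= (`|M| + B) * x ^+ k.+1.
  have -> : A k * x%:C ^+ k = f x%:C - (f x%:C - A k * x%:C ^+ k) by ring.
  apply: le_trans (normcB _ _) _; rewrite mulrDl lerD//.
    apply: le_trans hm _; apply: le_trans (_ : `|M| * x ^+ v <= _).
      by apply: ler_wpM2r; [rewrite exprn_ge0 ?ltW|exact: ler_norm].
    rewrite ler_wpM2l// -(subnKC kv) exprD; apply: ler_piMr.
      by rewrite exprn_ge0// ltW.
    by rewrite exprn_ile1// ltW.
  by move: hb; rewrite normcM normcV normcX nx ler_pdivrMr ?exprn_gt0.
move: hk; rewrite normcM normcX nx exprS mulrA ler_pM2r ?exprn_gt0// => hk.
apply: le_trans hk (le_trans _ xe).
by rewrite mulrC ler_pM2l// lerDl.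
Qed.

Lemma psum_unique A B f (rho : R) : 0 < rho ->
  (forall w, normc w < rho -> psum A w (f w)) ->
  (forall w, normc w < rho -> psum B w (f w)) -> A =1 B.
Proof.
move=> rho0 hA hB k; apply/subr0_eq.
apply: (@psum_order (fun n => A n - B n) (fun=> 0) rho rho 0 k.+1) => //.
  move=> w wr; rewrite -(subrr (f w)).
  by apply: eq_csum (csumB (hA w wr) (hB w wr)) => n; rewrite mulrBl.
by move=> w _; rewrite normc0 mul0r.
Qed.

Lemma psum_bigO A f (rho : R) v : 0 < rho ->
  (forall w, normc w < rho -> psum A w (f w)) ->
  (forall k, (k < v)%N -> A k = 0) ->
  exists M d : R, 0 < d /\ forall w, normc w < d -> normc (f w) <= M * normc w ^+ v.
Proof.
move=> rho0 hf A0.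
have f0 : f 0 = A 0%N.
  apply: (@csum_unique _ (fun n => A n * 0 ^+ n)).
    by apply: hf; rewrite normc0.
  move=> e e0; exists 1%N => -[//|m] _.
  rewrite big_ord_recl /= expr0 mulr1 big1 ?addr0 ?subrr ?normc0//.
  by move=> i _; rewrite exprS mul0r mulr0.
pose h w := if w == 0 then A v else f w / w ^+ v.
have hh w : normc w < rho -> psum (fun n => A (v + n)%N) w (h w).
  move=> wr; rewrite /h; case: eqP => [->|/eqP w0].
    move=> e e0; exists 1%N => -[//|m] _.
    rewrite big_ord_recl /= addn0 expr0 mulr1 big1 ?addr0 ?subrr ?normc0//.
    by move=> i _; rewrite exprS mul0r mulr0.
  have := psum_shift v w0 (hf w wr); congr (psum _ _ _).
  by rewrite big1 ?subr0// => i _; rewrite A0// mul0r.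
have [B B0 HB] := psum_bounded_near0 rho0 hh.
exists (Num.max B (normc (A 0%N))), (rho / 4); split => [|w wr]; first by rewrite divr_gt0.
have := HB w wr; rewrite /h; case: eqP => [->|/eqP w0].
  rewrite normc0 f0; case: v A0 {h hh HB} => [|v] A0 _.
    by rewrite expr0 mulr1 le_max lexx orbT.
  by rewrite A0// normc0 exprS mul0r mulr0.
have w1 : 0 < normc w by rewrite normc_gt0.
rewrite normcM normcV normcX ler_pdivrMr ?exprn_gt0// => le.
by apply: le_trans le _; rewrite ler_pM2r ?exprn_gt0// le_max lexx.
Qed.

(** The form suited to induction is n q^n (1 - q) <= 1 - q^n. *)
Lemma linear_geometric_le (q : R) (n : nat) : 0 <= q < 1 ->
  n%:R * q ^+ n <= (1 - q)^-1.
Proof.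
move=> /andP[q0 q1]; have q1' : 0 < 1 - q by rewrite subr_gt0.
rewrite -[leRHS]mul1r ler_pdivlMr//.
apply: le_trans (_ : 1 - q ^+ n <= _); last by rewrite gerBl exprn_ge0.
elim: n => [|n IH]; first by rewrite !mul0r expr0 subrr.
rewrite -natr1 exprS.
have qn : 0 <= q ^+ n by rewrite exprn_ge0.
have qn1 : q ^+ n <= 1 by rewrite exprn_ile1// ltW.
have := ler_wpM2l q0 IH; set s := q ^+ n in qn qn1 *; set m := n%:R.
have : 0 <= (1 - q) * (1 - q * s) by rewrite mulr_ge0 ?subr_ge0 ?mulr_ile1// ltW.
by lra.
Qed.

(** Multiplying by [rho ^+ 2] avoids the exponent n - 2, and [n%:R ^+ 2] replaces the binomial
    coefficient; both make the induction uniform in [n]. *)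
Lemma normc_binomial_rest z h (rho : R) n : normc z <= rho -> normc (z + h) <= rho ->
  normc ((z + h) ^+ n - z ^+ n - n%:R * z ^+ n.-1 * h) * rho ^+ 2 <=
  n%:R ^+ 2 * rho ^+ n * normc h ^+ 2.
Proof.
move=> zr zhr; have rho0 : 0 <= rho := le_trans (normc_ge0 _) zr.
have h0 := normc_ge0 h.
elim: n => [|n IH].
  by rewrite expr0 !mul0r subrr subr0 normc0 mul0r expr0n /= !mul0r.
have -> : (z + h) ^+ n.+1 - z ^+ n.+1 - n.+1%:R * z ^+ n * h =
   (z + h) * ((z + h) ^+ n - z ^+ n - n%:R * z ^+ n.-1 * h) +
   n%:R * z ^+ n.-1 * h ^+ 2.
  case: n {IH} => [|n] /=; first by rewrite !expr0 !expr1; ring.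
  by rewrite !exprS -!natr1; ring.
apply: le_trans (ler_wpM2r _ (le_normcD _ _)) _; first by rewrite exprn_ge0.
have h1 : normc ((z + h) * ((z + h) ^+ n - z ^+ n - n%:R * z ^+ n.-1 * h)) * rho ^+ 2 <=
   n%:R ^+ 2 * rho ^+ n.+1 * normc h ^+ 2.
  rewrite normcM -mulrA [rho ^+ n.+1]exprS.
  rewrite (_ : n%:R ^+ 2 * (rho * rho ^+ n) * normc h ^+ 2 =
    rho * (n%:R ^+ 2 * rho ^+ n * normc h ^+ 2)); last ring.
  by apply: ler_pM => //; rewrite ?mulr_ge0 ?normc_ge0 ?exprn_ge0.
have h2 : normc (n%:R * z ^+ n.-1 * h ^+ 2) * rho ^+ 2 <=
   n%:R * rho ^+ n.+1 * normc h ^+ 2.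
  rewrite normcM normcX normcM normcX -(rmorph_nat (real_complex R)) normcR normr_nat.
  case: n {IH h1} => [|n] /=; first by rewrite !mul0r.
  rewrite mulrAC ler_wpM2r ?exprn_ge0// -mulrA ler_wpM2l//.
  rewrite -[n.+2]addn2 exprD ler_wpM2r ?exprn_ge0//.
  by apply: lerXn2r; rewrite ?nnegrE ?normc_ge0.
rewrite mulrDl; apply: le_trans (lerD h1 h2) _.
rewrite -!mulrDl -natr1; apply: ler_wpM2r; first by rewrite exprn_ge0.
apply: ler_wpM2r; first by rewrite exprn_ge0.
by have : 0 <= n%:R :> R by []; set m := n%:R; nra.
Qed.

Lemma psum_cderiv A f z : normc z < 1 ->
  (forall w, normc w < 1 -> psum A w (f w)) ->
  exists2 d, cderiv f z d & psum (fun n => n.+1%:R * A n.+1) z d.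
Proof.
(* By Bernoulli, the fourth power of q = 1 - t is at least 1 - 4 t, the midpoint of [normc z] and 1.
   This leaves room for [z + h] below [rho]. *)
move=> z1 hf; set t := (1 - normc z) / 8; set q := 1 - t.
have z0 := normc_ge0 z.
have t0 : 0 < t by rewrite /t; lra.
have t1 : t <= 1 / 8 by rewrite /t; lra.
have q0 : 0 < q by rewrite /q; lra.
have q1 : q < 1 by rewrite /q; lra.
have q01 : 0 <= q < 1 by rewrite q1 ltW.
(* The four factors [q ^+ k] of [rho ^+ k] are spent separately in the error estimate: one bounds
   [A k], two absorb the factor k^2, and the last leaves a convergent geometric series. *)
set rho := q ^+ 4.
have rho0 : 0 < rho by rewrite exprn_gt0.
have zrho : normc z < rho.
  have : 1 - 4 * t <= rho.
    by rewrite /rho (_ : q ^+ 4 = (q ^+ 2) ^+ 2) -?exprM// /q; nra.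
  by rewrite /t; lra.
have q1' : 0 < 1 - q by rewrite subr_gt0.
set K := (1 - q)^-1; have K0 : 0 < K by rewrite invr_gt0.
have [|M HM] := csum_terms_bounded (hf q%:C _); first by rewrite normcR gtr0_norm.
have {}HM n : normc (A n) * q ^+ n <= M.
  by have := HM n; rewrite normcM normcX normcR gtr0_norm.
have M0 : 0 <= M by apply: le_trans (HM 0%N); rewrite mulr_ge0 ?normc_ge0 ?exprn_ge0 ?ltW.
have rhoE n : rho ^+ n = q ^+ n * (q ^+ n * q ^+ n * q ^+ n).
  by rewrite /rho exprAC; ring.
have qn n : 0 <= q ^+ n by rewrite exprn_ge0 // ltW.
have rho1 : rho <= 1 by rewrite exprn_ile1 ?ltW.
clearbody rho.
have lin n : n%:R * q ^+ n <= K by exact: linear_geometric_le.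
have [d hd] : exists d, psum (fun n => n.+1%:R * A n.+1) z d.
  apply: (csum_geometric (M := M * K / rho) q01) => n.
  rewrite !normcM normcX -(rmorph_nat (real_complex R)) normcR normr_nat.
  rewrite [leRHS]mulrAC ler_pdivlMr//.
  apply: le_trans (_ : n.+1%:R * normc (A n.+1) * rho ^+ n.+1 <= _).
    rewrite [rho ^+ n.+1]exprSr mulrA; apply: ler_wpM2r; first exact: ltW.
    rewrite ler_wpM2l ?mulr_ge0 ?normc_ge0//.
    by apply: lerXn2r; rewrite ?nnegrE ?normc_ge0 ?ltW.
  rewrite rhoE.
  rewrite (_ : _ * _ = (normc (A n.+1) * q ^+ n.+1) * (n.+1%:R * q ^+ n.+1) * (q ^+ n.+1 * q ^+ n.+1)); last ring.
  apply: ler_pM => //; rewrite ?mulr_ge0 ?normc_ge0//.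
    by apply: ler_pM => //; rewrite ?mulr_ge0 ?normc_ge0.
  rewrite -exprD; apply: ler_wiXn2l; rewrite ?ltW//.
  by rewrite (leq_trans (leqnSn n))// leq_addr.
exists d => //; pose S := M * (K * K) * K / rho ^+ 2.
have S0 : 0 <= S.
  by apply: divr_ge0; [rewrite !mulr_ge0// ltW|rewrite exprn_ge0// ltW].
have main h : normc h < rho - normc z -> normc (f (z + h) - f z - d * h) <= S * normc h ^+ 2.
  move=> hr; have zh : normc (z + h) < rho by apply: le_lt_trans (le_normcD _ _) _; lra.
  have c1 := csumB (hf _ (lt_le_trans zh rho1)) (hf _ z1).
  have c2 : csum (fun n => n%:R * A n * z ^+ n.-1 * h) (d * h).
    have : csum (fun n => h * (n.+1%:R * A n.+1 * z ^+ n)) (h * d) := csumZ h hd.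
    move=> H e /H[N HN]; exists N.+1 => -[//|n]; rewrite ltnS => /HN.
    rewrite big_ord_recl /= !mul0r add0r; congr (normc (_ - _) < _); last exact: mulrC.
    by apply: eq_bigr => i _; rewrite mulrC.
  apply: (csum_norm_le (csumB c1 c2)) => N.
  apply: le_trans (normc_sum_le _ _ _) _.
  apply: le_trans (_ : \sum_(k < N) M * (K * K) / rho ^+ 2 * normc h ^+ 2 * q ^+ k <= _).
    apply: ler_sum => k _.
    have hE := normc_binomial_rest k (ltW zrho) (ltW zh).
    rewrite (_ : _ - _ - _ = A k * ((z + h) ^+ k - z ^+ k - k%:R * z ^+ k.-1 * h)); last ring.
    rewrite normcM; set E := normc (_ - _ - _) in hE *.
    rewrite (_ : _ * _ * _ = M * (K * K) * normc h ^+ 2 * q ^+ k / rho ^+ 2); last ring.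
    rewrite ler_pdivlMr ?exprn_gt0// -[leLHS]mulrA.
    apply: le_trans (ler_wpM2l (normc_ge0 _) hE) _.
    rewrite rhoE.
    set qk := q ^+ k; rewrite [leLHS](_ : _ = (normc (A k) * qk) * ((k%:R * qk) * (k%:R * qk)) * normc h ^+ 2 * qk); last ring.
    rewrite /qk.
    rewrite ler_wpM2r// ler_wpM2r ?exprn_ge0 ?normc_ge0//.
    by apply: ler_pM => //; rewrite ?mulr_ge0 ?normc_ge0//; apply: ler_pM; rewrite ?mulr_ge0.
  rewrite -mulr_sumr.
  rewrite (_ : S * normc h ^+ 2 = M * (K * K) / rho ^+ 2 * normc h ^+ 2 * K); last by rewrite /S; ring.
  apply: ler_wpM2l; last exact: geometric_sum_le.
  apply: mulr_ge0; last by rewrite exprn_ge0// normc_ge0.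
  by apply: divr_ge0; [rewrite !mulr_ge0// ltW|rewrite exprn_ge0// ltW].
move=> e e0.
exists (Num.min (rho - normc z) (e / (S + 1))) => [|h].
  by rewrite lt_min subr_gt0 zrho divr_gt0// ltr_wpDl.
rewrite lt_min => /andP[/main le he]; apply: le_trans le _.
rewrite expr2 mulrA ler_wpM2r ?normc_ge0//.
apply: le_trans (_ : (S + 1) * normc h <= _).
  by rewrite ler_wpM2r ?normc_ge0// lerDl.
by rewrite mulrC -ler_pdivlMr ?ltW// ltr_wpDl.
Qed.

(** The formula at radius r only gives the expansion for [normc w < r]; uniqueness near 0 shows that
    the coefficients do not depend on r. *)
Lemma holomorphic_disc_psum f :
  (forall z, normc z < 1 -> holomorphic_at f z) ->
  exists A, forall w, normc w < 1 -> psum A w (f w).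
Proof.
move=> hf; have h2 : 0 < (1 / 2 : R) by lra.
exists (taylor_coef f (1 / 2)) => w w1.
pose r := Num.max (1 / 2) ((1 + normc w) / 2).
have r1 : r < 1 by rewrite gt_max; apply/andP; split; lra.
have wr : normc w < r by rewrite lt_max; apply/orP; right; lra.
have r0 : 0 < r by rewrite lt_max h2.
have half1 : (1 / 2 : R) < 1 by lra.
have -> : taylor_coef f (1 / 2) = taylor_coef f r.
  apply/funext; apply: (@psum_unique _ _ f (1 / 2)) => // z zh.
    exact: taylor_coefP.
  by apply: taylor_coefP => //; rewrite lt_max zh.
exact: taylor_coefP.
Qed.

End PowerSeries.

(** * Moments of the Bergman weight *)

Section RadialWeights.
Variable R : realType.
Variable s : R.
Hypothesis s_gt1 : 1 < s.
Local Notation mu := (@lebesgue_measure R).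

(** The weight times |z^n|^2 on the circle of radius [r], including the Jacobian factor [r]. *)
Definition radial (n : nat) (r : R) := (1 - r ^+ 2) `^ (s - 2) * r ^+ n.*2.+1.

(* The integral of [radial n] over [0, 1], by the recursion which integration by
   parts gives. *)
Fixpoint moment (n : nat) : R :=
  if n is m.+1 then moment m * (n%:R / (m%:R + s)) else (2 * (s - 1))^-1.

Lemma moment_gt0 n : 0 < moment n.
Proof.
elim: n => [|n IH] /=; first by rewrite invr_gt0 mulr_gt0// subr_gt0.
rewrite mulr_gt0// divr_gt0// ltr_wpDl// (lt_trans ltr01)//.
Qed.

Lemma radial_ge0 n r : 0 <= r -> 0 <= radial n r.
Proof. by move=> r0; rewrite mulr_ge0 ?powR_ge0 ?exprn_ge0. Qed.

Let sq_lt1 (r : R) : 0 <= r -> r < 1 -> 0 < 1 - r ^+ 2.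
Proof. by move=> r0 r1; rewrite subr_gt0 expr_lt1. Qed.

Let is_derive_powR_sq (a r : R) : 0 < 1 - r ^+ 2 ->
  is_derive r 1 (fun x : R => (1 - x ^+ 2) `^ a) (- (2 * a * r) * (1 - r ^+ 2) `^ (a - 1)).
Proof.
move=> r1; have h : is_derive r 1 (fun x : R => 1 - x ^+ 2) (- (2 * r)).
  by apply: is_derive_eq; rewrite /GRing.scale/=; ring.
have := @is_derive1_comp R (powR (R := R) ^~ a) (fun x : R => 1 - x ^+ 2) r _ _
  (is_derive1_powR a r1) h.
by move=> h'; apply: is_derive_eq h' _; ring.
Qed.

Lemma radial_cont n b : b < 1 -> cont_seg 0 b (radial n).
Proof.
move=> b1 r /andP[r0 rb].
have h := is_derive_powR_sq (s - 2) (sq_lt1 r0 (le_lt_trans rb b1)).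
have c : {for r, continuous (fun x : R => (1 - x ^+ 2) `^ (s - 2))}.
  by apply: differentiable_continuous; apply/derivable1_diffP; have [] := h.
by apply: cvgM c _; exact: exprn_continuous.
Qed.

Let moment0_trunc b : 0 < b -> b < 1 ->
  rint 0 b (radial 0) = (1 - (1 - b ^+ 2) `^ (s - 1)) / (2 * (s - 1)).
Proof.
move=> b0 b1; have s1 : s - 1 != 0 by rewrite gt_eqF// subr_gt0.
have dP r : 0 <= r <= b ->
    is_derive r 1 (fun r : R => - (1 - r ^+ 2) `^ (s - 1) / (2 * (s - 1))) (radial 0 r).
  move=> /andP[r0 rb]; have h := is_derive_powR_sq (s - 1) (sq_lt1 r0 (le_lt_trans rb b1)).
  have -> : (fun r : R => - (1 - r ^+ 2) `^ (s - 1) / (2 * (s - 1))) =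
      (fun r : R => (- (2 * (s - 1))^-1) *: (1 - r ^+ 2) `^ (s - 1)).
    by apply/funext => x; rewrite /GRing.scale/=; ring.
  apply: is_derive_eq; rewrite /radial /GRing.scale/= (_ : s - 1 - 1 = s - 2); last ring.
  by field.
rewrite (rint_derive b0 (radial_cont b1) dP).
by rewrite expr0n /= subr0 powR1; field.
Qed.

(** Integration by parts, written with the explicit primitive r^(2n+2) (1 - r^2)^(s-1). The
    truncation at b < 1 avoids the singularity of the weight at 1 for s < 2; as s > 1, the boundary
    term tends to 0. *)
Let momentS_trunc n b : 0 < b -> b < 1 ->
  (2 * n.+1%:R) * rint 0 b (radial n) - 2 * (n%:R + s) * rint 0 b (radial n.+1) =
  b ^+ n.+1.*2 * (1 - b ^+ 2) `^ (s - 1).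
Proof.
move=> b0 b1; rewrite -!rintZ; [|exact: radial_cont..].
have cz k m : cont_seg 0 b (fun x => k * radial m x).
  by move=> r rb; apply: cvgM; [exact: cvg_cst|exact: radial_cont rb].
rewrite -rintB; [|exact: cz..].
have cB : cont_seg 0 b (fun x => 2 * n.+1%:R * radial n x - 2 * (n%:R + s) * radial n.+1 x).
  by move=> r rb; apply: cvgB; [exact: cz rb|exact: cz rb].
have dP r : 0 <= r <= b ->
    is_derive r 1 (fun r : R => r ^+ n.+1.*2 * (1 - r ^+ 2) `^ (s - 1))
    (2 * n.+1%:R * radial n r - 2 * (n%:R + s) * radial n.+1 r).
  move=> /andP[r0 rb]; have rp := sq_lt1 r0 (le_lt_trans rb b1).
  have h := is_derive_powR_sq (s - 1) rp.
  have h2 : is_derive r 1 (fun r : R => r ^+ n.+1.*2) (n.+1.*2%:R * r ^+ n.*2.+1).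
    apply: DeriveDef; first exact: exprn_derivable.
    by rewrite exp_derive /GRing.scale/= mulr1.
  have h3 := is_deriveM h2 h.
  apply: is_derive_eq h3 _.
  have -> : (1 - r ^+ 2) `^ (s - 1) = (1 - r ^+ 2) * (1 - r ^+ 2) `^ (s - 2).
    rewrite -[X in X * _](powRr1 (ltW rp)) -powRD; last first.
      by rewrite (gt_eqF rp) implybT.
    by congr (_ `^ _); ring.
  rewrite /radial /GRing.scale/= (_ : s - 1 - 1 = s - 2); last ring.
  have -> : n.+1.*2%:R = 2 * n.+1%:R :> R by rewrite -muln2 natrM mulrC.
  rewrite doubleS [r ^+ n.*2.+3]exprS [r ^+ n.*2.+2]exprS -[n.+1%:R]natr1.
  by ring.
rewrite (rint_derive b0 cB dP).
by rewrite [0 ^+ n.+1.*2]expr0n /= mul0r subr0.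
Qed.

(** The shift by 2 keeps [bk 0] positive. *)
Let bk (k : nat) : R := 1 - k.+2%:R^-1.

Let bk_gt0 k : 0 < bk k.
Proof. by rewrite subr_gt0 invf_lt1// ltr1n. Qed.

Let bk_lt1 k : bk k < 1.
Proof. by rewrite ltrBlDr ltrDl invr_gt0. Qed.

Let cvg_bk : bk k @[k --> \oo] --> (1 : R).
Proof.
rewrite -[X in _ --> X]subr0; apply: cvgB; first exact: cvg_cst.
have := @cvg_harmonic R; rewrite -cvg_shiftS; exact.
Qed.

Let cvg_boundary n : bk k ^+ n * (1 - bk k ^+ 2) `^ (s - 1) @[k --> \oo] --> (0 : R).
Proof.
have s1 : 0 < s - 1 by rewrite subr_gt0.
apply/cvgrPdist_lt => e e0.
have /cvgrPdist_lt/(_ e e0)[d /= d0 Hd] := powR_cvg0 s1.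
have /cvgrPdist_lt/(_ _ (divr_gt0 d0 (ltr0n _ 2)))[N _ HN] := cvg_bk.
exists N => // k /HN /=.
have -> : 1 - bk k = k.+2%:R^-1 by rewrite /bk; ring.
rewrite ger0_norm ?invr_ge0// => kd.
have b0 := bk_gt0 k; have b1 := bk_lt1 k.
have x0 : 0 < 1 - bk k ^+ 2 by rewrite sq_lt1// ltW.
have xd : 1 - bk k ^+ 2 < d.
  have kE : k.+2%:R^-1 = 1 - bk k by rewrite /bk; ring.
  by rewrite kE in kd; nra.
have := Hd (1 - bk k ^+ 2); rewrite /ball_ /= !sub0r !normrN.
rewrite [X in X < d -> _]gtr0_norm// => /(_ xd x0) le.
apply: le_lt_trans le; rewrite normrM ler_piMl//.
by rewrite normrX exprn_ile1// ger0_norm ltW.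
Qed.

Lemma moment_cvg n : rint 0 (bk k) (radial n) @[k --> \oo] --> moment n.
Proof.
elim: n => [|n IH].
  have -> : moment 0 = (1 - 0) / (2 * (s - 1)) by rewrite /= subr0 mul1r.
  under eq_fun do rewrite moment0_trunc//.
  apply: cvgMl; apply: cvgB; first exact: cvg_cst.
  have := cvg_boundary 0; apply: cvg_trans; apply: near_eq_cvg.
  by near=> k; rewrite expr0 mul1r.
have ns : n%:R + s != 0 by rewrite gt_eqF// ltr_wpDl// (lt_trans ltr01).
have E k : rint 0 (bk k) (radial n.+1) =
    (2 * n.+1%:R * rint 0 (bk k) (radial n) -
     bk k ^+ n.+1.*2 * (1 - bk k ^+ 2) `^ (s - 1)) / (2 * (n%:R + s)).
  by rewrite -momentS_trunc//; field.
under eq_fun do rewrite E.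
have -> : moment n.+1 = (2 * n.+1%:R * moment n - 0) / (2 * (n%:R + s)).
  by rewrite /= subr0; field.
apply: cvgMl; apply: cvgB; last exact: cvg_boundary.
by apply: cvgMr.
Unshelve. all: by end_near.
Qed.

Lemma measurable_radial n : measurable_fun setT (radial n).
Proof.
apply: measurable_funM; last exact: measurable_funX.
apply: (measurableT_comp (measurable_powR (s - 2))).
by apply: measurable_funB => //; exact: measurable_funX.
Qed.

Lemma integral_radial n :
  (\int[mu]_(r in `[0%R, 1%R[) (radial n r)%:E = (moment n)%:E)%E.
Proof.
have U : \bigcup_k `[0, bk k]%classic = `[0, 1[%classic :> set R.
  apply/seteqP; split => [r [k _]|r] /=; rewrite !in_itv/=.
    by move=> /andP[-> rk]; apply: le_lt_trans rk _.
  move=> /andP[r0 r1]; have /cvgrPdist_lt/(_ (1 - r))[|N _ /(_ N (leqnn N))] := cvg_bk.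
    by rewrite subr_gt0.
  move=> /= h; exists N => //=; rewrite in_itv/= r0 /=.
  by move: h; rewrite gtr0_norm ?subr_gt0//; lra.
have := @ge0_nondecreasing_set_cvg_integral _ (measurableTypeR R) R (fun k => `[0, bk k]%classic)
  (fun r => (radial n r)%:E) mu.
rewrite U => /(_ _ _ _ _)/wrap[].
- move=> k l kl; apply/subsetPset => r /=; rewrite !in_itv/= => /andP[-> rk].
  by apply: le_trans rk _; rewrite lerD2l lerN2 lef_pV2 ?posrE// ler_nat !ltnS.
- by move=> k.
- move=> k; apply/measurable_EFinP; apply: measurable_funTS; exact: measurable_radial.
- by move=> k r /=; rewrite in_itv/= => /andP[r0 _]; rewrite lee_fin radial_ge0.
move=> H; have E k : (\int[mu]_(x in `[0%R, bk k]) (radial n x)%:E)%E = (rint 0 (bk k) (radial n))%:E.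
  rewrite /rint /Rintegral fineK//.
  by apply: integrable_fin_num => //; apply: cont_seg_integrable; exact: radial_cont.
apply: (cvg_unique _ H) => //.
rewrite (_ : (fun k => _) = (fun k => (rint 0 (bk k) (radial n))%:E)); last exact/funext.
by apply: cvg_EFin; [exact: nearW|exact: moment_cvg].
Qed.

End RadialWeights.

(** * Parseval's identity and the Bergman norm *)

Section Parseval.
Variable R : realType.
Local Notation C := R[i].
Local Notation mu := (@lebesgue_measure R).
Implicit Types (A : nat -> C) (f : C -> C) (z : C) (r t : R).

(** Comparison with the bounded terms at the radius halfway between [r] and 1 gives a geometric
    rate, uniform on the circle. *)
Lemma psum_uniform A f r : 0 <= r < 1 ->
  (forall w, normc w < 1 -> psum A w (f w)) ->
  exists K q : R, [/\ 0 <= K, 0 <= q < 1 & forall N z, normc z = r ->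
    normc (f z - \sum_(k < N) A k * z ^+ k) <= K * q ^+ N].
Proof.
move=> /andP[r0 r1] hf; pose x := (1 + r) / 2.
have x0 : 0 < x by rewrite /x; lra.
have x1 : x < 1 by rewrite /x; lra.
have [|M HM] := csum_terms_bounded (hf x%:C _); first by rewrite normcR gtr0_norm.
have {}HM n : normc (A n) * x ^+ n <= M.
  by have := HM n; rewrite normcM normcX normcR gtr0_norm.
have M0 : 0 <= M by apply: le_trans (HM 0%N); rewrite mulr_ge0 ?normc_ge0 ?exprn_ge0 ?ltW.
pose q := r / x.
have q0 : 0 <= q by rewrite divr_ge0// ltW.
have q1 : q < 1 by rewrite ltr_pdivrMr// mul1r /x; lra.
have q01 : 0 <= q < 1 by rewrite q0.
exists (M / (1 - q)), q; split => //; first by rewrite divr_ge0// subr_ge0 ltW.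
move=> N z zr; have z1 : normc z < 1 by rewrite zr.
apply: (csum_norm_le (csum_shift N (hf z z1))) => n.
apply: le_trans (normc_sum_le _ _ _) _.
apply: le_trans (_ : \sum_(k < n) M * q ^+ N * q ^+ k <= _).
  apply: ler_sum => k _; rewrite normcM normcX zr -mulrA -exprD.
  rewrite expr_div_n mulrA ler_pdivlMr ?exprn_gt0//.
  by rewrite mulrAC ler_wpM2r ?exprn_ge0.
rewrite -mulr_sumr [leRHS]mulrAC; apply: ler_wpM2l.
  by rewrite mulr_ge0 ?exprn_ge0.
exact: geometric_sum_le.
Qed.

Lemma sqr_normcD (z w : C) : normc (z + w) ^+ 2 =
  normc z ^+ 2 + (normc w ^+ 2 + 2 * complex.Re (z * conjc w)).
Proof.
rewrite !sqr_normc ReM ReD ImD; case: z w => [a b] [c d] /=.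
ring.
Qed.

Lemma ccont_sqr_normc (F : R -> C) (a b : R) : ccont F ->
  cont_seg a b (fun t => normc (F t) ^+ 2).
Proof.
move=> cF t ht; have [c1 c2] := cF t.
rewrite (_ : (fun x => _) = (fun x => complex.Re (F x) * complex.Re (F x) +
    complex.Im (F x) * complex.Im (F x))).
  by apply: cvgD; exact: cvgM.
by apply/funext => x; rewrite sqr_normc !expr2.
Qed.

Let circ r t : C := polar (r, t).

(** Induction on the degree replaces the double sum. On the circle conj(z) = r^2 / z, so the cross
    term between the new monomial and the lower ones is a combination of strictly negative powers of
    z, of mean zero. *)
Lemma parseval_poly A r N : 0 < r ->
  rint 0 (2 * pi) (fun t => normc (\sum_(k < N) A k * circ r t ^+ k) ^+ 2) =
  2 * pi * \sum_(k < N) normc (A k) ^+ 2 * r ^+ k.*2.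
Proof.
move=> r0; have pp : 0 <= 2 * pi :> R by rewrite mulr_ge0// pi_ge0.
have cz : ccont (circ r) by exact: ccont_polar.
have nz t : normc (circ r t) = r by rewrite normc_polar// ltW.
have z0 t : circ r t != 0 by rewrite -normc_gt0 nz.
pose S N t := \sum_(k < N) A k * circ r t ^+ k.
have cS n : ccont (S n).
  by apply: (@ccont_sum _ _ (fun k t => A k * circ r t ^+ k)) => k; apply/ccontZ/ccontX.
have cn F (cF : ccont F) : cont_seg 0 (2 * pi) (fun t => normc (F t) ^+ 2).
  exact: ccont_sqr_normc.
elim: N => [|N IH].
  rewrite big_ord0 mulr0; under eq_rint do rewrite big_ord0 normc0 expr0n /=.
  by rewrite rint_cst// mul0r.
rewrite [in RHS]big_ord_recr /= [RHS]mulrDr -IH.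
pose T t := A N * circ r t ^+ N.
pose U t := \sum_(k < N) (conjc (A N) * A k * (r ^+ N.*2)%:C) * (circ r t ^+ (N - k))^-1.
have cU0 k : ccont (fun t => (conjc (A N) * A k * (r ^+ N.*2)%:C) * (circ r t ^+ (N - k))^-1).
  by apply/ccontZ/ccontV; [exact: ccontX|move=> t; rewrite expf_neq0].
have cU : ccont U by exact: ccont_sum cU0.
have cint_U : cint U = 0.
  rewrite /U (cint_sum _ cU0) big1// => k _.
  rewrite cintZ; last by apply: ccontV; [exact: ccontX|move=> t; rewrite expf_neq0].
  by rewrite cint_polarV// subn_eq0 leqNgt ltn_ord /= mulr0.
have conjz t : conjc (circ r t) = (r ^+ 2)%:C / circ r t.
  by apply: (mulIf (z0 t)); rewrite divfK// mulrC mulcJ nz.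
have UE t : U t = S N t * conjc (T t).
  rewrite /U /S mulr_suml; apply: eq_bigr => k _.
  have -> : conjc (T t) = conjc (A N) * ((r ^+ 2)%:C / circ r t) ^+ N.
    by rewrite -conjz /T rmorphM rmorphXn.
  rewrite expr_div_n -mul2n exprM rmorphXn.
  rewrite (_ : circ r t ^+ N = circ r t ^+ k * circ r t ^+ (N - k)); last first.
    by rewrite -exprD subnKC// ltnW.
  by field; rewrite !expf_neq0.
have key t : normc (\sum_(k < N.+1) A k * circ r t ^+ k) ^+ 2 =
    normc (S N t) ^+ 2 + (normc (A N) ^+ 2 * r ^+ N.*2 + 2 * complex.Re (U t)).
  rewrite big_ord_recr /= -/(S N t) -/(T t) UE.
  rewrite (_ : normc (A N) ^+ 2 * r ^+ N.*2 = normc (T t) ^+ 2); last first.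
    by rewrite /T normcM normcX nz exprMn -exprM muln2.
  exact: sqr_normcD.
rewrite (eq_rint (fun t _ => key t)).
have cRe : cont_seg 0 (2 * pi) (fun t => 2 * complex.Re (U t)).
  by move=> t ht; apply: cvgM; [exact: cvg_cst|exact: (cU t).1].
have cK : cont_seg 0 (2 * pi) (fun t : R => normc (A N) ^+ 2 * r ^+ N.*2).
  exact: cont_seg_cst.
rewrite rintD; [|exact: cn|by move=> t ht; apply: cvgD; [exact: cvg_cst|exact: cRe ht]].
rewrite (rintD cK cRe) (@rintZ _ _ _ (fun t => complex.Re (U t))); last first.
  by move=> t ht; exact: (cU t).1.
rewrite rint_cst// subr0 [rint _ _ (fun t => complex.Re (U t))](congr1 (@complex.Re R) cint_U).
by rewrite /= mulr0 addr0 [_ * (2 * pi)]mulrC.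
Qed.

Lemma parseval A f r : 0 < r < 1 -> (forall w, normc w < 1 -> psum A w (f w)) ->
  forall e, 0 < e -> exists N0 : nat, forall N, (N0 <= N)%N ->
  `|\sum_(k < N) 2 * pi * (normc (A k) ^+ 2 * r ^+ k.*2) -
    rint 0 (2 * pi) (fun t => normc (f (circ r t)) ^+ 2)| < e.
Proof.
move=> /andP[r0 r1] hf e e0; have r01 : 0 <= r < 1 by rewrite r1 ltW.
have pp : 0 <= 2 * pi :> R by rewrite mulr_ge0// pi_ge0.
have [K [q [K0 q01 HK]]] := psum_uniform r01 hf.
have nz t : normc (circ r t) = r by rewrite normc_polar// ltW.
(* With F the function and S its partial sum, |F| <= K and |S| <= 2 K, while |F - S| <= K q^N; so
   the squares differ by at most 3 K^2 q^N, over a length 2 pi. *)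
have [N0 HN] := geometric_small (3 * K ^+ 2 * (2 * pi)) q01 e0.
exists N0 => N /HN; apply: le_lt_trans.
rewrite -mulr_sumr -parseval_poly//.
have cz : ccont (circ r) by exact: ccont_polar.
have cS : ccont (fun t => \sum_(k < N) A k * circ r t ^+ k).
  by apply: (@ccont_sum _ _ (fun k t => A k * circ r t ^+ k)) => k; apply/ccontZ/ccontX.
have cf : ccont (fun t => f (circ r t)).
  apply: (ccont_comp cz) => t; have [|d hd _] := @psum_cderiv _ A f (circ r t) _ hf.
    by rewrite nz.
  exact: cderiv_cont hd.
have cn F (cF : ccont F) : cont_seg 0 (2 * pi) (fun t => normc (F t) ^+ 2).
  exact: ccont_sqr_normc.
rewrite -rintB; [|exact: cn..].
rewrite (_ : 3 * K ^+ 2 * (2 * pi) * q ^+ N = 3 * K ^+ 2 * q ^+ N * (2 * pi - 0)); last ring.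
apply: rint_norm_le => // [t ht|t ht].
  by apply: cvgB; [exact: cn cS t ht|exact: cn cf t ht].
have := HK N (circ r t) (nz t); have := HK 0%N (circ r t) (nz t).
rewrite big_ord0 subr0 expr0 mulr1 => h1 h2.
set F := f (circ r t) in h1 h2 *; set S := \sum_(k < N) _ in h2 *.
have qn0 : 0 <= q ^+ N by rewrite exprn_ge0//; case/andP: q01.
have qn1 : q ^+ N <= 1 by case/andP: q01 => ? ?; rewrite exprn_ile1// ltW.
have nS : normc S <= 2 * K.
  have -> : S = F - (F - S) by ring.
  apply: le_trans (normcB _ _) _.
  have : K * q ^+ N <= K by rewrite ler_piMr.
  by lra.
have d1 : `|normc S - normc F| <= K * q ^+ N.
  have hS : normc S <= normc F + normc (F - S).
    by rewrite -{1}(subKr F S) normcB.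
  have hF : normc F <= normc S + normc (F - S).
    by rewrite -{1}(subrK S F) addrC; exact: le_normcD.
  by rewrite ler_norml; apply/andP; split; lra.
rewrite subr_sqr normrM.
have d2 : `|normc S + normc F| <= 3 * K.
  by rewrite ger0_norm ?addr_ge0 ?normc_ge0//; lra.
rewrite [leRHS](_ : _ = K * q ^+ N * (3 * K)); last ring.
by apply: ler_pM.
Qed.

Lemma nneseries_real (x : nat -> R) (l : R) :
  (forall e, 0 < e -> exists N0 : nat, forall N, (N0 <= N)%N ->
    `|\sum_(k < N) x k - l| < e) ->
  (\sum_(0 <= k <oo) (x k)%:E = l%:E)%E.
Proof.
move=> H; apply/cvg_lim => //.
under eq_fun do rewrite sumEFin big_mkord.
apply: cvg_EFin; first exact: nearW.
apply/cvgrPdist_lt => e /H[N HN]; exists N => // n /= /HN.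
by rewrite distrC.
Qed.

End Parseval.

(** * The squared norm as a weighted sum over Taylor coefficients *)

Section NormIdentity.
Variable R : realType.
Variable s : R.
Hypothesis s_gt1 : 1 < s.
Local Notation C := R[i].
Local Notation mu := (@lebesgue_measure R).
Implicit Types (A : nat -> C) (f : C -> C) (z : C) (r t : R).

(* The squared norm of the monomial of degree [n]. *)
Definition bweight n := 2 * pi * moment s n.

Lemma bweight_gt0 n : 0 < bweight n.
Proof. by rewrite mulr_gt0 ?moment_gt0// mulr_gt0// pi_gt0. Qed.

Lemma bweightS n : bweight n.+1 * (n%:R + s) = bweight n * n.+1%:R.
Proof.
rewrite /bweight /=; field.
by rewrite gt_eqF// ltr_wpDl// (lt_trans ltr01).
Qed.

Let T2 := (measurableTypeR R * measurableTypeR R)%type.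

Let density f (p : T2) : R := normc (f (polar p)) ^+ 2 * bergman_weight s p.

Lemma measurable_polarX n :
  measurable_fun setT (fun p : T2 => complex.Re (polar p ^+ n)) /\
  measurable_fun setT (fun p : T2 => complex.Im (polar p ^+ n)).
Proof.
have mc : measurable_fun setT (fun p : T2 => p.1 * cos p.2).
  apply: measurable_funM; first exact: measurable_fst.
  apply: (measurableT_comp (f := @cos R)); last exact: measurable_snd.
  by apply: continuous_measurable_fun; exact: continuous_cos.
have ms : measurable_fun setT (fun p : T2 => p.1 * sin p.2).
  apply: measurable_funM; first exact: measurable_fst.
  apply: (measurableT_comp (f := @sin R)); last exact: measurable_snd.
  by apply: continuous_measurable_fun; exact: continuous_sin.
elim: n => [|n [IH1 IH2]].
  by split; exact: measurable_cst.
split.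
  rewrite (_ : (fun p => _) = (fun p : T2 => (p.1 * cos p.2) * complex.Re (polar p ^+ n) -
    (p.1 * sin p.2) * complex.Im (polar p ^+ n))); last first.
    by apply/funext => p; rewrite exprS ReM.
  by apply: measurable_funB; exact: measurable_funM.
rewrite (_ : (fun p => _) = (fun p : T2 => (p.1 * cos p.2) * complex.Im (polar p ^+ n) +
  (p.1 * sin p.2) * complex.Re (polar p ^+ n))); last first.
  by apply/funext => p; rewrite exprS ImM.
by apply: measurable_funD; exact: measurable_funM.
Qed.

Lemma measurable_polar_disc : measurable (@polar_disc R).
Proof. by apply: measurableX; exact: measurable_itv. Qed.

Lemma polar_disc_normc (p : T2) : polar_disc p -> normc (polar p) < 1.
Proof.
case: p => r t [r01 _]; have /andP[r0 r1] : 0 <= r < 1 by move: r01; rewrite /= in_itv.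
by rewrite normc_polar.
Qed.

Lemma measurable_bergman_weight : measurable_fun setT (bergman_weight s : T2 -> R).
Proof.
apply: measurable_funM; last exact: measurable_fst.
apply: (measurableT_comp (measurable_powR (s - 2))).
by apply: measurable_funB => //; apply: measurable_funX; exact: measurable_fst.
Qed.

(** Measurability passes from the Taylor polynomials to their pointwise limit. *)
Lemma measurable_psum_polar A f : (forall w, normc w < 1 -> psum A w (f w)) ->
  measurable_fun (@polar_disc R) (fun p : T2 => complex.Re (f (polar p))) /\
  measurable_fun (@polar_disc R) (fun p : T2 => complex.Im (f (polar p))).
Proof.
move=> hf.
pose S N (p : T2) := \sum_(k < N) A k * polar p ^+ k.
have SRe N p : complex.Re (S N p) = \sum_(k < N) (complex.Re (A k) * complex.Re (polar p ^+ k) -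
    complex.Im (A k) * complex.Im (polar p ^+ k)).
  rewrite /S (big_morph _ (@ReD R) (erefl : complex.Re 0 = 0)).
  by apply: eq_bigr => k _; rewrite ReM.
have SIm N p : complex.Im (S N p) = \sum_(k < N) (complex.Re (A k) * complex.Im (polar p ^+ k) +
    complex.Im (A k) * complex.Re (polar p ^+ k)).
  rewrite /S (big_morph _ (@ImD R) (erefl : complex.Im 0 = 0)).
  by apply: eq_bigr => k _; rewrite ImM.
split.
  apply: (@measurable_fun_cvg _ _ _ _ (fun N p => complex.Re (S N p))).
    move=> N; apply: measurable_funTS; under eq_fun do rewrite SRe.
    apply: measurable_sum => k; have [m1 m2] := measurable_polarX k.
    by apply: measurable_funB; apply: measurable_funM.
  move=> p /polar_disc_normc /hf hp; apply/cvgrPdist_lt => e /hp[N HN].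
  exists N => // n /= /HN; apply: le_lt_trans.
  by rewrite distrC -ReB normRe_le.
apply: (@measurable_fun_cvg _ _ _ _ (fun N p => complex.Im (S N p))).
  move=> N; apply: measurable_funTS; under eq_fun do rewrite SIm.
  apply: measurable_sum => k; have [m1 m2] := measurable_polarX k.
  by apply: measurable_funD; apply: measurable_funM.
move=> p /polar_disc_normc /hf hp; apply/cvgrPdist_lt => e /hp[N HN].
exists N => // n /= /HN; apply: le_lt_trans.
by rewrite distrC -ImB normIm_le.
Qed.

Lemma measurable_density A f : (forall w, normc w < 1 -> psum A w (f w)) ->
  measurable_fun (@polar_disc R) (density f).
Proof.
move=> /measurable_psum_polar[m1 m2].
have mw : measurable_fun (@polar_disc R) (bergman_weight s : T2 -> R).
  by apply: measurable_funTS; exact: measurable_bergman_weight.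
have mn : measurable_fun (@polar_disc R) (fun p : T2 => normc (f (polar p)) ^+ 2).
  under eq_fun do rewrite sqr_normc.
  by apply: measurable_funD; exact: measurable_funX.
exact: measurable_funM.
Qed.

Let density_ge0 f p : polar_disc p -> 0 <= density f p.
Proof.
case: p => r t [/=]; rewrite in_itv/= => /andP[r0 r1] _.
by rewrite mulr_ge0 ?sqr_ge0// mulr_ge0 ?powR_ge0.
Qed.

Lemma tonelli_polar_disc (g : T2 -> R) : measurable_fun (@polar_disc R) g ->
  (forall p, polar_disc p -> 0 <= g p) ->
  (\int[@leb2 R]_(p in @polar_disc R) (g p)%:E =
   \int[mu]_(r in `[0%R, 1%R[) \int[mu]_(t in `[0%R, (2 * pi)%R[) (g (r, t))%:E)%E.
Proof.
move=> mg g0; rewrite integral_mkcond /leb2 fubini_tonelli1/=; last 2 first.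
- apply/(measurable_restrictT _ _).1; first exact: measurable_polar_disc.
  exact/measurable_EFinP.
- by move=> p; rewrite patchE; case: ifPn => // /set_mem/g0; rewrite lee_fin.
rewrite [RHS]integral_mkcond; apply: eq_integral => r _.
rewrite /fubini_F patchE; case: ifPn => [/set_mem r01|/negP r01].
  rewrite [RHS]integral_mkcond; apply: eq_integral => t _.
  rewrite !patchE; congr (if _ then _ else _).
  by apply/idP/idP => [/set_mem[_ /=]|/set_mem h]; rewrite inE.
rewrite integral0_eq// => t _; rewrite patchE; case: ifPn => // /set_mem[/= h _].
by exfalso; apply: r01; rewrite inE.
Qed.

(** Parseval in the angle, then the moments in the radius, with sum and integral exchanged because
    all terms are nonnegative. The identity lives in the extended reals, so it decides the
    integrability of the density along with its integral. *)
Lemma integral_density A f : (forall w, normc w < 1 -> psum A w (f w)) ->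
  (\int[@leb2 R]_(p in @polar_disc R) (density f p)%:E =
   \sum_(0 <= n <oo) (bweight n * normc (A n) ^+ 2)%:E)%E.
Proof.
move=> hf; rewrite tonelli_polar_disc//; last 2 first.
- exact: measurable_density hf.
- by move=> p; exact: density_ge0.
pose h n r := 2 * pi * normc (A n) ^+ 2 * radial s n r.
have h0 n r : 0 <= r -> 0 <= h n r.
  move=> r0; apply: mulr_ge0; last exact: radial_ge0.
  by rewrite mulr_ge0 ?sqr_ge0// mulr_ge0// pi_ge0.
have inner r : 0 <= r < 1 ->
   (\int[mu]_(t in `[0%R, (2 * pi)%R[) (density f (r, t))%:E =
    \sum_(0 <= n <oo) (h n r)%:E)%E.
  move=> /andP[r0 r1].
  have [->|rn0] := eqVneq r 0.
    rewrite integral0_eq => [|t _]; last by rewrite /density /bergman_weight /= !mulr0.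
    by rewrite eseries0// => n _ _; rewrite /h /radial [0 ^+ n.*2.+1]exprS mul0r !mulr0.
  have rp : 0 < r by rewrite lt_def rn0.
  pose W := (1 - r ^+ 2) `^ (s - 2) * r.
  have W0 : 0 <= W by rewrite mulr_ge0 ?powR_ge0.
  have pp : 0 <= 2 * pi :> R by rewrite mulr_ge0// pi_ge0.
  pose F t := normc (f (polar (r, t))) ^+ 2.
  have cF : cont_seg 0 (2 * pi) F.
    have cf : ccont (fun t => f (polar (r, t))).
      apply: (ccont_comp (ccont_polar r)) => t'.
      have [|d hd _] := @psum_cderiv _ A f (polar (r, t')) _ hf.
        by rewrite normc_polar.
      exact: cderiv_cont hd.
    exact: ccont_sqr_normc.
  have cFW : cont_seg 0 (2 * pi) (fun t => W * F t).
    by move=> t ht; apply: cvgM; [exact: cvg_cst|exact: cF ht].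
  have iFW := cont_seg_integrable cFW.
  transitivity (\int[mu]_(t in `[0%R, (2 * pi)%R[) (W * F t)%:E)%E.
    by apply: eq_integral => t _; rewrite /density /bergman_weight /F /W /= mulrC.
  rewrite integral_itv_bndo_bndc; last first.
    apply: measurable_funS (measurable_int _ iFW); first exact: measurable_itv.
    by apply: subset_itvl; rewrite bnd_simp.
  transitivity (rint 0 (2 * pi) (fun t => W * F t))%:E.
    by rewrite /rint /Rintegral fineK//; exact: integrable_fin_num.
  rewrite rintZ//; apply/esym/nneseries_real => e e0.
  have W1 : 0 < W + 1 by rewrite ltr_wpDl.
  have r01 : 0 < r < 1 by rewrite rp.
  have [N HN] := parseval r01 hf (divr_gt0 e0 W1); exists N => n /HN.
  rewrite ltr_pdivlMr// => le.
  rewrite (_ : \sum_(k < n) h k r = W * \sum_(k < n) 2 * pi * (normc (A k) ^+ 2 * r ^+ k.*2)).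
    rewrite -mulrBr normrM ger0_norm//; apply: le_lt_trans le.
    by rewrite mulrC ler_wpM2l// lerDl.
  rewrite mulr_sumr; apply: eq_bigr => k _.
  by rewrite /h /W /radial [r ^+ k.*2.+1]exprS; ring.
transitivity (\int[mu]_(r in `[0%R, 1%R[) \sum_(0 <= n <oo) (h n r)%:E)%E.
  by apply: eq_integral => r; rewrite inE/= in_itv/= => /inner.
have mr n : measurable_fun (`[0, 1[ : set (measurableTypeR R)) (fun r => (radial s n r)%:E).
  by apply/measurable_EFinP; apply: measurable_funTS; exact: measurable_radial.
rewrite integral_nneseries//.
- apply: eq_eseriesr => n _; rewrite /h.
  under eq_integral do rewrite EFinM.
  rewrite ge0_integralZl_EFin//=.
  + by rewrite integral_radial// -EFinM /bweight; congr (_%:E); ring.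
  + by move=> r /=; rewrite in_itv/= => /andP[r0 _]; rewrite lee_fin radial_ge0.
  + by rewrite mulr_ge0 ?sqr_ge0// mulr_ge0// pi_ge0.
- move=> n; apply/measurable_EFinP; apply: measurable_funM; first exact: measurable_cst.
  by apply: measurable_funTS; exact: measurable_radial.
- by move=> n r /=; rewrite in_itv/= => /andP[r0 _]; rewrite lee_fin h0.
Qed.

End NormIdentity.

(** * Bergman functions and their coefficients *)

Section BergmanSpace.
Variable R : realType.
Variable s : R.
Hypothesis s_gt1 : 1 < s.
Local Notation C := R[i].
Local Notation bw := (bweight s).
Implicit Types (A B : nat -> C) (f g : C -> C) (z w a : C).

Definition ell2 A := exists M, forall N, \sum_(k < N) bw k * normc (A k) ^+ 2 <= M.

Lemma bw_term_ge0 A k : 0 <= bw k * normc (A k) ^+ 2.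
Proof. by rewrite mulr_ge0 ?sqr_ge0// ltW// bweight_gt0. Qed.

Let T2 := (measurableTypeR R * measurableTypeR R)%type.
Let dens f (p : T2) : R := complex.Re `|f (polar p)| ^+ 2 * bergman_weight s p.

Let densE f : dens f = (fun p => normc (f (polar p)) ^+ 2 * bergman_weight s p).
Proof. by apply/funext => p; rewrite /dens normcE. Qed.

Let dens_ge0 f p : polar_disc p -> 0 <= dens f p.
Proof.
case: p => r t [r01 _]; have /andP[r0 r1] : 0 <= r < 1 by move: r01; rewrite /= in_itv.
by rewrite mulr_ge0 ?sqr_ge0// mulr_ge0 ?powR_ge0.
Qed.

Let integral_dens A f : (forall w, normc w < 1 -> psum A w (f w)) ->
  (\int[@leb2 R]_(p in @polar_disc R) (dens f p)%:E =
   \sum_(0 <= n <oo) (bw n * normc (A n) ^+ 2)%:E)%E.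
Proof. by move=> hf; rewrite -(integral_density s_gt1 hf) densE. Qed.

(** Reduces membership to a bound on finite sums of coefficients, which is how closure properties of
    the space and its completeness are checked. *)
Lemma bergmanP f : bergman s f <-> (forall w, ~ unit_disc w -> f w = 0) /\
  exists2 A, forall w, normc w < 1 -> psum A w (f w) & ell2 A.
Proof.
split=> [[f0 fh fi]|[f0 [A hA [M HM]]]].
  split=> //; have [|A hA] := @holomorphic_disc_psum _ f.
    by move=> z z1; apply: fh; apply/unit_discE.
  exists A => //; have /= fin := integrable_fin_num (@measurable_polar_disc R) fi.
  rewrite -/(dens f) (integral_dens hA) in fin.
  exists (fine (\sum_(0 <= n <oo) (bw n * normc (A n) ^+ 2)%:E)%E) => N.
  rewrite -lee_fin fineK// -sumEFin.
  apply: le_trans (nneseries_lim_ge N _); first by rewrite big_mkord.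
  by move=> k _; rewrite lee_fin bw_term_ge0.
split=> // [w /unit_discE w1|].
  by have [d hd _] := psum_cderiv w1 hA; exact: cderiv_holo hd.
apply/integrableP; split.
  apply/measurable_EFinP; rewrite -/(dens f) densE; exact: measurable_density hA.
rewrite (eq_integral (fun p => (dens f p)%:E)); last first.
  by move=> p /set_mem hp; rewrite gee0_abs// lee_fin dens_ge0.
rewrite (integral_dens hA); apply: le_lt_trans (ltry M).
apply: lime_le; first by apply: is_cvg_nneseries => k _ _; rewrite lee_fin bw_term_ge0.
by apply: nearW => N; rewrite sumEFin lee_fin big_mkord.
Qed.

Definition coef f : nat -> C :=
  xget (fun=> 0) [set A | forall w, normc w < 1 -> psum A w (f w)].

Lemma coefP f : bergman s f -> forall w, normc w < 1 -> psum (coef f) w (f w).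
Proof.
move=> /bergmanP[_ [A hA _]]; rewrite /coef.
by case: xgetP => [B -> //|/(_ A)]; move=> /(_ hA).
Qed.

Lemma coef_unique f A : bergman s f ->
  (forall w, normc w < 1 -> psum A w (f w)) -> coef f = A.
Proof. by move=> bf hA; apply/funext; exact: psum_unique ltr01 (coefP bf) hA. Qed.

Lemma coef_ell2 f : bergman s f -> ell2 (coef f).
Proof. by move=> bf; have [_ [A hA lA]] := (bergmanP f).1 bf; rewrite (coef_unique bf hA). Qed.

Lemma bergman_eq f g : bergman s f -> bergman s g -> coef f = coef g -> f = g.
Proof.
move=> bf bg e; apply/funext => w; have [w1|w1] := ltP (normc w) 1.
  by have := coefP bf w1; rewrite e => /csum_unique; apply; exact: coefP.
have hw : ~ unit_disc w by move/unit_discE; rewrite ltNge w1.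
have [f0 _] := (bergmanP f).1 bf; have [g0 _] := (bergmanP g).1 bg.
by rewrite f0// g0//.
Qed.

Lemma ell2D A B : ell2 A -> ell2 B -> ell2 (fun k => A k + B k).
Proof.
move=> [M HM] [M' HM']; exists (2 * M + 2 * M') => N.
apply: le_trans (_ : \sum_(k < N) (2 * (bw k * normc (A k) ^+ 2) + 2 * (bw k * normc (B k) ^+ 2)) <= _).
  apply: ler_sum => k _; rewrite [leRHS](_ : _ = bw k * (2 * normc (A k) ^+ 2 + 2 * normc (B k) ^+ 2)); last by ring.
  apply: ler_wpM2l; first exact/ltW/bweight_gt0.
  have := le_normcD (A k) (B k); have := normc_ge0 (A k + B k).
  move: (normc (A k + B k)) (normc (A k)) (normc (B k)) => x y z x0 le.
  have h1 : x ^+ 2 <= (y + z) ^+ 2 by rewrite lerXn2r ?nnegrE// (le_trans x0).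
  have h2 := sqr_ge0 (y - z); apply: le_trans h1 _; rewrite -subr_ge0.
  by rewrite (_ : _ - _ = (y - z) ^+ 2)//; ring.
have p2 : 0 <= 2 :> R by lra.
by rewrite big_split /= -!mulr_sumr; apply: lerD; apply: (ler_wpM2l p2); [exact: HM|exact: HM'].
Qed.

Lemma ell2Z a A : ell2 A -> ell2 (fun k => a * A k).
Proof.
move=> [M HM]; exists (normc a ^+ 2 * M) => N.
under eq_bigr do rewrite normcM exprMn mulrCA.
by rewrite -mulr_sumr ler_wpM2l// sqr_ge0.
Qed.

Lemma bergmanD f g : bergman s f -> bergman s g -> bergman s (fun w => f w + g w).
Proof.
move=> /bergmanP[f0 [A hA lA]] /bergmanP[g0 [B hB lB]]; apply/bergmanP; split.
  by move=> w hw; rewrite f0// g0// addr0.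
exists (fun k => A k + B k); last exact: ell2D.
by move=> w w1; apply: eq_csum (csumD (hA w w1) (hB w w1)) => n; rewrite mulrDl.
Qed.

Lemma bergmanZ a f : bergman s f -> bergman s (fun w => a * f w).
Proof.
move=> /bergmanP[f0 [A hA lA]]; apply/bergmanP; split.
  by move=> w hw; rewrite f0// mulr0.
exists (fun k => a * A k); last exact: ell2Z.
by move=> w w1; apply: eq_csum (csumZ a (hA w w1)) => n; rewrite mulrA.
Qed.

Lemma bergman0 : bergman s (fun=> 0).
Proof.
apply/bergmanP; split=> //; exists (fun=> 0).
  by move=> w _; apply: eq_csum (@csum0 R) => n; rewrite mul0r.
by exists 0 => N; rewrite big1// => k _; rewrite normc0 expr0n mulr0.
Qed.

Lemma bergmanB f g : bergman s f -> bergman s g -> bergman s (fun w => f w - g w).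
Proof.
move=> bf bg; rewrite (_ : (fun w => _) = (fun w => f w + -1 * g w)).
  by apply: bergmanD => //; exact: bergmanZ.
by apply/funext => w; rewrite mulN1r.
Qed.

Lemma bergman_sum n (F : 'I_n -> C -> C) : (forall i, bergman s (F i)) ->
  bergman s (fun w => \sum_i F i w).
Proof.
elim: n F => [|n IH] F hF.
  rewrite (_ : (fun w => _) = (fun=> 0)); first exact: bergman0.
  by apply/funext => w; rewrite big_ord0.
rewrite (_ : (fun w => _) = (fun w => F ord0 w + \sum_i F (lift ord0 i) w)).
  by apply: bergmanD => //; exact: IH.
by apply/funext => w; rewrite big_ord_recl.
Qed.

Lemma coefD f g : bergman s f -> bergman s g ->
  coef (fun w => f w + g w) = (fun k => coef f k + coef g k).
Proof.
move=> bf bg; apply: coef_unique; first exact: bergmanD.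
by move=> w w1; apply: eq_csum (csumD (coefP bf w1) (coefP bg w1)) => n; rewrite mulrDl.
Qed.

Lemma coefZ a f : bergman s f -> coef (fun w => a * f w) = (fun k => a * coef f k).
Proof.
move=> bf; apply: coef_unique; first exact: bergmanZ.
by move=> w w1; apply: eq_csum (csumZ a (coefP bf w1)) => n; rewrite mulrA.
Qed.

Lemma coefB f g : bergman s f -> bergman s g ->
  coef (fun w => f w - g w) = (fun k => coef f k - coef g k).
Proof.
move=> bf bg; apply: coef_unique; first exact: bergmanB.
by move=> w w1; apply: eq_csum (csumB (coefP bf w1) (coefP bg w1)) => n; rewrite mulrBl.
Qed.

(** The ratio of consecutive weights is (k + 1) / (k + s), which tends to 1 and so exceeds [q] from
    some index on. *)
Lemma bweight_geometric (q : R) : 0 < q < 1 ->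
  exists2 c, 0 < c & forall k, c * q ^+ k <= bw k.
Proof.
move=> /andP[q0 q1].
(* Chosen so that q (k + s) <= k + 1 for all k >= K. *)
pose K := Num.bound (q * s / (1 - q)).
have q1' : 0 < 1 - q by rewrite subr_gt0.
have step k : (K <= k)%N -> bw k * q <= bw k.+1.
  move=> Kk; have s0 : 0 < s by exact: lt_trans s_gt1.
  have ks : 0 < k%:R + s by rewrite ltr_wpDl.
  rewrite -(ler_pM2r ks) bweightS// -mulrA ler_pM2l ?bweight_gt0//.
  have : q * s / (1 - q) < k%:R.
    apply: lt_le_trans (_ : K%:R <= _); last by rewrite ler_nat.
    by rewrite archi_boundP// divr_ge0 ?mulr_ge0 ?ltW.
  by rewrite ltr_pdivrMr// -natr1; nra.
have [c c0 Hc] : exists2 c, 0 < c & forall k, (k <= K)%N -> c <= bw k.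
  elim: (K) => [|n [c c0 Hc]].
    by exists (bw 0); [exact: bweight_gt0|case].
  exists (Num.min c (bw n.+1)) => [|k]; first by rewrite lt_min c0 bweight_gt0.
  by rewrite leq_eqVlt => /predU1P[->|/Hc le]; rewrite ge_min ?lexx ?orbT// le.
exists c => //; elim=> [|k IH]; first by rewrite expr0 mulr1 Hc.
have [kK|Kk] := leqP k.+1 K.
  apply: le_trans (Hc _ kK); apply: ler_piMr; first exact: ltW.
  by rewrite exprn_ile1// ltW.
apply: le_trans (step k Kk); rewrite exprSr mulrA ler_wpM2r// ltW//.
Qed.

(** The weights decay more slowly than any geometric sequence; hence [A k * r ^+ k] is bounded for
    [r] between [normc w] and 1. *)
Lemma ell2_psum A w : ell2 A -> normc w < 1 -> exists l, psum A w l.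
Proof.
move=> [M HM] w1; have w0 := normc_ge0 w.
pose r := (1 + normc w) / 2.
have r0 : 0 < r by rewrite /r; lra.
have r1 : r < 1 by rewrite /r; lra.
have [|c c0 Hc] := bweight_geometric (q := r ^+ 2).
  by rewrite exprn_gt0// exprn_ilt1// ltW.
have b k : normc (A k) * r ^+ k <= 1 + M / c.
  have h : bw k * normc (A k) ^+ 2 <= M.
    apply: le_trans (HM k.+1); rewrite big_ord_recr /= lerDr sumr_ge0// => i _.
    exact: bw_term_ge0.
  have : (normc (A k) * r ^+ k) ^+ 2 <= M / c.
    rewrite ler_pdivlMr// exprMn -exprM mulnC exprM; apply: le_trans h.
    rewrite [leLHS](_ : _ = normc (A k) ^+ 2 * (c * (r ^+ 2) ^+ k)); last ring.
    by rewrite [leRHS]mulrC ler_wpM2l ?sqr_ge0.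
  by move: (_ * _) => x; nra.
have q01 : 0 <= normc w / r < 1.
  apply/andP; split; first by apply: divr_ge0 => //; exact: ltW.
  by rewrite ltr_pdivrMr// mul1r /r; lra.
apply: (csum_geometric (M := 1 + M / c) q01) => k.
rewrite normcM normcX expr_div_n mulrA ler_pdivlMr ?exprn_gt0//.
by rewrite mulrAC ler_wpM2r ?exprn_ge0.
Qed.

Lemma ell2_bergman A : ell2 A ->
  exists2 f, bergman s f & coef f = A.
Proof.
move=> lA; pose f w := if normc w < 1 then xget 0 [set l | psum A w l] else 0.
have hf w : normc w < 1 -> psum A w (f w).
  move=> w1; rewrite /f w1; have [l hl] := ell2_psum lA w1.
  by case: xgetP => [l' -> //|/(_ l)]; move=> /(_ hl).
have bf : bergman s f.
  apply/bergmanP; split; last by exists A.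
  by move=> w hw; rewrite /f; case: ifP => // w1; exfalso; apply/hw/unit_discE.
by exists f => //; exact: coef_unique.
Qed.

Definition energy f : R := (\int[@leb2 R]_(p in @polar_disc R) dens f p)%R.

Let dens_integrable f : bergman s f ->
  (@leb2 R).-integrable (@polar_disc R) (EFin \o dens f).
Proof. by case. Qed.

Lemma energy_cvg f : bergman s f ->
  \sum_(k < N) bw k * normc (coef f k) ^+ 2 @[N --> \oo] --> energy f.
Proof.
move=> bf; have fi := dens_integrable bf.
have fin := integrable_fin_num (@measurable_polar_disc R) fi.
have E : (\sum_(0 <= n <oo) (bw n * normc (coef f n) ^+ 2)%:E = (energy f)%:E)%E.
  by rewrite -(integral_dens (coefP bf)) /energy /Rintegral fineK.
have H : (\sum_(0 <= n < N) (bw n * normc (coef f n) ^+ 2)%:E)%E @[N --> \oo] --> (energy f)%:E.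
  by rewrite -E; apply: is_cvg_nneseries => k _ _; rewrite lee_fin bw_term_ge0.
have /fine_cvgP[_ ] := H.
apply: cvg_trans; apply: near_eq_cvg; near=> N.
by rewrite /= sumEFin big_mkord.
Unshelve. all: by end_near.
Qed.

Let dens2 f g (p : T2) : R := complex.Re (f (polar p) * conjc (g (polar p))) * bergman_weight s p.

(** Polarization: the integral of the product and its expansion in coefficients are inherited from
    the three squared norms, whose densities are integrable. *)
Let inner_Re f g : bergman s f -> bergman s g ->
  (\int[@leb2 R]_(p in @polar_disc R) dens2 f g p)%R =
  (energy (fun w => f w + g w) - energy f - energy g) / 2.
Proof.
move=> bf bg; have bfg := bergmanD bf bg.
have i1 := dens_integrable bf; have i2 := dens_integrable bg.
have i3 := dens_integrable bfg.
have md := @measurable_polar_disc R.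
rewrite (_ : dens2 f g = (fun p => 2^-1 * (dens (fun w => f w + g w) p - dens f p - dens g p))).
  have i4 : (@leb2 R).-integrable (@polar_disc R)
      (EFin \o (fun p => dens (fun w => f w + g w) p - dens f p)).
    by apply: (integrableB md i3 i1).
  have i5 : (@leb2 R).-integrable (@polar_disc R)
      (EFin \o (fun p => dens (fun w => f w + g w) p - dens f p - dens g p)).
    by apply: (integrableB md i4 i2).
  by rewrite (RintegralZl 2^-1 md i5)// (RintegralB md i4 i2)// (RintegralB md i3 i1)// mulrC.
apply/funext => p; by rewrite !densE /dens2 sqr_normcD; field.
Qed.

Let inner_Im f g : bergman s f -> bergman s g ->
  (\int[@leb2 R]_(p in @polar_disc R)
    (complex.Im (f (polar p) * conjc (g (polar p))) * bergman_weight s p))%R =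
  (\int[@leb2 R]_(p in @polar_disc R) dens2 f (fun w => 'i * g w) p)%R.
Proof.
move=> bf bg; apply: eq_Rintegral => p _; rewrite /dens2; congr (_ * _).
by case: (f _) => a b; case: (g _) => c d /=; ring.
Qed.

Let re_csum f g : bergman s f -> bergman s g ->
  \sum_(k < N) bw k * complex.Re (coef f k * conjc (coef g k)) @[N --> \oo] -->
  (\int[@leb2 R]_(p in @polar_disc R) dens2 f g p)%R.
Proof.
move=> bf bg; rewrite inner_Re//; have bfg := bergmanD bf bg.
have H := cvgMr_tmp (cvgB (cvgB (energy_cvg bfg) (energy_cvg bf)) (energy_cvg bg)) (b := 2^-1).
apply: cvg_trans (H _ _ _); apply: near_eq_cvg; apply: nearW => N /=.
rewrite coefD//= !fctE /= -!sumrB mulr_suml; apply: eq_bigr => k _.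
by rewrite sqr_normcD; field.
Qed.

Lemma inner_csum f g : bergman s f -> bergman s g ->
  csum (fun k => (bw k)%:C * (coef f k * conjc (coef g k))) (bergman_inner s f g).
Proof.
move=> bf bg; have big := bergmanZ 'i bg.
have c1 := re_csum bf bg; have := re_csum bf big.
rewrite -inner_Im// coefZ// => c2.
move=> e e0; have e2 : 0 < e / 2 by lra.
have /cvgrPdist_lt /(_ _ e2) [N1 _ H1] := c1.
have /cvgrPdist_lt /(_ _ e2) [N2 _ H2] := c2.
exists (maxn N1 N2) => N; rewrite geq_max => /andP[n1 n2].
have h1 := H1 N n1; have h2 := H2 N n2; rewrite /= in h1 h2.
have -> : \sum_(k < N) (bw k)%:C * (coef f k * conjc (coef g k)) =
  (\sum_(k < N) bw k * complex.Re (coef f k * conjc (coef g k))) +i*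
  (\sum_(k < N) bw k * complex.Re (coef f k * conjc ('i * coef g k))).
  elim: (N) => [|m IH]; first by rewrite !big_ord0.
  rewrite !big_ord_recr IH; case: (coef f m) => a b; case: (coef g m) => c d.
  by apply/eqP; rewrite eq_complex /=; apply/andP; split; apply/eqP; ring.
apply: le_lt_trans (normc_leD _) _; rewrite ReB ImB /= distrC [X in _ + X]distrC.
by lra.
Qed.

End BergmanSpace.

(** * Hilbert space structure *)

Section Conjugation.
Variable R : realType.
Implicit Types (x y : R) (z w : R[i]).

Lemma conjcM z w : conjc (z * w) = conjc z * conjc w.
Proof. exact: rmorphM. Qed.

Lemma conjcD z w : conjc (z + w) = conjc z + conjc w.
Proof. exact: rmorphD. Qed.

Lemma conjcB z w : conjc (z - w) = conjc z - conjc w.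
Proof. exact: rmorphB. Qed.

Lemma conjcR x : conjc x%:C = x%:C.
Proof. by rewrite /conjc /= oppr0. Qed.

Lemma conjcN z : conjc (- z) = - conjc z.
Proof. exact: rmorphN. Qed.

Lemma conjcX z n : conjc (z ^+ n) = conjc z ^+ n.
Proof. exact: rmorphXn. Qed.

Lemma conjcV z : conjc z^-1 = (conjc z)^-1.
Proof. exact: fmorphV. Qed.

Lemma conjc_neq0 z : z != 0 -> conjc z != 0.
Proof. by rewrite -!normc_gt0 normcJ. Qed.

Lemma RC_neq0 x : x != 0 -> x%:C != 0.
Proof. by rewrite fmorph_eq0. Qed.

Lemma RCD x y : (x + y)%:C = x%:C + y%:C.
Proof. exact: rmorphD. Qed.

Lemma RCM x y : (x * y)%:C = x%:C * y%:C.
Proof. exact: rmorphM. Qed.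

Lemma RCV x : (x^-1)%:C = x%:C^-1.
Proof. exact: fmorphV. Qed.

Lemma RCB x y : (x - y)%:C = x%:C - y%:C.
Proof. exact: rmorphB. Qed.

Lemma RC_sum n (F : 'I_n -> R) : (\sum_(i < n) F i)%:C = \sum_(i < n) (F i)%:C.
Proof. exact: rmorph_sum. Qed.

Lemma conjc_sum n (F : 'I_n -> R[i]) : conjc (\sum_(i < n) F i) = \sum_(i < n) conjc (F i).
Proof. exact: rmorph_sum. Qed.

End Conjugation.

Section BergmanHilbert.
Variable R : realType.
Variable s : R.
Hypothesis s_gt1 : 1 < s.
Local Notation C := R[i].
Local Notation bw := (bweight s).
Local Notation energy := (energy s).
Local Notation ip := (bergman_inner s).
Implicit Types (f g h : C -> C) (a : C).

Lemma inner_unique f g l : bergman s f -> bergman s g ->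
  csum (fun k => (bw k)%:C * (coef f k * conjc (coef g k))) l -> ip f g = l.
Proof. by move=> bf bg; apply: csum_unique; exact: inner_csum. Qed.

Lemma innerD f g h : bergman s f -> bergman s g -> bergman s h ->
  ip (fun w => f w + g w) h = ip f h + ip g h.
Proof.
move=> bf bg bh; apply: inner_unique => //; first exact: bergmanD.
rewrite (coefD s_gt1)//; apply: eq_csum (csumD (inner_csum s_gt1 bf bh) (inner_csum s_gt1 bg bh)) => k.
by rewrite mulrDl mulrDr.
Qed.

Lemma innerZ a f g : bergman s f -> bergman s g ->
  ip (fun w => a * f w) g = a * ip f g.
Proof.
move=> bf bg; apply: inner_unique => //; first exact: bergmanZ.
rewrite (coefZ s_gt1)//; apply: eq_csum (csumZ a (inner_csum s_gt1 bf bg)) => k.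
by rewrite -mulrA mulrCA.
Qed.

Lemma csumJ (u : nat -> C) l : csum u l -> csum (fun k => conjc (u k)) (conjc l).
Proof.
move=> h e /h[N HN]; exists N => n /HN.
by rewrite -conjc_sum -conjcB normcJ.
Qed.

Lemma innerC f g : bergman s f -> bergman s g -> ip g f = conjc (ip f g).
Proof.
move=> bf bg; apply: inner_unique => //.
apply: eq_csum (csumJ (inner_csum s_gt1 bf bg)) => k.
by rewrite !conjcM conjcR conjcK [coef g k * _]mulrC.
Qed.

Lemma innerB f g h : bergman s f -> bergman s g -> bergman s h ->
  ip (fun w => f w - g w) h = ip f h - ip g h.
Proof.
move=> bf bg bh; rewrite (_ : (fun w => _) = (fun w => f w + -1 * g w)).
  by rewrite (innerD bf (bergmanZ s_gt1 _ bg) bh) innerZ// mulN1r.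
by apply/funext => w; rewrite mulN1r.
Qed.

Lemma inner_sum n (F : 'I_n -> C -> C) h : (forall i, bergman s (F i)) ->
  bergman s h -> ip (fun w => \sum_i F i w) h = \sum_i ip (F i) h.
Proof.
move=> hF bh; elim: n F hF => [|n IH] F hF.
  rewrite (_ : (fun w => _) = (fun w => 0 * h w)); first by rewrite innerZ// mul0r big_ord0.
  by apply/funext => w; rewrite big_ord0 mul0r.
rewrite (_ : (fun w => _) = (fun w => F ord0 w + \sum_i F (lift ord0 i) w)).
  rewrite (innerD (hF _) (bergman_sum s_gt1 (fun i => hF (lift ord0 i))) bh).
  by rewrite big_ord_recl IH.
by apply/funext => w; rewrite big_ord_recl.
Qed.

Lemma inner_energy f : bergman s f -> ip f f = (energy f)%:C.
Proof.
move=> bf; apply: inner_unique => // e e0.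
have /cvgrPdist_lt /(_ _ e0) [N _ HN] := energy_cvg s_gt1 bf.
exists N => n /HN /=; rewrite distrC -normcR; apply: le_lt_trans.
rewrite RCB RC_sum (eq_bigr (fun k : 'I_n => (bw k * normc (coef f k) ^+ 2)%:C))//.
by move=> k _; rewrite mulcJ RCM.
Qed.

Lemma energy_ge_partial f N : bergman s f ->
  \sum_(k < N) bw k * normc (coef f k) ^+ 2 <= energy f.
Proof.
move=> bf; have /cvg_lim <- // := energy_cvg s_gt1 bf.
apply: nondecreasing_cvgn_le; last by apply/cvg_ex; exists (energy f); exact: energy_cvg.
apply/nondecreasing_seqP => n; rewrite big_ord_recr /= lerDl.
exact: bw_term_ge0.
Qed.

Lemma energy_le f S : bergman s f ->
  (forall N, \sum_(k < N) bw k * normc (coef f k) ^+ 2 <= S) -> energy f <= S.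
Proof.
move=> bf h; have E := energy_cvg s_gt1 bf.
by rewrite -(cvg_lim _ E)//; apply: limr_le; [apply/cvg_ex; exists (energy f)|exact: nearW].
Qed.

Lemma energy_ge0 f : bergman s f -> 0 <= energy f.
Proof. by move=> bf; have := energy_ge_partial 0 bf; rewrite big_ord0. Qed.

Lemma coef_le_energy f k : bergman s f -> bw k * normc (coef f k) ^+ 2 <= energy f.
Proof.
move=> bf; apply: le_trans (energy_ge_partial k.+1 bf); rewrite big_ord_recr /= lerDr.
by apply: sumr_ge0 => i _; exact: bw_term_ge0.
Qed.

Lemma energyD f g : bergman s f -> bergman s g ->
  energy (fun w => f w + g w) = energy f + energy g + 2 * complex.Re (ip f g).
Proof.
move=> bf bg; have bfg := bergmanD s_gt1 bf bg.
have : (energy (fun w => f w + g w))%:C = (energy f)%:C + (energy g)%:C + (ip f g + conjc (ip f g)).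
  rewrite -!inner_energy// innerD// (innerC bfg bf) (innerC bfg bg) !innerD//.
  by rewrite !conjcD -!innerC//; ring.
by case: (ip f g) => x y [] -> _ /=; ring.
Qed.

Lemma energyZ a f : bergman s f -> energy (fun w => a * f w) = normc a ^+ 2 * energy f.
Proof.
move=> bf; have baf := bergmanZ s_gt1 a bf.
have : (energy (fun w => a * f w))%:C = (normc a ^+ 2 * energy f)%:C.
  by rewrite -inner_energy// innerZ// (innerC baf bf) innerZ// conjcM -innerC// inner_energy// RCM -mulcJ mulrA.
by case.
Qed.

Lemma energyB f g : bergman s f -> bergman s g ->
  energy (fun w => f w - g w) = energy f + energy g - 2 * complex.Re (ip f g).
Proof.
move=> bf bg; rewrite (_ : (fun w => _) = (fun w => f w + -1 * g w)).
  rewrite energyD//; last exact: bergmanZ.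
  rewrite energyZ// (innerC (bergmanZ s_gt1 _ bg) bf) innerZ// conjcM -innerC//.
  by rewrite normcN normc1 expr1n mul1r rmorphN1 mulN1r; case: (ip f g) => x y /=; ring.
by apply/funext => w; rewrite mulN1r.
Qed.

Lemma energyBC f g : energy (fun w => f w - g w) = energy (fun w => g w - f w).
Proof.
apply: eq_Rintegral => p _; rewrite !normcE.
by rewrite normcBC.
Qed.

Lemma energy_eq0 f : bergman s f -> energy f = 0 -> f = (fun=> 0).
Proof.
move=> bf f0; apply: (bergman_eq s_gt1) => //; first exact: bergman0.
apply/funext => k; rewrite (_ : (fun=> 0) = (fun w => 0 * f w)); last first.
  by apply/funext => w; rewrite mul0r.
rewrite (coefZ s_gt1)// mul0r; apply/eqP; rewrite -normc_eq0 -sqrf_eq0 eq_le sqr_ge0 andbT.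
by have := coef_le_energy k bf; rewrite f0 pmulr_rle0// bweight_gt0.
Qed.

(* The optimal multiple of [g] is the orthogonal projection of [u] onto [g]. *)
Lemma inner_sqr_le u g (d : R) : bergman s u -> bergman s g ->
  (forall a, d <= energy (fun w => u w - a * g w)) ->
  normc (ip u g) ^+ 2 <= (energy u - d) * energy g.
Proof.
move=> bu bg hd; have [g0|g0] := eqVneq (energy g) 0.
  rewrite (energy_eq0 bg g0) (_ : (fun=> 0) = (fun w => 0 * u w)); last first.
    by apply/funext => w; rewrite mul0r.
  rewrite (innerC (bergmanZ s_gt1 _ bu) bu) innerZ// mul0r conjc0 normc0 energyZ//.
  by rewrite normc0 expr0n mul0r mulr0.
have gp : 0 < energy g by rewrite lt_neqAle eq_sym g0 energy_ge0.
have := hd (ip u g / (energy g)%:C).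
rewrite energyB//; last exact: bergmanZ.
rewrite energyZ// (innerC (bergmanZ s_gt1 _ bg) bu) innerZ// conjcM -innerC//.
rewrite normcM -RCV normcR normfV (gtr0_norm gp).
have -> : complex.Re (conjc (ip u g * ((energy g)^-1)%:C) * ip u g) = normc (ip u g) ^+ 2 / energy g.
  by rewrite conjcM conjcR mulrAC [conjc _ * _]mulrC mulcJ -RCM.
rewrite -ler_pdivrMr//; move: (normc _) (energy _) gp g0 (energy u) => x y y0 yn0 z.
rewrite (_ : (x / y) ^+ 2 * y = x ^+ 2 / y); last by field.
by move: (x ^+ 2 / y) => t; lra.
Qed.

Lemma cauchy_schwarz f g : bergman s f -> bergman s g ->
  normc (ip f g) ^+ 2 <= energy f * energy g.
Proof.
move=> bf bg; rewrite -[energy f]subr0; apply: inner_sqr_le => // a.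
by apply: energy_ge0; apply: bergmanB => //; exact: bergmanZ.
Qed.

Lemma energy_parallelogram f g : bergman s f -> bergman s g ->
  energy (fun w => f w + g w) + energy (fun w => f w - g w) = 2 * energy f + 2 * energy g.
Proof. by move=> bf bg; rewrite energyD// energyB//; ring. Qed.

Definition energy_lim (F : nat -> C -> C) f := forall e, 0 < e ->
  exists N, forall n, (N <= n)%N -> energy (fun w => F n w - f w) < e.

Lemma real_cauchy_cvg (x : nat -> R) :
  (forall e, 0 < e -> exists N, forall m n, (N <= m)%N -> (N <= n)%N -> `|x m - x n| < e) ->
  exists l : R, x n @[n --> \oo] --> l.
Proof.
move=> h; apply/cvg_ex; apply/cauchy_cvgP; apply: cauchy_exP => e e0.
have [N HN] := h e e0; exists (x N); exists N => // n Nn.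
exact: (HN N n (leqnn N) Nn).
Qed.

(** Each coefficient is Cauchy, being controlled by the norm. Bounds on finite partial sums survive
    the limit, uniformly in the number of terms, so the limit sequence is square summable and is
    approached in norm. *)
Lemma bergman_complete (F : nat -> C -> C) : (forall n, bergman s (F n)) ->
  (forall e, 0 < e -> exists N, forall m n, (N <= m)%N -> (N <= n)%N ->
     energy (fun w => F m w - F n w) < e) ->
  exists2 f, bergman s f & energy_lim F f.
Proof.
move=> bF hc.
have lim_coef k : exists a : C,
    complex.Re (coef (F n) k) @[n --> \oo] --> complex.Re a /\
    complex.Im (coef (F n) k) @[n --> \oo] --> complex.Im a.
  have small e : 0 < e -> exists N, forall m n, (N <= m)%N -> (N <= n)%N ->
      normc (coef (F m) k - coef (F n) k) < e.
    move=> e0; have b0 := bweight_gt0 s_gt1 k.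
    have [|N HN] := hc (bw k * e ^+ 2); first by rewrite mulr_gt0 ?exprn_gt0.
    exists N => m n Nm Nn; have le := HN m n Nm Nn.
    have := coef_le_energy k (bergmanB s_gt1 (bF m) (bF n)).
    rewrite (coefB s_gt1)// => /le_lt_trans/(_ le).
    rewrite (ltr_pM2l b0) => h; rewrite -(@ltr_pXn2r _ 2)// ?nnegrE ?normc_ge0//; exact: ltW.
  have [|x Hx] := @real_cauchy_cvg (fun n => complex.Re (coef (F n) k)).
    move=> e /small[N HN]; exists N => m n Nm Nn; rewrite -ReB.
    exact: le_lt_trans (normRe_le _) (HN m n Nm Nn).
  have [|y Hy] := @real_cauchy_cvg (fun n => complex.Im (coef (F n) k)).
    move=> e /small[N HN]; exists N => m n Nm Nn; rewrite -ImB.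
    exact: le_lt_trans (normIm_le _) (HN m n Nm Nn).
  by exists (x +i* y).
have [A HA] := choice lim_coef.
have cvg_part (B : nat -> C) M : \sum_(k < M) bw k * normc (coef (F n) k - B k) ^+ 2 @[n --> \oo] -->
    \sum_(k < M) bw k * normc (A k - B k) ^+ 2.
  elim: M => [|M IH].
    by under eq_fun do rewrite big_ord0; rewrite big_ord0; exact: cvg_cst.
  under eq_fun do rewrite big_ord_recr; rewrite big_ord_recr.
  apply: cvgD => //; apply: cvgMl_tmp; have [h1 h2] := HA M.
  under eq_fun do rewrite sqr_normc ReB ImB; rewrite sqr_normc ReB ImB.
  by apply: cvgD; apply: cvgM; apply: cvgB => //; exact: cvg_cst.
have part e : 0 < e -> exists N, forall n, (N <= n)%N -> forall M,
    \sum_(k < M) bw k * normc (A k - coef (F n) k) ^+ 2 <= e.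
  move=> /hc[N HN]; exists N => n Nn M.
  apply: ler_cvg_to (cvg_part (coef (F n)) M) (cvg_cst e) _.
  exists N => // m Nm /=; apply: le_trans (ltW (HN m n Nm Nn)).
  have := energy_ge_partial M (bergmanB s_gt1 (bF m) (bF n)).
  by rewrite (coefB s_gt1).
have lA : ell2 s A.
  have [N HN] := part 1 ltr01.
  rewrite (_ : A = fun k => (A k - coef (F N) k) + coef (F N) k).
    by apply: (ell2D s_gt1) (coef_ell2 s_gt1 (bF N)); exists 1 => M; exact: HN.
  by apply/funext => k; rewrite subrK.
have [f bf fA] := ell2_bergman s_gt1 lA.
exists f => // e e0; have e2 : 0 < e / 2 by lra.
have [N HN] := part _ e2; exists N => n Nn.
apply: le_lt_trans (_ : e / 2 < e); last by lra.
rewrite energyBC; apply: energy_le; first exact: bergmanB.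
by move=> M; rewrite (coefB s_gt1)// fA; exact: HN.
Qed.

Lemma inv_succ_small (e : R) : 0 < e -> exists N, forall n, (N <= n)%N -> n.+1%:R^-1 < e.
Proof. by move=> e0; have [N _ HN] := near_infty_natSinv_lt (PosNum e0); exists N. Qed.

(** Closedness is asked along sequences only, the form in which it can be checked both for vanishing
    conditions and for the set of functions on which an operator is isometric. *)
Lemma orthogonal_projection (M : set (C -> C)) f :
  M `<=` bergman s -> M (fun=> 0) ->
  (forall g h, M g -> M h -> M (fun w => g w + h w)) ->
  (forall a g, M g -> M (fun w => a * g w)) ->
  (forall F g, (forall n, M (F n)) -> bergman s g -> energy_lim F g -> M g) ->
  bergman s f ->
  exists2 m, M m & forall g, M g -> ip (fun w => f w - m w) g = 0.
Proof.
move=> Mb M0 MD MZ Mc bf.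
pose E := [set energy (fun w => f w - m w) | m in M].
have hE : has_inf E.
  split; first by exists (energy (fun w => f w - 0)), (fun=> 0).
  by exists 0 => _ [m Mm <-]; apply: energy_ge0; apply: bergmanB => //; exact: Mb.
have dle m : M m -> inf E <= energy (fun w => f w - m w).
  by move=> Mm; apply: ge_inf; [exact: hE.2|exists m].
set d := inf E in dle.
have adh n : exists m, M m /\ energy (fun w => f w - m w) < d + n.+1%:R^-1.
  have [|_ [m Mm <-] le] := @inf_adherent _ E n.+1%:R^-1 _ hE; last by exists m.
  by rewrite invr_gt0 ltr0n.
have [F HF] := choice adh.
have bF n : bergman s (F n) by apply: Mb; exact: (HF n).1.
have bfF n : bergman s (fun w => f w - F n w) by exact: bergmanB.
(* The parallelogram law for [f - F i] and [f - F j]: the midpoint of [F i] and [F j] lies in [M],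
   so its squared distance to [f] is at least [d]. *)
have near i j : energy (fun w => F i w - F j w) <= 2 * i.+1%:R^-1 + 2 * j.+1%:R^-1.
  have [Mi li] := HF i; have [Mj lj] := HF j.
  have := energy_parallelogram (bfF j) (bfF i).
  rewrite (_ : (fun w => _ - _ - _) = (fun w => F i w - F j w)); last first.
    by apply/funext => w; ring.
  rewrite (_ : (fun w => _ - _ + _) = (fun w => 2 * (f w - 2^-1 * (F i w + F j w)))); last first.
    by apply/funext => w; field.
  have bm : M (fun w => 2^-1 * (F i w + F j w)) by apply: (MZ 2^-1); exact: MD.
  rewrite energyZ; last by apply: bergmanB => //; exact: Mb.
  have := dle _ bm; rewrite (_ : normc 2 = 2); last first.
    by rewrite (_ : 2 = (2:R)%:C) ?normcR ?normr_nat// rmorph_nat.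
  rewrite (_ : 2 ^+ 2 = 4 :> R); last by rewrite -natrX.
  move: li lj; move: (energy (fun w => f w - F i w)) (energy (fun w => f w - F j w)) => x y.
  move: (energy (fun w => F i w - F j w)) (energy _) (i.+1%:R^-1) (j.+1%:R^-1) => z u p q *.
  lra.
have [|m bm Fm] := bergman_complete bF.
  move=> e e0; have [|N HN] := @inv_succ_small (e / 4); first by lra.
  by exists N => i j /HN h1 /HN h2; apply: le_lt_trans (near i j) _;
    move: (i.+1%:R^-1) (j.+1%:R^-1) h1 h2 => p q; lra.
have Mm : M m by apply: Mc Fm => // n; exact: (HF n).1.
exists m => // g Mg; have bg := Mb _ Mg.
apply: normc_small_eq0 => e e0.
pose c := energy g + 1; have c0 : 0 < c by rewrite ltr_wpDl// energy_ge0.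
have t0 : 0 < e ^+ 2 / (4 * c) by rewrite divr_gt0 ?exprn_gt0 ?mulr_gt0.
have [N1 H1] := inv_succ_small t0; have [N2 H2] := Fm _ t0.
pose n := maxn N1 N2.
have {}H1 := H1 n (leq_maxl _ _); have {}H2 := H2 n (leq_maxr _ _).
have -> : ip (fun w => f w - m w) g = ip (fun w => f w - F n w) g + ip (fun w => F n w - m w) g.
  by rewrite !innerB//; ring.
(* [F n] misses the infimum by less than 1 / (n + 1), and a nonzero inner product with [g] would
   allow an improvement of [F n] along [g] by a comparable amount. *)
have h1 : normc (ip (fun w => f w - F n w) g) ^+ 2 <= n.+1%:R^-1 * energy g.
  apply: le_trans (inner_sqr_le (d := d) (bfF n) bg _) _.
    move=> a; rewrite (_ : (fun w => _) = (fun w => f w - (F n w + a * g w))).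
      by apply: dle; apply: MD; [exact: (HF n).1|exact: MZ].
    by apply/funext => w; ring.
  apply: ler_wpM2r; first exact: energy_ge0.
  by rewrite lerBlDl; exact: ltW (HF n).2.
have h2 := cauchy_schwarz (bergmanB s_gt1 (bF n) bm) bg.
have g0 := energy_ge0 bg.
have l1 : n.+1%:R^-1 * energy g <= e ^+ 2 / 4.
  apply: le_trans (_ : e ^+ 2 / (4 * c) * c <= _); last by rewrite le_eqVlt; apply/orP; left; apply/eqP; field; rewrite gt_eqF.
  apply: ler_pM; [by rewrite invr_ge0|exact: g0|exact: ltW|by rewrite /c; lra].
have l2 : energy (fun w => F n w - m w) * energy g <= e ^+ 2 / 4.
  apply: le_trans (_ : e ^+ 2 / (4 * c) * c <= _); last by rewrite le_eqVlt; apply/orP; left; apply/eqP; field; rewrite gt_eqF.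
  apply: ler_pM; [by apply: energy_ge0; exact: bergmanB|exact: g0|exact: ltW|by rewrite /c; lra].
apply: le_trans (le_normcD _ _) _.
have half z : normc z ^+ 2 <= e ^+ 2 / 4 -> normc z <= e / 2.
  move=> h; rewrite -(@ler_pXn2r _ 2)// ?nnegrE ?normc_ge0//; last by lra.
  by apply: le_trans h _; rewrite expr_div_n -natrX.
have := half _ (le_trans h1 l1); have := half _ (le_trans h2 l2).
by move: (normc _) (normc _) => x y; lra.
Qed.

End BergmanHilbert.

(** * The reproducing kernel and unitary operators *)

Lemma csum_partial_le (R : realType) (u : nat -> R) l n : (forall k, 0 <= u k) ->
  csum (fun k => (u k)%:C) l -> \sum_(k < n) u k <= normc l + 1.
Proof.
move=> u0 /(_ 1 ltr01)[N HN].
have mono : \sum_(k < n) u k <= \sum_(k < N + n) u k.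
  elim: (N) => [|m IH]; first by rewrite add0n.
  by rewrite addSn big_ord_recr /= (le_trans IH)// lerDl.
apply: le_trans mono _; have := HN (N + n)%N (leq_addr _ _); rewrite -RC_sum => lt.
rewrite -[leLHS]ger0_norm; last by apply: sumr_ge0.
rewrite -normcR -[_%:C](subrK l); apply: le_trans (le_normcD _ _) _.
by rewrite addrC lerD2l; exact: ltW.
Qed.

Section ReproducingKernel.
Variable R : realType.
Variable s : R.
Hypothesis s_gt1 : 1 < s.
Local Notation C := R[i].
Local Notation bw := (bweight s).
Local Notation energy := (energy s).
Local Notation ip := (bergman_inner s).
Implicit Types (f g h : C -> C) (a b c w : C).

Variable Lam : C -> C.
Hypothesis Lam0 : Lam 0 = 0.
Hypothesis Lam_cont : forall u, normc u < 1 -> {for u, continuous (Lam : C^o -> C^o)}.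
Hypothesis Lam_log : forall u, normc u < 1 -> cexp (Lam u) = (1 - u)^-1.

(** The power (1 - u)^(-s) on the unit disc, for the branch with value 1 at 0. *)
Let F u := cexp (s%:C * Lam u).

Lemma disc_sub1_neq0 (u : C) : normc u < 1 -> 1 - u != 0.
Proof.
by move=> u1; apply/eqP => /subr0_eq e; move: u1; rewrite -e normc1 ltxx.
Qed.

Lemma kernel_cderiv u : normc u < 1 -> cderiv F u (s%:C * F u / (1 - u)).
Proof.
move=> u1; have n0 := disc_sub1_neq0 u1.
have c1 : cderiv (fun w => 1 - w) u (-1).
  by have := cderivB (cderiv_cst u 1) (cderiv_id u); rewrite sub0r.
have [d hd] := @cderivV _ (fun w => 1 - w) u _ n0 c1.
have dE : d = (1 - u)^-1 ^+ 2.
  have := cderivM c1 hd; have one : cderiv (fun w => (1 - w) * (1 - w)^-1) u 0.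
    apply: (@cderiv_ext _ (fun=> 1) _ _ _ (1 - normc u)) (cderiv_cst _ _).
      by rewrite subr_gt0.
    move=> w wu; rewrite divff// disc_sub1_neq0// -(subrK u w).
    by apply: le_lt_trans (le_normcD _ _) _; rewrite -ltrBrDr.
  move=> /cderiv_unique/(_ one) e; apply: (mulfI n0).
  rewrite expr2 mulrA divff// mul1r; apply/eqP; rewrite -subr_eq0 -e; apply/eqP.
  by rewrite mulrN1.
have cl : cderiv Lam u (1 - u)^-1.
  have := @cderiv_log _ (fun w => (1 - w)^-1) Lam u d (Lam_cont u1) _ hd.
  rewrite dE invrK expr2 -mulrA mulVf// mulr1; apply.
  apply/nbhs_complexP; exists (1 - normc u); first by rewrite subr_gt0.
  move=> w wu; apply: Lam_log; rewrite -(subrK u w).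
  by apply: le_lt_trans (le_normcD _ _) _; rewrite -ltrBrDr.
have := cderiv_comp (cderivM (cderiv_cst u s%:C) cl) (cderiv_cexp _).
by rewrite mulr0 addr0 -/(F u) mulrA [F u * _]mulrC.
Qed.

Lemma psum_at0 (A : nat -> C) l : psum A 0 l -> A 0%N = l.
Proof.
move=> h; apply: csum_unique h => e e0; exists 1%N => -[//|n] _.
rewrite big_ord_recl big1 => [|i _]; first by rewrite expr0 mulr1 addr0 subrr normc0.
by rewrite exprS mul0r mulr0.
Qed.

Lemma csum_cons (u : nat -> C) l a : csum u l ->
  csum (fun n => if n is m.+1 then u m else a) (a + l).
Proof.
move=> h e /h[N HN]; exists N.+1 => -[//|n] Nn.
by rewrite big_ord_recl /= opprD addrACA subrr add0r HN.
Qed.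

(* The equation [(1 - u) F' = s F] determines the Taylor coefficients. *)
Lemma kernel_coef : forall u, normc u < 1 -> psum (fun n => (bw 0 / bw n)%:C) u (F u).
Proof.
have [|B hB] := @holomorphic_disc_psum _ F.
  by move=> u /kernel_cderiv; exact: cderiv_holo.
have rec : (fun n => n.+1%:R * B n.+1 - n%:R * B n) =1 (fun n => s%:C * B n).
  apply: (@psum_unique _ _ _ (fun u => s%:C * F u) 1 ltr01) => u u1; last first.
    by apply: eq_csum (csumZ s%:C (hB u u1)) => n; rewrite mulrA.
  have [d hd sd] := psum_cderiv u1 hB.
  rewrite (cderiv_unique hd (kernel_cderiv u1)) in sd.
  have n0 := disc_sub1_neq0 u1.
  have sud := csum_cons 0 (csumZ u sd).
  have := csumB sd sud; rewrite add0r.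
  rewrite (_ : _ - _ = s%:C * F u); last by field.
  by apply: eq_csum => -[|n]; rewrite mulrBl ?mul0r// exprS; ring.
have B0 : B 0 = 1.
  by rewrite (psum_at0 (hB 0 _)) /F ?Lam0 ?mulr0 ?cexp0// normc0.
suff BE n : B n = (bw 0 / bw n)%:C.
  by move=> u /hB; apply: eq_csum => n; rewrite BE.
elim: n => [|n IH]; first by rewrite B0 divff// gt_eqF// bweight_gt0.
have n1 : n.+1%:R != 0 :> R by rewrite pnatr_eq0.
have := rec n; move/eqP; rewrite subr_eq -mulrDl IH => /eqP e.
have n1C : n.+1%:R != 0 :> C by rewrite pnatr_eq0.
apply: (mulfI n1C); rewrite e.
have RCn (m : nat) : m%:R = (m%:R : R)%:C by rewrite rmorph_nat.
rewrite !RCn -rmorphD -!RCM; congr (_%:C).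
have bS := bweightS s_gt1 n.
have b1 : bw n != 0 by rewrite gt_eqF// bweight_gt0.
have b2 : bw n.+1 != 0 by rewrite gt_eqF// bweight_gt0.
apply: (mulIf b2); apply: (mulIf b1); rewrite [in RHS]mulrAC.
rewrite (_ : _ * _ * _ = bw 0 * (bw n.+1 * (n%:R + s))); last by field.
by rewrite bS; field.
Qed.

Definition kernel_fun b w := if normc w < 1 then F (w * conjc b) else 0.

Lemma normcM_lt1 w b : normc w < 1 -> normc b < 1 -> normc (w * conjc b) < 1.
Proof. by move=> w1 b1; rewrite normcM normcJ mulr_ilt1// normc_ge0. Qed.

Lemma kernel_fun_psum b : normc b < 1 -> forall w, normc w < 1 ->
  psum (fun n => (bw 0 / bw n)%:C * conjc b ^+ n) w (kernel_fun b w).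
Proof.
move=> b1 w w1; rewrite /kernel_fun w1.
by apply: eq_csum (kernel_coef (normcM_lt1 w1 b1)) => n; rewrite exprMn; ring.
Qed.

(** The sum of the squared norm is [bw 0] times the kernel series at [b * conjc b], a point of the
    disc. *)
Lemma bergman_kernel b : normc b < 1 -> bergman s (kernel_fun b).
Proof.
move=> b1; apply/(bergmanP s_gt1); split.
  by move=> w /unit_discE hw; rewrite /kernel_fun ifF//; apply/negP.
eexists; first exact: kernel_fun_psum.
have := kernel_coef (normcM_lt1 b1 b1); set l := F _ => hl.
have part n : \sum_(k < n) bw 0 / bw k * normc b ^+ 2 ^+ k <= normc l + 1.
  apply: (@csum_partial_le _ (fun k => bw 0 / bw k * normc b ^+ 2 ^+ k)) => [k|].
    apply: mulr_ge0; last by rewrite exprn_ge0// sqr_ge0.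
    by rewrite ltW// divr_gt0// bweight_gt0.
  by apply: eq_csum hl => k; rewrite mulcJ; symmetry; rewrite RCM; congr (_ * _); exact: rmorphXn.
exists (bw 0 * (normc l + 1)) => n; apply: le_trans (_ : bw 0 * \sum_(k < n) bw 0 / bw k * normc b ^+ 2 ^+ k <= _).
  rewrite mulr_sumr; apply: ler_sum => k _; rewrite normcM normcX normcJ normcR.
  rewrite ger0_norm; last by rewrite divr_ge0// ltW// bweight_gt0.
  rewrite le_eqVlt; apply/orP; left; apply/eqP.
  by rewrite -exprM mulnC exprM; field; rewrite gt_eqF// bweight_gt0.
by rewrite ler_pM2l// bweight_gt0.
Qed.

Lemma coef_kernel b : normc b < 1 ->
  coef (kernel_fun b) = fun n => (bw 0 / bw n)%:C * conjc b ^+ n.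
Proof.
by move=> b1; apply: (coef_unique s_gt1 (bergman_kernel b1)); exact: kernel_fun_psum.
Qed.

Lemma inner_kernel f b : bergman s f -> normc b < 1 -> ip f (kernel_fun b) = (bw 0)%:C * f b.
Proof.
move=> bf b1; apply: inner_unique => //; first exact: bergman_kernel.
rewrite coef_kernel//; apply: eq_csum (csumZ (bw 0)%:C (coefP s_gt1 bf b1)) => n.
have bn : bw n != 0 by rewrite gt_eqF// bweight_gt0.
rewrite conjcM conjcR conjcX conjcK RCM RCV.
by field; exact: RC_neq0.
Qed.

Lemma eval_le b : normc b < 1 -> exists2 M, 0 < M & forall f, bergman s f ->
  normc (f b) ^+ 2 <= M * energy f.
Proof.
move=> b1; have b0 := bweight_gt0 s_gt1 0; have bk := bergman_kernel b1.
have e0 := energy_ge0 s_gt1 bk.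
exists ((energy (kernel_fun b) + 1) / bw 0 ^+ 2).
  by rewrite divr_gt0 ?exprn_gt0// ltr_wpDl.
move=> f bf; rewrite mulrAC ler_pdivlMr ?exprn_gt0//.
have := cauchy_schwarz s_gt1 bf bk; rewrite inner_kernel// normcM normcR gtr0_norm// exprMn.
have y := energy_ge0 s_gt1 bf; rewrite [normc (f b) ^+ 2 * _]mulrC => le.
by apply: le_trans le _; rewrite mulrC ler_wpM2r// lerDl.
Qed.

Lemma energy_lim_eval (G : nat -> C -> C) f b : (forall n, bergman s (G n)) -> bergman s f ->
  energy_lim s G f -> normc b < 1 -> forall e, 0 < e ->
  exists N, forall n, (N <= n)%N -> normc (G n b - f b) < e.
Proof.
move=> bG bf lim b1 e e0; have [M M0 HM] := eval_le b1.
have [|N HN] := lim (e ^+ 2 / M); first by rewrite divr_gt0// exprn_gt0.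
exists N => n /HN le; rewrite -(@ltr_pXn2r _ 2)// ?nnegrE ?normc_ge0//; last exact: ltW.
apply: le_lt_trans (HM _ (bergmanB s_gt1 (bG n) bf)) _.
by move: le; rewrite ltr_pdivlMr// mulrC.
Qed.

Lemma energy_lim_inner (G : nat -> C -> C) f g : (forall n, bergman s (G n)) -> bergman s f ->
  bergman s g -> energy_lim s G f -> forall e, 0 < e ->
  exists N, forall n, (N <= n)%N -> normc (ip (G n) g - ip f g) < e.
Proof.
move=> bG bf bg lim e e0; have g0 := energy_ge0 s_gt1 bg.
have m0 : 0 < energy g + 1 by rewrite ltr_wpDl.
have [|N HN] := lim (e ^+ 2 / (energy g + 1)); first by rewrite divr_gt0// exprn_gt0.
exists N => n /HN le; rewrite -(@ltr_pXn2r _ 2)// ?nnegrE ?normc_ge0//; last exact: ltW.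
rewrite -innerB//; have bd := bergmanB s_gt1 (bG n) bf.
apply: le_lt_trans (cauchy_schwarz s_gt1 bd bg) _.
move: le; rewrite ltr_pdivlMr//; apply: le_lt_trans; rewrite ler_wpM2l//.
  exact: energy_ge0.
by rewrite lerDl.
Qed.

(** The component of [f] orthogonal to [N] is orthogonal to all kernel functions, so by the
    reproducing property it vanishes at every point of the disc. *)
Lemma kernel_dense (N : set (C -> C)) :
  N `<=` bergman s -> N (fun=> 0) ->
  (forall g h, N g -> N h -> N (fun w => g w + h w)) ->
  (forall a g, N g -> N (fun w => a * g w)) ->
  (forall G g, (forall n, N (G n)) -> bergman s g -> energy_lim s G g -> N g) ->
  (forall b, normc b < 1 -> N (kernel_fun b)) ->
  bergman s `<=` N.
Proof.
move=> Nb N0 ND NZ Nc Nk f bf.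
have [m Nm orth] := orthogonal_projection s_gt1 Nb N0 ND NZ Nc bf.
have bm := Nb _ Nm; suff -> : f = m by [].
apply/funext => b; have [b1|b1] := ltP (normc b) 1; last first.
  have hb : ~ unit_disc b by move/unit_discE; rewrite ltNge b1.
  have [f0 _] := (bergmanP s_gt1 f).1 bf; have [m0 _] := (bergmanP s_gt1 m).1 bm.
  by rewrite f0// m0.
have := orth _ (Nk b b1); rewrite inner_kernel//; last exact: bergmanB.
by move/eqP; rewrite mulf_eq0 (negbTE (RC_neq0 _)) ?subr_eq0 => [/eqP|]; rewrite ?gt_eqF ?bweight_gt0.
Qed.

Definition kernel_pair (phi psi J : C -> C) := [/\
  forall w, normc w < 1 -> normc (phi w) < 1 /\ psi (phi w) = w,
  forall w, normc w < 1 -> normc (psi w) < 1 /\ phi (psi w) = w &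
  forall a b, normc a < 1 -> normc b < 1 ->
    F (phi a * conjc (phi b)) * J a * conjc (J b) = F (a * conjc b)].

Definition transport (phi J : C -> C) f w := if normc w < 1 then J w * f (phi w) else 0.

Lemma kernel_pair_neq0 phi psi J w : kernel_pair phi psi J -> normc w < 1 -> J w != 0.
Proof.
move=> [_ _ h] w1; apply/eqP => J0; have := h w w w1 w1; rewrite J0 mulr0 mul0r.
by move/esym/eqP; rewrite (negbTE (cexp_neq0 _)).
Qed.

Lemma kernel_pair_inv phi psi J : kernel_pair phi psi J ->
  kernel_pair psi phi (fun w => (J (psi w))^-1).
Proof.
move=> kp; have [h1 h2 h3] := kp; split=> // a b a1 b1.
have [pa ea] := h2 a a1; have [pb eb] := h2 b b1.
have := h3 _ _ pa pb; rewrite ea eb => <-.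
have na := kernel_pair_neq0 kp pa; have nb := kernel_pair_neq0 kp pb.
rewrite conjcV; have nb' := conjc_neq0 nb.
by field; apply/andP.
Qed.

Lemma transportK phi psi J f : kernel_pair phi psi J -> bergman s f ->
  transport phi J (transport psi (fun w => (J (psi w))^-1) f) = f.
Proof.
move=> kp bf; have [h1 h2 _] := kp; apply/funext => w; rewrite /transport.
case: ifPn => [w1|nw]; last first.
  have [f0 _] := (bergmanP s_gt1 f).1 bf; rewrite f0//.
  by move/unit_discE; exact/negP.
have [-> ->] := h1 w w1; rewrite mulrA divff ?mul1r//.
exact: kernel_pair_neq0 kp w1.
Qed.

Lemma transportD phi J f g :
  transport phi J (fun w => f w + g w) = fun w => transport phi J f w + transport phi J g w.
Proof. by apply/funext => w; rewrite /transport; case: ifP => _; rewrite ?mulrDr ?addr0. Qed.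

Lemma transportZ phi J a f :
  transport phi J (fun w => a * f w) = fun w => a * transport phi J f w.
Proof. by apply/funext => w; rewrite /transport; case: ifP => _; rewrite ?mulr0// mulrCA. Qed.

Lemma transportB phi J f g :
  transport phi J (fun w => f w - g w) = fun w => transport phi J f w - transport phi J g w.
Proof. by apply/funext => w; rewrite /transport; case: ifP => _; rewrite ?mulrBr ?subr0. Qed.

(* Quantifying over all transportable [g] makes this condition linear and closed
   in [f], while it holds for kernel functions by the reproducing property. *)
Let isometric phi J f := [/\ bergman s f, bergman s (transport phi J f) &
  forall g, bergman s g -> bergman s (transport phi J g) ->
    ip (transport phi J f) (transport phi J g) = ip f g].

Lemma transport_kernel phi psi J b : kernel_pair phi psi J -> normc b < 1 ->
  transport phi J (kernel_fun b) =
  fun w => (conjc (J (psi b)))^-1 * kernel_fun (psi b) w.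
Proof.
move=> kp b1; have [h1 h2 h3] := kp; have [pb eb] := h2 b b1.
have nb := conjc_neq0 (kernel_pair_neq0 kp pb).
apply/funext => w; rewrite /transport /kernel_fun; case: ifPn => w1; last by rewrite mulr0.
rewrite (h1 w w1).1 -(h3 w (psi b) w1 pb) eb.
by field.
Qed.

(** The delicate case is closedness, where the transported limit must be shown to lie in the space.
    The images of the sequence are Cauchy because the operator is isometric on its members; as point
    evaluations are continuous, their limit is the transported limit. *)
Lemma isometric_all phi psi J : kernel_pair phi psi J -> bergman s `<=` isometric phi J.
Proof.
move=> kp; have [h1 h2 h3] := kp; apply: kernel_dense.
- by move=> f [].
- split; [exact: bergman0| |].
    rewrite (_ : transport _ _ _ = fun=> 0); first exact: bergman0.
    by apply/funext => w; rewrite /transport mulr0; case: ifP.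
  move=> g bg bTg.
  rewrite (_ : (fun=> 0) = (fun w => 0 * g w)); last by apply/funext => w; rewrite mul0r.
  by rewrite transportZ !innerZ// !mul0r.
- move=> f g [bf bTf hf] [bg bTg hg]; rewrite /isometric transportD; split; try exact: bergmanD.
  by move=> k bk bTk; rewrite !innerD// hf// hg.
- move=> a f [bf bTf hf]; rewrite /isometric transportZ; split; try exact: bergmanZ.
  by move=> k bk bTk; rewrite !innerZ// hf.
- move=> G f HG bf lim.
  have bG n : bergman s (G n) by have [] := HG n.
  have bTG n : bergman s (transport phi J (G n)) by have [] := HG n.
  have iso m n : energy (fun w => transport phi J (G m) w - transport phi J (G n) w) =
      energy (fun w => G m w - G n w).
    have bd := bergmanB s_gt1 (bG m) (bG n); have bTd := bergmanB s_gt1 (bTG m) (bTG n).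
    have : (energy (fun w => transport phi J (G m) w - transport phi J (G n) w))%:C =
      (energy (fun w => G m w - G n w))%:C; last by case.
    rewrite -!inner_energy// !innerB//.
    have [_ _ hm] := HG m; have [_ _ hn] := HG n.
    by rewrite -transportB hm ?hn// transportB.
  have [|h bh limh] := bergman_complete s_gt1 bTG.
    move=> e e0; have [|N HN] := lim (e / 4); first by lra.
    exists N => m n Nm Nn; rewrite iso.
    have := energy_parallelogram s_gt1 (bergmanB s_gt1 (bG m) bf) (bergmanB s_gt1 (bG n) bf).
    rewrite (_ : (fun w => _ - _ - (_ - _)) = fun w => G m w - G n w); last by apply/funext => w; ring.
    have := energy_ge0 s_gt1 (bergmanD s_gt1 (bergmanB s_gt1 (bG m) bf) (bergmanB s_gt1 (bG n) bf)).
    have := HN m Nm; have := HN n Nn.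
    by move: (energy _) (energy _) (energy _) (energy _) => x y z t; lra.
  have hE : transport phi J f = h.
    apply/funext => w; have [w1|nw] := ltP (normc w) 1; last first.
      have [h0 _] := (bergmanP s_gt1 h).1 bh; rewrite h0; last by move/unit_discE; rewrite ltNge nw.
      by rewrite /transport ltNge nw.
    apply/subr0_eq/normc_small_eq0 => e e0; rewrite /transport w1.
    have [pw _] := h1 w w1; have m0 : 0 < normc (J w) + 1 by rewrite ltr_wpDl// normc_ge0.
    have [|N1 H1] := energy_lim_eval bG bf lim pw (e := e / 2 / (normc (J w) + 1)).
      by rewrite !divr_gt0.
    have [|N2 H2] := energy_lim_eval bTG bh limh w1 (e := e / 2); first by lra.
    have := H1 _ (leq_maxl N1 N2); have := H2 _ (leq_maxr N1 N2).
    move: (maxn N1 N2) => n; rewrite {1}/transport w1 => l2; rewrite -(ltr_pM2r m0) divfK ?gt_eqF// => l1.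
    rewrite (_ : _ - _ = (J w * G n (phi w) - h w) - J w * (G n (phi w) - f (phi w))); last by ring.
    apply: le_trans (normcB _ _) _; rewrite normcM.
    have := normc_ge0 (G n (phi w) - f (phi w)); move: l1 l2.
    move: (normc (G n _ - _)) (normc (J w * _ - _)) (normc (J w)) => x y z.
    by rewrite mulrDr mulr1 [z * x]mulrC; move: (x * z) => t; lra.
  have bTf : bergman s (transport phi J f) by rewrite hE.
  split=> // g bg bTg; apply/subr0_eq/normc_small_eq0 => e e0.
  have e2 : 0 < e / 2 by lra.
  rewrite -hE in limh.
  have [N1 H1] := energy_lim_inner bG bf bg lim e2.
  have [N2 H2] := energy_lim_inner bTG bTf bTg limh e2.
  have := H1 _ (leq_maxl N1 N2); have := H2 _ (leq_maxr N1 N2).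
  move: (maxn N1 N2) => n; have [_ _ ->//] := HG n => l2 l1.
  rewrite (_ : _ - _ = (ip (G n) g - ip f g) - (ip (G n) g - ip (transport phi J f) (transport phi J g))); last by ring.
  by apply: le_trans (normcB _ _) _; move: l1 l2; move: (normc _) (normc _) => x y; lra.
- move=> b b1; have [pb eb] := h2 b b1.
  have bk := bergman_kernel pb; have bT : bergman s (transport phi J (kernel_fun b)).
    by rewrite (transport_kernel kp)//; exact: bergmanZ.
  split=> //; first exact: bergman_kernel.
  (* The image of the kernel function at [b] is a multiple of the one at [psi b]. Pairing with it
     evaluates [transport phi J g] at [psi b], where the factor [J (psi b)] cancels the multiple and
     leaves [g b]. *)
  move=> g bg bTg; rewrite (innerC s_gt1 bTg bT) (innerC s_gt1 bg (bergman_kernel b1)).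
  congr conjc; rewrite inner_kernel// (transport_kernel kp)//.
  rewrite (innerC s_gt1 (bergmanZ s_gt1 _ bk) bTg) innerZ// conjcM -innerC//.
  rewrite inner_kernel// /transport pb eb conjcV conjcK.
  rewrite mulrCA [_^-1 * _]mulrA mulVf ?mul1r//; exact: kernel_pair_neq0 kp pb.
Qed.

Lemma transport_bergman phi psi J f : kernel_pair phi psi J -> bergman s f ->
  bergman s (transport phi J f).
Proof. by move=> kp /(isometric_all kp)[]. Qed.

Lemma transport_inner phi psi J f g : kernel_pair phi psi J -> bergman s f -> bergman s g ->
  ip (transport phi J f) (transport phi J g) = ip f g.
Proof.
by move=> kp /(isometric_all kp)[_ _ h] bg; apply: h => //; exact: transport_bergman kp bg.
Qed.

Lemma transport_adjoint phi psi J f g : kernel_pair phi psi J -> bergman s f -> bergman s g ->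
  ip (transport phi J f) g = ip f (transport psi (fun w => (J (psi w))^-1) g).
Proof.
move=> kp bf bg; rewrite -{1}(transportK kp bg) (transport_inner kp)//.
exact: transport_bergman (kernel_pair_inv kp) bg.
Qed.

End ReproducingKernel.

(** * Moebius transformations *)

Section Mobius.
Variable R : realType.
Local Notation C := R[i].
Local Notation H := (@upper_half_plane R).
Implicit Types (z w a b : C) (m : 'M[R]_2) (g h : PSL2 R).

Definition mob m z := ((m 0 0)%:C * z + (m 0 1)%:C) / cocycle m z.

Lemma det2E m : \det m = m 0 0 * m 1 1 - m 0 1 * m 1 0.
Proof.
rewrite (expand_det_row _ 0) !big_ord_recl big_ord0 addr0 /cofactor !det_mx11 !mxE /=.
rewrite expr0 expr1 mul1r.
rewrite (_ : lift 0 0 = 1); last exact: val_inj.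
rewrite (_ : lift 1 0 = 0); last exact: val_inj.
by ring.
Qed.

Lemma mulmx2E (m m' : 'M[R]_2) i j : (m * m') i j = m i 0 * m' 0 j + m i 1 * m' 1 j.
Proof.
rewrite !mxE !big_ord_recl big_ord0 addr0.
by rewrite (_ : lift 0 0 = 1); last exact: val_inj.
Qed.

Lemma cocycle_neq0 m z : \det m = 1 -> H z -> cocycle m z != 0.
Proof.
rewrite det2E /upper_half_plane /= => d1 z0; apply/eqP => e.
have : complex.Im (cocycle m z) = 0 by rewrite e.
have : complex.Re (cocycle m z) = 0 by rewrite e.
rewrite /cocycle; case: z z0 {e} => x y /= y0.
rewrite !mul0r !addr0 !subr0 => e1 /eqP; rewrite mulf_eq0 (gt_eqF y0) orbF => /eqP c0.
move: e1; rewrite c0 mul0r add0r => e1; move: d1; rewrite e1 c0 !mulr0 subr0 => /eqP.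
by rewrite eq_sym oner_eq0.
Qed.

Lemma cocycleN m z : cocycle (- m) z = - cocycle m z.
Proof. by rewrite /cocycle !mxE !rmorphN mulNr opprD. Qed.

Lemma mobN m z : mob (- m) z = mob m z.
Proof. by rewrite /mob cocycleN !mxE !rmorphN mulNr -opprD invrN mulrNN. Qed.

Lemma cocycleM m m' z : cocycle m' z != 0 ->
  cocycle (m * m') z = cocycle m (mob m' z) * cocycle m' z.
Proof.
rewrite /mob /cocycle !mulmx2E !RCD !RCM => n0.
by field.
Qed.

Lemma mobM m m' z : cocycle m' z != 0 -> cocycle (m * m') z != 0 ->
  mob (m * m') z = mob m (mob m' z).
Proof.
move=> n0; rewrite [mob _ z]/mob [mob m _]/mob cocycleM// mulf_eq0 negb_or => /andP[n1 _].
rewrite (_ : _ + _ = ((m 0 0)%:C * mob m' z + (m 0 1)%:C) * cocycle m' z).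
  by rewrite -mulf_div divff// mulr1.
move: n0; rewrite /mob /cocycle !mulmx2E !RCD !RCM => n0.
by field.
Qed.

Lemma mob1 z : mob 1 z = z.
Proof. by rewrite /mob /cocycle !mxE /= rmorph1 rmorph0 mul0r add0r mul1r addr0 divr1. Qed.

Lemma mob_sub m z w : \det m = 1 -> cocycle m z != 0 -> cocycle m w != 0 ->
  mob m z - mob m w = (z - w) / (cocycle m z * cocycle m w).
Proof.
move=> d1 z0 w0; rewrite /mob.
have d1C : (m 0 0)%:C * (m 1 1)%:C - (m 0 1)%:C * (m 1 0)%:C = 1 :> C.
  by rewrite -!RCM -RCB -det2E d1.
apply: (mulIf z0); apply: (mulIf w0); rewrite -[RHS]mulrA divfK ?mulf_neq0//.
rewrite -[RHS]mulr1 -d1C; transitivity (((m 0 0)%:C * z + (m 0 1)%:C) * cocycle m w - ((m 0 0)%:C * w + (m 0 1)%:C) * cocycle m z).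
  by field; apply/andP.
by rewrite /cocycle; ring.
Qed.

Lemma conjc_cocycle m z : conjc (cocycle m z) = cocycle m (conjc z).
Proof. by rewrite /cocycle conjcD conjcM !conjcR. Qed.

Lemma conjc_mob m z : conjc (mob m z) = mob m (conjc z).
Proof. by rewrite /mob conjcM conjcV conjc_cocycle conjcD conjcM !conjcR. Qed.

(** With [w = z] this is the transformation rule of the imaginary part; for general points it is the
    half-plane form of the kernel identity. *)
Lemma mob_subJ m z w : \det m = 1 -> H z -> H w ->
  mob m z - conjc (mob m w) = (z - conjc w) / (cocycle m z * conjc (cocycle m w)).
Proof.
move=> d1 hz hw; have := conjc_neq0 (cocycle_neq0 d1 hw); rewrite conjc_cocycle => n.
by rewrite conjc_mob mob_sub// cocycle_neq0.
Qed.

Lemma subJ_Im z : z - conjc z = (2 * complex.Im z)%:C * 'i.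
Proof.
by case: z => x y; apply/eqP; rewrite eq_complex; apply/andP; split; apply/eqP => /=; ring.
Qed.

Lemma mob_upper m z : \det m = 1 -> H z -> H (mob m z).
Proof.
move=> d1 hz; have := mob_subJ d1 hz hz; rewrite mulcJ !subJ_Im -RCV.
rewrite mulrAC -RCM => /(congr1 (@complex.Im R)) /=; rewrite !mul0r !mulr1 !addr0 => e.
rewrite /upper_half_plane /= -(pmulr_rgt0 _ (ltr0n _ 2)) e divr_gt0//.
  by rewrite mulr_gt0.
by rewrite exprn_gt0// normc_gt0 cocycle_neq0.
Qed.

Lemma mobius_mob g z : mobius g z = mob (SL2val (repr g)) z.
Proof. by []. Qed.

Lemma mobius_class (x : SL2 R) z : mobius (PSL2_class x) z = mob (SL2val x) z.
Proof. by rewrite mobius_mob; case: (repr_PSL2_class x) => ->; rewrite ?mobN. Qed.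

Lemma mobius_upper g z : H z -> H (mobius g z).
Proof. by move=> hz; rewrite mobius_mob; apply: mob_upper => //; exact: det_SL2. Qed.

Lemma mobiusM g h z : H z -> mobius (g * h)%g z = mobius g (mobius h z).
Proof.
move=> hz; rewrite -{1}(PSL2_classK g) -{1}(PSL2_classK h).
rewrite [(_ * _)%g](PSL2_classM (repr g) (repr h)) mobius_class.
have hh : cocycle (SL2val (repr h)) z != 0 by rewrite cocycle_neq0// det_SL2.
by apply: mobM => //; rewrite cocycleM// mulf_neq0// cocycle_neq0 ?det_SL2//; exact: mobius_upper.
Qed.

Lemma mobius1 z : mobius 1%g z = z.
Proof. by rewrite [1%g]/(PSL2_class 1%g) mobius_class mob1. Qed.

Lemma addi_neq0 z : H z -> z + 'i != 0.
Proof.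
move=> hz; apply/eqP => /(congr1 (@complex.Im R)); rewrite ImD /= => e.
by move: hz; rewrite /upper_half_plane /= => hz; move: e; lra.
Qed.

Lemma i_neq0 : 'i != 0 :> C.
Proof. by rewrite eq_complex /= oner_eq0 andbF. Qed.

Lemma conjci : conjc 'i = - 'i :> C.
Proof. by rewrite /conjc /= -[LHS]/(0 +i* (-1)); simpc. Qed.

Lemma cayley_invE w : 1 - w != 0 -> cayley_inv w + 'i = 2 * 'i / (1 - w).
Proof. by move=> w1; rewrite /cayley_inv; field. Qed.

Lemma cayley_subJ z w : z + 'i != 0 -> w + 'i != 0 ->
  1 - cayley z * conjc (cayley w) = - (2 * 'i) * (z - conjc w) / ((z + 'i) * conjc (w + 'i)).
Proof.
move=> z0 w0; rewrite /cayley conjcM conjcV !conjcD conjcN conjci.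
have w0' : conjc w - 'i != 0 by rewrite -conjci -conjcD conjc_neq0.
by field; apply/andP; split.
Qed.

Lemma cayley_sub z w : z + 'i != 0 -> w + 'i != 0 ->
  cayley z - cayley w = 2 * 'i * (z - w) / ((z + 'i) * (w + 'i)).
Proof. by move=> z0 w0; rewrite /cayley; field; apply/andP; split. Qed.

Lemma two_neq0 : 2 != 0 :> C.
Proof. by rewrite pnatr_eq0. Qed.

Lemma cayley_norm z : z + 'i != 0 ->
  1 - normc (cayley z) ^+ 2 = 4 * complex.Im z / normc (z + 'i) ^+ 2.
Proof.
move=> z0; have := cayley_subJ z0 z0; rewrite !mulcJ subJ_Im.
rewrite [_ * (_ * 'i)](_ : _ = (4 * complex.Im z)%:C); last first.
  case: z {z0} => x y; apply/eqP; rewrite eq_complex.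
  by apply/andP; split; apply/eqP => /=; ring.
by rewrite -RCV -RCM -[1]/(1%:C) -RCB => -[].
Qed.

Lemma cayley_disc z : H z -> normc (cayley z) < 1.
Proof.
move=> hz; have z0 := addi_neq0 hz; have := cayley_norm z0.
have : 0 < 4 * complex.Im z / normc (z + 'i) ^+ 2.
  by rewrite divr_gt0 ?exprn_gt0 ?normc_gt0// mulr_gt0.
by move=> p e; have := normc_ge0 (cayley z); move: (normc _) e p => x; move: (_ / _) => y; nra.
Qed.

Lemma cayley_invK w : 1 - w != 0 -> cayley (cayley_inv w) = w.
Proof.
move=> w1; rewrite /cayley cayley_invE// /cayley_inv.
by field; rewrite w1 i_neq0.
Qed.

Lemma cayley_inv_upper w : normc w < 1 -> H (cayley_inv w).
Proof.
move=> w1; have n0 := disc_sub1_neq0 w1.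
have z0 : cayley_inv w + 'i != 0.
  by rewrite cayley_invE// !mulf_neq0 ?invr_neq0// ?two_neq0// i_neq0.
have := cayley_norm z0; rewrite cayley_invK// => e.
have : 0 < 4 * complex.Im (cayley_inv w) / normc (cayley_inv w + 'i) ^+ 2.
  by rewrite -e; have := normc_ge0 w; move: (normc w) w1 => x; nra.
rewrite pmulr_lgt0; last by rewrite invr_gt0 exprn_gt0// normc_gt0.
by rewrite pmulr_rgt0.
Qed.

Lemma cayleyK z : H z -> cayley_inv (cayley z) = z.
Proof.
move=> hz; have z0 := addi_neq0 hz.
have e : 1 - cayley z = 2 * 'i / (z + 'i) by rewrite /cayley; field.
have n0 : 1 - cayley z != 0.
  by rewrite e !mulf_neq0 ?invr_neq0// ?two_neq0// i_neq0.
rewrite /cayley_inv e /cayley; field.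
by rewrite z0 i_neq0.
Qed.

Lemma cayley_inv0 : cayley_inv 0 = 'i :> C.
Proof. by rewrite /cayley_inv addr0 subr0 divr1 mulr1. Qed.

Lemma disc_mobius_disc g w : normc w < 1 -> normc (disc_mobius g w) < 1.
Proof. by move=> w1; apply: cayley_disc; apply: mobius_upper; exact: cayley_inv_upper. Qed.

Lemma disc_mobiusM g h w : normc w < 1 ->
  disc_mobius (g * h)%g w = disc_mobius g (disc_mobius h w).
Proof.
move=> w1; have hz := cayley_inv_upper w1.
by rewrite /disc_mobius mobiusM// cayleyK//; exact: mobius_upper.
Qed.

Lemma disc_mobius1 w : normc w < 1 -> disc_mobius 1%g w = w.
Proof. by move=> w1; rewrite /disc_mobius mobius1 cayley_invK// disc_sub1_neq0. Qed.

Lemma disc_mobiusK g w : normc w < 1 -> disc_mobius g^-1%g (disc_mobius g w) = w.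
Proof. by move=> w1; rewrite -disc_mobiusM// mulVg disc_mobius1. Qed.

Lemma disc_mobiusVK g w : normc w < 1 -> disc_mobius g (disc_mobius g^-1%g w) = w.
Proof. by move=> w1; rewrite -disc_mobiusM// mulgV disc_mobius1. Qed.

Lemma mobius_transitive z : H z -> exists g, mobius g 'i%R = z.
Proof.
case: z => x y; rewrite /upper_half_plane /= => y0; pose r := Num.sqrt y.
have r0 : r != 0 by rewrite gt_eqF// sqrtr_gt0.
(* The affine map sending a point u to y u + x, normalized to determinant 1. *)
pose m : 'M[R]_2 := \matrix_(i, j) if i == 0 then (if j == 0 then r else x / r)
   else (if j == 0 then 0 else r^-1).
have d1 : \det m == 1 by rewrite det2E !mxE /= mulr0 subr0 divff.
exists (PSL2_class (MkSL2 d1)); rewrite mobius_class /mob /cocycle !mxE /=.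
have r2 : r * r = y by rewrite -expr2 sqr_sqrtr// ltW.
have r0C : r%:C != 0 := RC_neq0 r0.
rewrite mul0r add0r RCM RCV; rewrite (_ : (_ + _) / _ = (r * r)%:C * 'i + x%:C).
  by rewrite r2; simpc.
by rewrite RCM; field.
Qed.

End Mobius.

(** * The representation in the disc model *)

Section Paths.
Variable R : realType.
Local Notation C := R[i].
Implicit Types (F f g : C -> C) (E : R -> C) (t : R) (z : C).

Definition ccts F z := forall e, 0 < e -> exists2 d : R, 0 < d &
  forall w, normc (w - z) < d -> normc (F w - F z) < e.

Definition pcont E t := forall e, 0 < e -> exists2 d : R, 0 < d &
  forall x, `|x - t| < d -> normc (E x - E t) < e.

Lemma cctsP F z : {for z, continuous (F : C^o -> C^o)} <-> ccts F z.
Proof. exact: continuous_complexP. Qed.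

Lemma pcont_comp F E t : ccts F (E t) -> pcont E t -> pcont (fun x => F (E x)) t.
Proof.
move=> cF cE e /cF[d d0 hd]; have [d' d'0 hd'] := cE d d0.
by exists d' => // x /hd'; exact: hd.
Qed.

Lemma pcontD E E' t : pcont E t -> pcont E' t -> pcont (fun x => E x + E' x) t.
Proof.
move=> cE cE' e e0; have e2 : 0 < e / 2 by lra.
have [d d0 hd] := cE _ e2; have [d' d'0 hd'] := cE' _ e2.
exists (Num.min d d') => [|x]; first by rewrite lt_min d0.
rewrite lt_min => /andP[/hd h1 /hd' h2].
rewrite (_ : _ - _ = (E x - E t) + (E' x - E' t)); last by ring.
by apply: le_lt_trans (le_normcD _ _) _; lra.
Qed.

Lemma pcontN E t : pcont E t -> pcont (fun x => - E x) t.
Proof.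
move=> cE e /cE[d d0 hd]; exists d => // x /hd.
by rewrite -opprB normcN opprK addrC.
Qed.

Lemma pcontM E E' t : pcont E t -> pcont E' t -> pcont (fun x => E x * E' x) t.
Proof.
move=> cE cE' e e0; pose m := 1 + normc (E t) + normc (E' t).
have m0 : 0 < m by rewrite /m -addrA ltr_pwDl// addr_ge0// normc_ge0.
have k0 : 0 < Num.min 1 (e / m) by rewrite lt_min ltr01 divr_gt0.
have [d d0 hd] := cE _ k0; have [d' d'0 hd'] := cE' _ k0.
exists (Num.min d d') => [|x]; first by rewrite lt_min d0.
rewrite lt_min => /andP[/hd h1 /hd' h2].
rewrite (_ : _ - _ = (E x - E t) * (E' x - E' t) + (E t * (E' x - E' t) + (E x - E t) * E' t)).
  apply: le_lt_trans (le_normcD _ _) _; rewrite normcM.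
  apply: le_lt_trans (lerD (lexx _) (le_normcD _ _)) _; rewrite !normcM.
  move: h1 h2; rewrite !lt_min => /andP[u1 u2] /andP[v1]; rewrite ltr_pdivlMr// => v2.
  have := normc_ge0 (E x - E t); have := normc_ge0 (E' x - E' t).
  have := normc_ge0 (E t); have := normc_ge0 (E' t); move: u1 u2 v1 v2; rewrite ltr_pdivlMr//.
  rewrite /m; move: (normc (E x - E t)) (normc (E' x - E' t)) (normc (E t)) (normc (E' t)) => u v p q.
  move=> u1 uE v1 vE q0 p0 v0 u0; have [uv|vu] := leP u v.
    have := ler_wpM2r v0 (ltW u1); have := ler_wpM2r q0 uv; lra.
  have := ler_wpM2l u0 (ltW v1); have := ler_wpM2l p0 (ltW vu); lra.
by ring.
Qed.

Lemma pcont_scale z t : pcont (fun x => x%:C * z) t.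
Proof.
move=> e e0; have m0 : 0 < normc z + 1 by rewrite ltr_wpDl// normc_ge0.
exists (e / (normc z + 1)) => [|x]; first by rewrite divr_gt0.
rewrite ltr_pdivlMr// -mulrBl -RCB normcM normcR; apply: le_lt_trans.
by rewrite ler_wpM2l// lerDl.
Qed.

Lemma ccts_conj z : ccts (@conjc R) z.
Proof.
by move=> e e0; exists e => // w; rewrite -conjcB normcJ.
Qed.

Lemma ccts_comp f g z : ccts f z -> ccts g (f z) -> ccts (fun w => g (f w)) z.
Proof.
move=> cf cg e /cg[d d0 hd]; have [d' d'0 hd'] := cf d d0.
by exists d' => // w /hd'; exact: hd.
Qed.

Lemma ccts_cst (c : C) z : ccts (fun=> c) z.
Proof. by move=> e e0; exists 1 => // w _; rewrite subrr normc0. Qed.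

Lemma cctsB f g z : ccts f z -> ccts g z -> ccts (fun w => f w - g w) z.
Proof.
move=> cf cg e e0; have e2 : 0 < e / 2 by lra.
have [d d0 hd] := cf _ e2; have [d' d'0 hd'] := cg _ e2.
exists (Num.min d d') => [|w]; first by rewrite lt_min d0.
rewrite lt_min => /andP[/hd h1 /hd' h2].
rewrite (_ : _ - _ = (f w - f z) - (g w - g z)); last by ring.
by apply: le_lt_trans (normcB _ _) _; lra.
Qed.

Lemma ccts_ratio (p q r u : C) z : r * z + u != 0 ->
  ccts (fun w => (p * w + q) / (r * w + u)) z.
Proof.
have aff (x y : C) : cderiv (fun w => x * w + y) z (x * 1 + z * 0 + 0).
  exact: cderivD (cderivM (cderiv_cst z x) (cderiv_id z)) (cderiv_cst z y).
move=> n0; have [d hd] := @cderivV _ (fun w => r * w + u) z _ n0 (aff r u).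
by apply/cctsP; exact: cderiv_cont (cderivM (aff p q) hd).
Qed.

Lemma pcont_eq0 E : (forall t, 0 <= t <= 1 -> pcont E t) ->
  (forall t, 0 <= t <= 1 -> cexp (E t) = 1) -> E 0 = 0 -> E 1 = 0.
Proof.
move=> cE; apply: cexp_eq1_const; apply: continuous_in_subspaceT => t.
rewrite inE/= in_itv/= => /cE h; apply/real_continuousP => e /h[d d0 hd].
exists d => // x /hd; apply: le_lt_trans; rewrite -ImB; exact: normIm_le.
Qed.

End Paths.

(** * Branches of logarithms and the kernel identity for Moebius maps *)

Section DiscRep.
Variable R : realType.
Local Notation C := R[i].
Local Notation H := (@upper_half_plane R).
Implicit Types (z w a b : C) (g h : PSL2 R) (t : R).

Variables (l0 : C -> C) (l : PSL2 R -> C -> C).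
Hypothesis l0_log : is_cayley_log l0.
Hypothesis l_log : is_cocycle_log l.

(* A branch of [log (1 / (1 - u))]. *)
Definition disc_log u := l0 'i%R - l0 (cayley_inv u).

Lemma disc_log0 : disc_log 0 = 0.
Proof. by rewrite /disc_log cayley_inv0 subrr. Qed.

Lemma ccts_cayley_inv u : normc u < 1 -> ccts (@cayley_inv R) u.
Proof.
move=> u1; have := @ccts_ratio R 'i%R 'i%R (-1) 1 u.
rewrite mulN1r addrC => /(_ (disc_sub1_neq0 u1)).
rewrite (_ : (fun w => _) = @cayley_inv R)//; apply/funext => w.
by rewrite /cayley_inv mulN1r [- w + 1]addrC mulrDr mulr1 ['i + _]addrC.
Qed.

Lemma upper_i : H 'i%R.
Proof. by rewrite /upper_half_plane /= ltr01. Qed.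

Lemma l0_cont z : H z -> ccts l0 z. Proof. by move=> hz; apply/cctsP; exact: l0_log.1. Qed.

Lemma disc_log_cont u : normc u < 1 -> ccts disc_log u.
Proof.
move=> u1; apply: cctsB; first exact: ccts_cst.
by apply: ccts_comp; [exact: ccts_cayley_inv|apply: l0_cont; exact: cayley_inv_upper].
Qed.

Lemma cexp_disc_log u : normc u < 1 -> cexp (disc_log u) = (1 - u)^-1.
Proof.
move=> u1; have n0 := disc_sub1_neq0 u1.
rewrite cexpB !l0_log.2//; [|exact: cayley_inv_upper|exact: upper_i].
rewrite cayley_invE//; have i0 := i_neq0 R.
rewrite (_ : 'i%R + 'i%R = 2 * 'i%R :> C); last by ring.
by field; rewrite n0 i0.
Qed.

(** Along the segment from 0 to [x], [disc_log] and the real function -ln(1 - t) have the same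
    exponential and both start at 0, so they agree. This fixes the branch at the starting point of
    the deformation in [rep_log_kernel]. *)
Lemma disc_log_real x : 0 <= x < 1 -> exists y : R, disc_log x%:C = y%:C.
Proof.
move=> /andP[x0 x1]; exists (- ln (1 - x)).
pose E t := disc_log (t%:C * x%:C) + (ln (1 - t * x))%:C.
have tx t : 0 <= t <= 1 -> 0 <= t * x < 1.
  by move=> /andP[t0 t1]; rewrite mulr_ge0//= (le_lt_trans _ x1)// ler_piMl.
have D t : 0 <= t <= 1 -> normc (t%:C * x%:C) < 1.
  by move=> /tx/andP[h0 h1]; rewrite -RCM normcR ger0_norm.
have : E 1 = 0.
  apply: pcont_eq0 => [t t01|t t01|].
  - apply: pcontD; last first.
      have c : {for t, continuous (fun t : R => ln (1 - t * x))}.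
        apply: (@continuous_comp _ _ _ (fun t => 1 - t * x) (@ln R)).
          apply: (@cvgB _ R^o); first exact: cvg_cst.
          by apply: cvgM; [exact: cvg_id|exact: cvg_cst].
        by apply: continuous_ln; have /andP[_] := tx t t01; rewrite subr_gt0.
      move=> e e0; have /real_continuousP/(_ e e0)[d d0 hd] := c.
      by exists d => // y /hd; rewrite -RCB normcR.
    apply: pcont_comp; last exact: pcont_scale.
    exact/disc_log_cont/D.
  - have p : 0 < 1 - t * x by have /andP[_] := tx t t01; rewrite subr_gt0.
    rewrite cexpD cexp_disc_log ?D// cexpR lnK// -RCM -[1 in LHS]/(1%:C) -RCB mulVf//.
    by apply: RC_neq0; rewrite gt_eqF.
  - by rewrite /E mul0r disc_log0 mul0r subr0 ln1 addr0.
by rewrite /E !mul1r => /eqP; rewrite addr_eq0 rmorphN => /eqP.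
Qed.

(* [cexp (rep_log h w)] is, up to sign, a square root of the derivative of
   [disc_mobius h] at [w]. *)
Definition rep_log h w :=
  l0 (mobius h (cayley_inv w)) - l h (cayley_inv w) - l0 (cayley_inv w).

(** The three powers from the change of model, the cocycle and the change back merge into one
    exponential of [s] times a single logarithm, to which [transport] applies. *)
Lemma bergman_repE s g f : bergman_rep s l0 l g f =
  transport (disc_mobius g^-1%g) (fun w => cexp (s%:C * rep_log g^-1%g w)) f.
Proof.
apply/funext => w; rewrite /bergman_rep /to_disc /transport.
have -> : (w \in @unit_disc R) = (normc w < 1).
  by apply/idP/idP => [/set_mem/unit_discE|/unit_discE/mem_set].
case: ifP => // _; rewrite /half_plane_rep /to_half_plane /cpow /rep_log !mulrBr !cexpB.
by rewrite -[cayley (mobius _ _)]/(disc_mobius _ _); move: (cexp _) (cexp _) (cexp _) (f _) => x y z t; ring.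
Qed.

Lemma cocycle_cont h z : H z -> ccts (mobius h) z.
Proof. by move=> hz; apply: ccts_ratio; apply: cocycle_neq0 => //; exact: det_SL2. Qed.

Lemma cayley_cont z : H z -> ccts (@cayley R) z.
Proof.
move=> hz; have := @ccts_ratio R 1 (- 'i%R) 1 'i%R z.
rewrite mul1r => /(_ (addi_neq0 hz)).
by rewrite (_ : (fun w => _) = @cayley R)//; apply/funext => w; rewrite /cayley !mul1r.
Qed.

Lemma disc_mobius_cont h w : normc w < 1 -> ccts (disc_mobius h) w.
Proof.
move=> w1; have hz := cayley_inv_upper w1.
apply: (@ccts_comp _ _ (@cayley R)); last by apply: cayley_cont; exact: mobius_upper.
by apply: ccts_comp; [exact: ccts_cayley_inv|exact: cocycle_cont].
Qed.

Lemma rep_log_cont h w : normc w < 1 -> ccts (rep_log h) w.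
Proof.
move=> w1; have hz := cayley_inv_upper w1; have ci := ccts_cayley_inv w1.
apply: cctsB; last by apply: ccts_comp => //; exact: l0_cont.
apply: cctsB; last first.
  by have [m _ [cl _]] := l_log h; apply: (@ccts_comp _ _ (l h)) => //; apply/cctsP; exact: cl.
apply: (@ccts_comp _ (fun w => mobius h (cayley_inv w))); last first.
  by apply: l0_cont; exact: mobius_upper.
by apply: ccts_comp => //; exact: cocycle_cont.
Qed.

(** The branch [l h] may belong to either of the two matrices of [h]. The sign [eps] records the
    choice and disappears from products of two values. *)
Lemma cexp_rep_log h : exists2 eps : R, eps * eps = 1 & forall w, normc w < 1 ->
  let z := cayley_inv w in
  cexp (rep_log h w) = eps%:C * (z + 'i) / ((mobius h z + 'i) * cocycle (SL2val (repr h)) z).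
Proof.
have [m mh [_ lm]] := l_log h.
have [eps e1 ce] : exists2 eps : R, eps * eps = 1 & forall z,
    cocycle m z = eps%:C * cocycle (SL2val (repr h)) z.
  rewrite -mh; case: (repr_PSL2_class m) => ->.
    by exists 1; rewrite ?mul1r// => z; rewrite rmorph1 mul1r.
  by exists (-1); rewrite ?mulrNN ?mul1r// => z; rewrite cocycleN rmorphN1 mulN1r opprK.
exists eps => // w w1 /=; have hz := cayley_inv_upper w1; have hz' := mobius_upper h hz.
have n0 := addi_neq0 hz; have n1 := addi_neq0 hz'.
have j0 : cocycle (SL2val (repr h)) (cayley_inv w) != 0 by rewrite cocycle_neq0// det_SL2.
have ee : eps%:C * eps%:C = 1 by rewrite -RCM e1.
have eps0 : eps%:C != 0 by apply/eqP => e0; move/eqP: ee; rewrite e0 mul0r eq_sym oner_eq0.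
rewrite !cexpB !l0_log.2// lm// ce.
rewrite -[LHS]mul1r -ee; field.
by rewrite n0 n1 j0 eps0.
Qed.

Lemma disc_mobius_subJ h a b : normc a < 1 -> normc b < 1 ->
  1 - disc_mobius h a * conjc (disc_mobius h b) =
  (1 - a * conjc b) * cexp (rep_log h a) * conjc (cexp (rep_log h b)).
Proof.
move=> a1 b1; have ha := cayley_inv_upper a1; have hb := cayley_inv_upper b1.
have na := addi_neq0 ha; have nb := conjc_neq0 (addi_neq0 hb).
have na' := addi_neq0 (mobius_upper h ha); have nb' := conjc_neq0 (addi_neq0 (mobius_upper h hb)).
have d1 : \det (SL2val (repr h)) = 1 by exact: det_SL2.
have ja := cocycle_neq0 d1 ha; have jb := conjc_neq0 (cocycle_neq0 d1 hb).
have [eps e1 E] := cexp_rep_log h; rewrite (E a a1) (E b b1).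
have ee : eps%:C * eps%:C = 1 by rewrite -RCM e1.
rewrite {1}/disc_mobius cayley_subJ ?addi_neq0//; try exact: mobius_upper.
rewrite mobius_mob mob_subJ//.
have -> : 1 - a * conjc b = - (2 * 'i%R) * (cayley_inv a - conjc (cayley_inv b)) /
    ((cayley_inv a + 'i%R) * conjc (cayley_inv b + 'i%R)).
  rewrite -{1}(cayley_invK (disc_sub1_neq0 a1)) -{1}(cayley_invK (disc_sub1_neq0 b1)).
  by rewrite cayley_subJ ?addi_neq0.
have cE (A B D : C) : conjc (eps%:C * A / (B * D)) = eps%:C * conjc A / (conjc B * conjc D).
  by rewrite conjcM conjcM conjcR conjcV conjcM.
rewrite cE.
rewrite -mobius_mob; move: (conjc (_ + 'i%R)) nb (conjc (mobius _ _ + 'i%R)) nb' => x n1 y n2.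
move: (conjc (cocycle _ _)) jb => p n3; move: (conjc (cayley_inv b)) => z.
move: (cayley_inv a + 'i%R) na (mobius h (cayley_inv a) + 'i%R) na' (cocycle _ _) ja => x' n4 y' n5 p' n6.
rewrite -[LHS]mul1r -ee; field.
by rewrite n1 n2 n3 n4 n5 n6.
Qed.

Lemma disc_mobius_sub h a b : normc a < 1 -> normc b < 1 ->
  disc_mobius h a - disc_mobius h b =
  (a - b) * cexp (rep_log h a) * cexp (rep_log h b).
Proof.
move=> a1 b1; have ha := cayley_inv_upper a1; have hb := cayley_inv_upper b1.
have na := addi_neq0 ha; have nb := addi_neq0 hb.
have na' := addi_neq0 (mobius_upper h ha); have nb' := addi_neq0 (mobius_upper h hb).
have d1 : \det (SL2val (repr h)) = 1 by exact: det_SL2.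
have ja := cocycle_neq0 d1 ha; have jb := cocycle_neq0 d1 hb.
have [eps e1 E] := cexp_rep_log h; rewrite (E a a1) (E b b1).
have ee : eps%:C * eps%:C = 1 by rewrite -RCM e1.
rewrite /disc_mobius cayley_sub//.
have -> : a - b = 2 * 'i%R * (cayley_inv a - cayley_inv b) /
    ((cayley_inv a + 'i%R) * (cayley_inv b + 'i%R)).
  rewrite -{1}(cayley_invK (disc_sub1_neq0 a1)) -{1}(cayley_invK (disc_sub1_neq0 b1)).
  by rewrite cayley_sub.
rewrite [mobius h _ - _]mob_sub//.
rewrite -[LHS]mul1r -ee; field.
by rewrite na nb na' nb' ja jb.
Qed.

(* The difference of the two sides at [(t a, t b)] is a continuous function of [t]
   with values in 2 pi i Z, and it is real at [t = 0]. *)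
Lemma rep_log_kernel h a b : normc a < 1 -> normc b < 1 ->
  disc_log (disc_mobius h a * conjc (disc_mobius h b)) +
  rep_log h a + conjc (rep_log h b) = disc_log (a * conjc b).
Proof.
move=> a1 b1; pose phi := disc_mobius h.
pose E t := disc_log (phi (t%:C * a) * conjc (phi (t%:C * b))) +
  rep_log h (t%:C * a) + conjc (rep_log h (t%:C * b)) -
  disc_log (t%:C * a * conjc (t%:C * b)).
have D z t : normc z < 1 -> 0 <= t <= 1 -> normc (t%:C * z) < 1.
  move=> z1 /andP[t0 t1]; rewrite normcM normcR ger0_norm//.
  by apply: le_lt_trans z1; rewrite ler_piMl// normc_ge0.
have cexpE t : 0 <= t <= 1 -> cexp (E t) = 1.
  move=> t01; have ta := D a t a1 t01; have tb := D b t b1 t01.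
  have pa := disc_mobius_disc h ta; have pb := disc_mobius_disc h tb.
  have n1 := disc_sub1_neq0 (normcM_lt1 ta tb).
  have q1 := cexp_neq0 (rep_log h (t%:C * a)); have q2 := conjc_neq0 (cexp_neq0 (rep_log h (t%:C * b))).
  rewrite /E cexpB cexpD cexpD !cexp_disc_log ?normcM_lt1// disc_mobius_subJ// cexpJ invrK.
  move: (1 - _) n1 (cexp _) q1 (conjc _) q2 => x n1 y n2 z n3.
  by field; rewrite n1 n2 n3.
have E0 : E 0 = 0.
  rewrite /E !mul0r disc_log0 subr0 mulcJ.
  have [|y hy] := @disc_log_real (normc (phi 0) ^+ 2).
    have := @disc_mobius_disc _ h 0; rewrite normc0 => /(_ ltr01).
    move=> p1; rewrite sqr_ge0 andTb expr2.
    exact: (mulr_ilt1 (normc_ge0 _) (normc_ge0 _) p1 p1).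
  rewrite hy.
  have := cexpE 0; rewrite lexx ler01 => /(_ isT); rewrite /E !mul0r disc_log0 subr0 mulcJ hy.
  move: (rep_log h 0) => [u v].
  rewrite (_ : y%:C + (u +i* v) + conjc (u +i* v) = (y + (u + u))%:C); last first.
    by apply/eqP; rewrite eq_complex; apply/andP; split; apply/eqP => /=; ring.
  by rewrite cexpR -[1]/(1%:C) -(@expR0 R) => -[] /expR_inj ->.
have : E 1 = 0.
  apply: pcont_eq0 => // t t01; have ta := D a t a1 t01; have tb := D b t b1 t01.
  have pa := disc_mobius_disc h ta; have pb := disc_mobius_disc h tb.
  have sa := pcont_scale a t; have sb := pcont_scale b t.
  have cj F : pcont F t -> pcont (fun t => conjc (F t)) t.
    by apply: (@pcont_comp _ (@conjc R)); exact: ccts_conj.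
  apply: pcontD; [apply: pcontD; [apply: pcontD|]|apply: pcontN].
  - apply: (@pcont_comp _ disc_log); first exact/disc_log_cont/normcM_lt1.
    apply: pcontM; last apply: cj.
      by apply: pcont_comp => //; exact: disc_mobius_cont.
    by apply: (@pcont_comp _ phi) => //; exact: disc_mobius_cont.
  - by apply: pcont_comp => //; exact: rep_log_cont.
  - by apply: cj; apply: pcont_comp => //; exact: rep_log_cont.
  - apply: (@pcont_comp _ disc_log); first exact/disc_log_cont/normcM_lt1.
    by apply: pcontM => //; exact: cj.
by rewrite /E !mul1r => /subr0_eq.
Qed.

Lemma disc_kernel_pair s h : kernel_pair s disc_log (disc_mobius h) (disc_mobius h^-1%g)
  (fun w => cexp (s%:C * rep_log h w)).
Proof.
split=> [w w1|w w1|a b a1 b1].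
- by rewrite disc_mobius_disc// disc_mobiusK.
- by rewrite disc_mobius_disc// -{1}(invgK h) disc_mobiusK.
- by rewrite -cexpJ -!cexpD [conjc (s%:C * _)]conjcM conjcR -!mulrDr rep_log_kernel.
Qed.

End DiscRep.

(** * Freeness of the action *)

Section FreeAction.
Variable R : realType.
Local Notation C := R[i].
Local Notation H := (@upper_half_plane R).
Implicit Types (z w : C) (m : 'M[R]_2) (g h : PSL2 R) (G : set (PSL2 R)).

Lemma subgroupM G g h : is_subgroup G -> G g -> G h -> G (g * h)%g.
Proof.
move=> [G1 GB] gg gh; rewrite -[h]invgK; apply: (GB) => //.
by rewrite -[_^-1%g]mul1g; exact: GB.
Qed.

Lemma subgroupV G g : is_subgroup G -> G g -> G g^-1%g.
Proof. by move=> [G1 GB] gg; rewrite -[_^-1%g]mul1g; exact: GB. Qed.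

Lemma subgroupX G g n : is_subgroup G -> G g -> G (g ^+ n)%g.
Proof.
move=> sG gg; elim: n => [|n IH]; first by rewrite expg0; exact: sG.1.
by rewrite expgS; exact: subgroupM.
Qed.

(** If 1 < g, left translation by the powers of g makes these powers strictly increasing, so none of
    them returns to 1; likewise if g < 1. *)
Lemma orderable_torsion_free G g n : is_subgroup G -> orderable G -> G g ->
  g <> 1%g -> (g ^+ n.+1)%g <> 1%g.
Proof.
move=> sG [lt [irr tr tot inv]] gg g1; have G1 := sG.1.
have gX k : G (g ^+ k)%g by exact: subgroupX.
have [l1|l1] : lt 1%g g \/ lt g 1%g by apply: tot => // e; apply: g1.
  have step k : lt (g ^+ k)%g (g ^+ k.+1)%g.
    by rewrite expgSr -{1}[(g ^+ k)%g]mulg1; exact: (inv 1%g g _ G1 gg (gX k)).1 l1.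
  have : lt 1%g (g ^+ n.+1)%g.
    elim: n => [|n IH]; first by rewrite expg1.
    exact: tr G1 (gX _) (gX _) IH (step _).
  by move=> + e; rewrite e; exact: irr.
have step k : lt (g ^+ k.+1)%g (g ^+ k)%g.
  by rewrite expgSr -{2}[(g ^+ k)%g]mulg1; exact: (inv g 1%g _ gg G1 (gX k)).1 l1.
have : lt (g ^+ n.+1)%g 1%g.
  elim: n => [|n IH]; first by rewrite expg1.
  exact: tr (gX _) (gX _) G1 (step _) IH.
by move=> + e; rewrite e; exact: irr.
Qed.

(** Pulling the isolating open set back along the continuous quotient map turns discreteness into a
    condition on the entries of a matrix representative. *)
Lemma discrete_one G : is_subgroup G -> discrete_subset G ->
  exists2 e : R, 0 < e & forall x : SL2 R, G (PSL2_class x) ->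
    (forall i j, `|SL2val x i j - (1 : 'M[R]_2) i j| < e) -> PSL2_class x = 1%g.
Proof.
move=> sG /(_ 1%g sG.1)[U oU UG].
have : nbhs (1%g : SL2 R) [set x | U (PSL2_class x)].
  apply: (@pi_continuous (SL2 R) (PSL2 R) 1%g U); apply: open_nbhs_nbhs; split=> //.
  by have [] : (U `&` G) 1%g by rewrite UG.
move=> [B [[A oA <-] A1] BU].
have /nbhs_ballP[e /= e0 he] : nbhs (1 : 'M[R]_2) A by exact: open_nbhs_nbhs.
exists e => // x Gx hx; have : (U `&` G) (PSL2_class x).
  split=> //; apply: BU; apply: he; split=> // i j.
  by rewrite /ball /= distrC; exact: hx.
by rewrite UG.
Qed.

(* Pigeonhole on the cells of a grid. *)
Lemma unit_power_near1 z (e : R) : normc z = 1 -> 0 < e ->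
  exists n, normc (z ^+ n.+1 - 1) < e.
Proof.
move=> z1 e0; pose K := Num.bound (4 / e).
have Ke : 4 / e < K%:R by rewrite archi_boundP// divr_ge0// ltW.
have K0 : 0 < K%:R :> R by apply: lt_trans Ke; rewrite divr_gt0.
have nX k : normc (z ^+ k) = 1 by rewrite normcX z1 expr1n.
have Re1 k : `|complex.Re (z ^+ k)| <= 1 by rewrite -(nX k) normRe_le.
have Im1 k : `|complex.Im (z ^+ k)| <= 1 by rewrite -(nX k) normIm_le.
pose cell (x : R) : nat := Num.truncn ((x + 1) * K%:R).
have cell_lt x : `|x| <= 1 -> (cell x < (2 * K).+1)%N.
  rewrite ler_norml => /andP[x0 x1].
  have p : 0 <= (x + 1) * K%:R by rewrite mulr_ge0//; lra.
  have /andP[h _] := truncn_itv p; rewrite ltnS -(ler_nat R); apply: le_trans h _.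
  by rewrite natrM ler_pM2r//; lra.
have cell_eq x y : `|x| <= 1 -> `|y| <= 1 -> cell x = cell y -> `|x - y| < e / 4.
  rewrite !ler_norml => /andP[x0 x1] /andP[y0 y1] exy.
  have p : 0 <= (x + 1) * K%:R by rewrite mulr_ge0//; lra.
  have q : 0 <= (y + 1) * K%:R by rewrite mulr_ge0//; lra.
  have /andP[h1 h2] := truncn_itv p; have /andP[h3 h4] := truncn_itv q.
  rewrite -/(cell x) -/(cell y) exy -natr1 in h1 h2 h3 h4.
  have lt1 : `|x - y| * K%:R < 1.
    have -> : `|x - y| * K%:R = `|(x + 1) * K%:R - (y + 1) * K%:R|.
      by rewrite -mulrBl normrM (gtr0_norm K0); congr (`|_| * _); ring.
    rewrite ltr_norml; move: h1 h2 h3 h4.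
    by move: ((x + 1) * _) ((y + 1) * _) => u v *; apply/andP; split; lra.
  rewrite -(ltr_pM2r K0); apply: lt_trans lt1 _.
  by move: Ke; rewrite ltr_pdivrMr// => ?; lra.
pose L := (2 * K).+1.
pose F (i : 'I_(L * L).+1) : 'I_L * 'I_L :=
  (Ordinal (cell_lt _ (Re1 i)),
   Ordinal (cell_lt _ (Im1 i))).
have : ~ injective F.
  by move=> /leq_card; rewrite card_prod !card_ord ltnn.
move=> /existsNP[i /existsNP[j /not_implyP[eF nij]]].
wlog lij : i j eF nij / (i < j)%N.
  move=> w; have := nij; case: (ltngtP i j) => [h|h|/val_inj//] _.
    exact: w eF nij h.
  by apply: w (esym eF) _ h => e1; apply: nij.
have [e1 e2] : cell (complex.Re (z ^+ i)) = cell (complex.Re (z ^+ j)) /\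
    cell (complex.Im (z ^+ i)) = cell (complex.Im (z ^+ j)).
  by have := congr1 (fun p => val p.1) eF; have := congr1 (fun p => val p.2) eF.
exists (j - i).-1; rewrite prednK ?subn_gt0//.
have -> : normc (z ^+ (j - i) - 1) = normc (z ^+ j - z ^+ i).
  rewrite -{2}(subnK (ltnW lij)) exprD -[X in _ = normc (_ - X)]mul1r -mulrBl.
  by rewrite normcM nX mulr1.
apply: le_lt_trans (normc_leD _) _; rewrite ReB ImB.
have := cell_eq _ _ (Re1 j) (Re1 i) (esym e1).
have := cell_eq _ _ (Im1 j) (Im1 i) (esym e2).
by lra.
Qed.

(** The vector (z, 1) is an eigenvector with eigenvalue k. As [m] is real, real and imaginary parts
    of the two coordinates determine its four entries. *)
Lemma fixing_matrixE m z : H z -> \det m = 1 -> mob m z = z ->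
  let k := cocycle m z in
  [/\ m 1 0 = complex.Im k / complex.Im z,
      m 1 1 = complex.Re k - m 1 0 * complex.Re z,
      m 0 0 = complex.Im (k * z) / complex.Im z &
      m 0 1 = complex.Re (k * z) - m 0 0 * complex.Re z].
Proof.
move=> hz d1 fz k; have k0 : k != 0 by exact: cocycle_neq0.
have e : k * z = (m 0 0)%:C * z + (m 0 1)%:C by rewrite -{1}fz /mob mulrC divfK.
have y0 : complex.Im z != 0 by rewrite gt_eqF.
rewrite e /k /cocycle; case: z y0 {hz fz e k0 k} => x y /= y0.
by split; field.
Qed.

(** By [fixing_matrixE] the entries depend affinely on the eigenvalue and are those of the identity
    at 1; [M] dominates the Lipschitz constants. *)
Lemma SL2_fix_close z (e : R) : H z -> 0 < e -> exists2 d : R, 0 < d &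
  forall m, \det m = 1 -> mob m z = z -> normc (cocycle m z - 1) < d ->
    forall i j, `|m i j - (1 : 'M[R]_2) i j| < e.
Proof.
move=> hz e0; have y0 : 0 < complex.Im z by [].
pose M := 1 + normc z + (1 + normc z) / complex.Im z + (1 + normc z) / complex.Im z * normc z.
have n0 := normc_ge0 z.
have p0 : 0 <= (1 + normc z) / complex.Im z by apply: divr_ge0; [lra|exact: ltW].
have M0 : 0 < M.
  have p1 := mulr_ge0 p0 n0.
  by rewrite /M -!addrA ltr_pwDl// !addr_ge0.
exists (e / M) => [|m d1 fz]; first by rewrite divr_gt0.
rewrite ltr_pdivlMr// => le.
have [e10 e11 e00 e01] := fixing_matrixE hz d1 fz.
move: le e10 e11 e00 e01; move: (cocycle m z) => k le e10 e11 e00 e01.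
pose t := normc (k - 1); have t0 : 0 <= t := normc_ge0 _.
have tz : normc ((k - 1) * z) = t * normc z by rewrite normcM.
have b10 : `|m 1 0 - 0| <= t / complex.Im z.
  rewrite subr0 e10 normrM normfV (gtr0_norm y0) ler_pM2r ?invr_gt0//.
  by have := normIm_le (k - 1); rewrite ImB /= subr0.
have b00 : `|m 0 0 - 1| <= t * normc z / complex.Im z.
  have -> : m 0 0 - 1 = complex.Im ((k - 1) * z) / complex.Im z.
    by rewrite e00 mulrBl mul1r ImB; field; rewrite gt_eqF.
  rewrite normrM normfV (gtr0_norm y0) ler_pM2r ?invr_gt0//.
  by rewrite -tz; exact: normIm_le.
have rz := normRe_le z.
have b11 : `|m 1 1 - 1| <= t + t / complex.Im z * normc z.
  have -> : m 1 1 - 1 = complex.Re (k - 1) - (m 1 0 - 0) * complex.Re z.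
    by rewrite e11 ReB /=; ring.
  apply: le_trans (ler_normB _ _) _; apply: lerD; first exact: normRe_le.
  by rewrite normrM; apply: ler_pM.
have b01 : `|m 0 1 - 0| <= t * normc z + t * normc z / complex.Im z * normc z.
  have -> : m 0 1 - 0 = complex.Re ((k - 1) * z) - (m 0 0 - 1) * complex.Re z.
    by rewrite e01 mulrBl mul1r ReB; ring.
  apply: le_trans (ler_normB _ _) _; apply: lerD; first by rewrite -tz; exact: normRe_le.
  by rewrite normrM; apply: ler_pM.
have tM : t * M = t + t * normc z + t / complex.Im z + t * normc z / complex.Im z
    + t / complex.Im z * normc z + t * normc z / complex.Im z * normc z.
  by rewrite /M; field; rewrite gt_eqF.
have q1 : 0 <= t / complex.Im z by rewrite divr_ge0// ltW.
have q2 : 0 <= t * normc z by rewrite mulr_ge0.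
have q3 : 0 <= t * normc z / complex.Im z by rewrite divr_ge0// ltW.
have q4 := mulr_ge0 q1 n0; have q5 := mulr_ge0 q3 n0.
rewrite -/t tM in le.
have all i j : `|m i j - (1 : 'M[R]_2) i j| < e.
  have : (i == 0) || (i == 1) by case: i => [[|[|?]]].
  have : (j == 0) || (j == 1) by case: j => [[|[|?]]].
  move=> /orP[]/eqP-> /orP[]/eqP->; rewrite mxE /=.
  - by apply: le_lt_trans b00 _; lra.
  - by apply: le_lt_trans b10 _; lra.
  - by apply: le_lt_trans b01 _; lra.
  - by apply: le_lt_trans b11 _; lra.
exact: all.
Qed.

(* The powers of an element fixing [z] are determined by the powers of a number
   of modulus one, which accumulate at 1: discreteness makes one of them trivial. *)
Lemma free_action G g z : is_subgroup G -> discrete_subset G -> orderable G ->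
  G g -> H z -> mobius g z = z -> g = 1%g.
Proof.
move=> sG dG oG gg hz fz; apply: contrapT => g1.
pose x := repr g; pose m := SL2val x.
have d1 : \det m = 1 by exact: det_SL2.
have fm : mob m z = z by [].
pose k := cocycle m z.
have k1 : normc k = 1.
  have := mob_subJ d1 hz hz; rewrite fm mulcJ -/k !subJ_Im -RCV.
  rewrite mulrAC -RCM => /(congr1 (@complex.Im R)) /=; rewrite !mul0r !mulr1 !addr0.
  have y0 : complex.Im z != 0 by rewrite gt_eqF.
  have kn : normc k != 0 by rewrite normc_eq0 cocycle_neq0.
  move=> e; have : normc k ^+ 2 = 1.
    have y2 : 2 * complex.Im z != 0 by rewrite mulf_neq0// pnatr_eq0.
    apply: (mulfI y2); rewrite mulr1 {1}e divfK// expf_neq0//.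
  by move/eqP; rewrite sqrf_eq1 => /orP[/eqP//|/eqP kE]; have := normc_ge0 k; rewrite kE; lra.
have Xm n : [/\ \det (SL2val (x ^+ n)%g) = 1, mob (SL2val (x ^+ n)%g) z = z,
    cocycle (SL2val (x ^+ n)%g) z = k ^+ n & PSL2_class (x ^+ n)%g = (g ^+ n)%g].
  elim: n => [|n [dn fn cn pn]].
    split; rewrite ?expg0 ?expr0//; first exact: det1.
      exact: mob1.
    by rewrite /cocycle /= !mxE /= rmorph0 rmorph1 mul0r add0r.
  have nz : cocycle (SL2val (x ^+ n)%g) z != 0 by rewrite cocycle_neq0.
  have dS : \det (SL2val (x ^+ n.+1)%g) = 1 by exact: det_SL2.
  have nS : cocycle (SL2val (x ^+ n.+1)%g) z != 0 by rewrite cocycle_neq0.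
  split => //.
  - by rewrite expgS /= mobM// ?fn// -/m; move: nS; rewrite expgS.
  - by rewrite expgS /= cocycleM// fn cn exprS.
  - by rewrite !expgS -pn; have := PSL2_classM x (x ^+ n)%g; rewrite {1}/x PSL2_classK => <-.
have [e e0 he] := discrete_one sG dG.
have [d d0 hd] := SL2_fix_close hz e0.
have [n hn] := unit_power_near1 k1 d0.
have [dn fn cn pn] := Xm n.+1.
apply: (orderable_torsion_free (n := n) sG oG gg g1); rewrite -pn.
apply: he; first by rewrite pn; exact: subgroupX.
by apply: hd => //; rewrite cn.
Qed.

End FreeAction.

(** * Orders of vanishing *)

Section OrderConditions.
Variable R : realType.
Local Notation C := R[i].
Implicit Types (f g u : C -> C) (p w : C) (v k m : nat).

(* For a holomorphic function this is a zero of order at least [v]; the estimate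
   is easier to transport and to pass to limits. *)
Definition bigO_at f p v := exists M d : R, 0 < d /\
  forall w, normc (w - p) < d -> normc (f w) <= M * normc (w - p) ^+ v.

Lemma bounded_near f p : ccts f p -> exists M d : R, [/\ 0 < d, 0 <= M &
  forall w, normc (w - p) < d -> normc (f w) <= M].
Proof.
move=> /(_ 1 ltr01)[d d0 hd]; exists (normc (f p) + 1), d.
split=> //[|w /hd h]; first by rewrite addr_ge0 ?normc_ge0.
rewrite -(subrK (f p) (f w)) addrC; apply: le_trans (le_normcD _ _) _.
by rewrite lerD2l; exact: ltW.
Qed.

Lemma zero_order_bigO f p v : zero_order_ge f p v -> bigO_at f p v.
Proof.
move=> [h [hh fE]]; have /holomorphic_atP[d' /cderiv_cont/cctsP ch] := nbhs_singleton hh.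
have [M [d [d0 M0 hM]]] := bounded_near ch.
have /nbhs_complexP[r r0 hr] := fE.
exists M, (Num.min d r); split=> [|w]; first by rewrite lt_min d0.
rewrite lt_min => /andP[/hM le /hr ->].
by rewrite normcM normcX mulrC ler_wpM2r// exprn_ge0// normc_ge0.
Qed.

Lemma bigO_at_eq0 p v : bigO_at (fun=> 0) p v.
Proof. by exists 0, 1; split=> // w _; rewrite normc0 mul0r. Qed.

Lemma bigO_atD f g p v : bigO_at f p v -> bigO_at g p v ->
  bigO_at (fun w => f w + g w) p v.
Proof.
move=> [M [d [d0 hM]]] [M' [d' [d'0 hM']]]; exists (M + M'), (Num.min d d').
split=> [|w]; first by rewrite lt_min d0.
rewrite lt_min => /andP[/hM h1 /hM' h2].
by apply: le_trans (le_normcD _ _) _; rewrite mulrDl; exact: lerD.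
Qed.

Lemma bigO_atZ (a : C) f p v : bigO_at f p v -> bigO_at (fun w => a * f w) p v.
Proof.
move=> [M [d [d0 hM]]]; exists (normc a * M), d; split=> // w /hM h.
by rewrite normcM -mulrA ler_wpM2l// normc_ge0.
Qed.

Lemma bigO_at_transport (phi J : C -> C) f p v : ccts phi p -> ccts J p ->
  (exists L d : R, [/\ 0 < d, 0 <= L &
     forall w, normc (w - p) < d -> normc (phi w - phi p) <= L * normc (w - p)]) ->
  bigO_at f (phi p) v -> bigO_at (transport phi J f) p v.
Proof.
move=> cphi cJ [L [d1 [d10 L0 hL]]] [M [d2 [d20 hM]]].
have [B [d3 [d30 B0 hB]]] := bounded_near cJ.
have [d4 d40 h4] := cphi _ d20.
exists (B * (`|M| * L ^+ v)), (Num.min (Num.min d1 d3) d4).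
split=> [|w]; first by rewrite !lt_min d10 d30.
rewrite !lt_min => /andP[/andP[/hL le1 /hB le3] /h4/hM le2].
have n0 := normc_ge0 (w - p).
rewrite /transport; case: ifP => _; last first.
  by rewrite normc0 !mulr_ge0// exprn_ge0.
rewrite normcM -!mulrA; apply: ler_pM => //; try exact: normc_ge0.
apply: le_trans le2 _; apply: le_trans (_ : `|M| * normc (phi w - phi p) ^+ v <= _).
  by apply: ler_wpM2r; [rewrite exprn_ge0// normc_ge0|exact: ler_norm].
rewrite -exprMn; apply: ler_wpM2l => //.
by apply: lerXn2r; rewrite ?nnegrE ?normc_ge0// mulr_ge0.
Qed.

End OrderConditions.

(** * Orders of zeros as conditions on Taylor coefficients *)

Section OrderInBergman.
Variable R : realType.
Variable s : R.
Hypothesis s_gt1 : 1 < s.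
Local Notation C := R[i].
Local Notation bw := (bweight s).
Local Notation energy := (energy s).
Local Notation ip := (bergman_inner s).
Implicit Types (f g u : C -> C) (p w : C) (v k m : nat) (h : PSL2 R).
Variables (l0 : C -> C) (l : PSL2 R -> C -> C).
Hypothesis l0_log : is_cayley_log l0.
Hypothesis l_log : is_cocycle_log l.

Definition rep_factor h w := cexp (s%:C * rep_log l0 l h w).
(** Indexed by the inverse: [bergman_rep] at g is [disc_rep] at g^-1, so that functions are composed
    with [disc_mobius h] itself. *)
Definition disc_rep h := transport (disc_mobius h) (rep_factor h).
(** The exact inverse and adjoint. The operator [disc_rep] at h^-1 may differ from it by a scalar,
    since the branches for h and h^-1 are chosen independently. *)
Definition disc_rep_inv h :=
  transport (disc_mobius h^-1%g) (fun w => (rep_factor h (disc_mobius h^-1%g w))^-1).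

Let kp h := disc_kernel_pair l0_log l_log s h.
Let Lam0 := disc_log0 l0.
Let Lam_cont (u : C) (u1 : normc u < 1) := (cctsP (disc_log l0) u).2 (disc_log_cont l0_log u1).
Let Lam_log (u : C) (u1 : normc u < 1) := cexp_disc_log l0_log u1.

Lemma disc_rep_bergman h f : bergman s f -> bergman s (disc_rep h f).
Proof. exact: (transport_bergman s_gt1 Lam0 Lam_cont Lam_log (kp h)). Qed.

Lemma disc_rep_inv_bergman h f : bergman s f -> bergman s (disc_rep_inv h f).
Proof. exact: (transport_bergman s_gt1 Lam0 Lam_cont Lam_log (kernel_pair_inv (kp h))). Qed.

Lemma disc_rep_adjoint h f g : bergman s f -> bergman s g ->
  ip (disc_rep h f) g = ip f (disc_rep_inv h g).
Proof. exact: (transport_adjoint s_gt1 Lam0 Lam_cont Lam_log (kp h)). Qed.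

Lemma disc_repK h f : bergman s f -> disc_rep h (disc_rep_inv h f) = f.
Proof. exact: (transportK s_gt1 (kp h)). Qed.

Lemma rep_factor_neq0 h w : rep_factor h w != 0.
Proof. exact: cexp_neq0. Qed.

Lemma disc_rep_invK h f : bergman s f -> disc_rep_inv h (disc_rep h f) = f.
Proof.
move=> bf; rewrite -[RHS](transportK s_gt1 (kernel_pair_inv (kp h)) bf).
apply/funext => w; rewrite /disc_rep_inv /disc_rep /transport; case: ifP => // w1.
rewrite disc_mobius_disc//; congr (_ * (_ * _)).
by rewrite invrK disc_mobiusVK.
Qed.

Lemma disc_rep_energy h f g : bergman s f -> bergman s g ->
  energy (fun w => disc_rep h f w - disc_rep h g w) = energy (fun w => f w - g w).
Proof.
move=> bf bg; have bd := bergmanB s_gt1 bf bg.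
have bT := disc_rep_bergman h bd.
have : (energy (disc_rep h (fun w => f w - g w)))%:C = (energy (fun w => f w - g w))%:C.
  by rewrite -!inner_energy// (transport_inner s_gt1 Lam0 Lam_cont Lam_log (kp h)).
by rewrite /disc_rep transportB => -[].
Qed.

Lemma rep_factor_cont h p : normc p < 1 -> ccts (rep_factor h) p.
Proof.
move=> p1; apply: (@ccts_comp _ (fun w => s%:C * rep_log l0 l h w) (@cexp R)); last first.
  by apply/cctsP; exact: cderiv_cont (cderiv_cexp _).
apply: (@ccts_comp _ (rep_log l0 l h) (fun z => s%:C * z)); first exact: rep_log_cont.
apply/cctsP; exact: cderiv_cont (cderivM (cderiv_cst _ _) (cderiv_id _)).
Qed.

Lemma disc_mobius_lip h p : normc p < 1 -> exists L d : R, [/\ 0 < d, 0 <= L &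
  forall w, normc (w - p) < d ->
    normc (disc_mobius h w - disc_mobius h p) <= L * normc (w - p)].
Proof.
move=> p1; have cq : ccts (fun w => cexp (rep_log l0 l h w)) p.
  apply: (@ccts_comp _ (rep_log l0 l h) (@cexp R)); first exact: rep_log_cont.
  by apply/cctsP; exact: cderiv_cont (cderiv_cexp _).
have [B [d [d0 B0 hB]]] := bounded_near cq.
exists (B * B), (Num.min d (1 - normc p)).
split=> [||w]; [by rewrite lt_min d0 subr_gt0|exact: mulr_ge0|].
rewrite lt_min => /andP[hw w1].
have w1' : normc w < 1.
  rewrite -(subrK p w); apply: le_lt_trans (le_normcD _ _) _; rewrite -ltrBrDr//.
rewrite (disc_mobius_sub l0_log l_log)// 2!normcM.
have h1 := hB w hw; have h2 : normc (cexp (rep_log l0 l h p)) <= B.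
  by apply: hB; rewrite subrr normc0.
rewrite -mulrA mulrC; apply: ler_wpM2r; first exact: normc_ge0.
by apply: (ler_pM (normc_ge0 _) (normc_ge0 _)).
Qed.

Lemma disc_rep_bigO h f p v : normc p < 1 ->
  bigO_at f (disc_mobius h p) v -> bigO_at (disc_rep h f) p v.
Proof.
move=> p1; apply: bigO_at_transport.
- exact: disc_mobius_cont.
- exact: rep_factor_cont.
- exact: disc_mobius_lip.
Qed.

Lemma ccts_inv (F : C -> C) p : F p != 0 -> ccts F p -> ccts (fun w => (F w)^-1) p.
Proof.
move=> F0 cF; apply: (@ccts_comp _ F (fun z => z^-1)) => //.
by have [d hd] := cderivV F0 (cderiv_id (F p)); apply/cctsP; exact: cderiv_cont hd.
Qed.

Lemma disc_rep_inv_bigO h f p v : normc p < 1 ->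
  bigO_at f (disc_mobius h^-1%g p) v -> bigO_at (disc_rep_inv h f) p v.
Proof.
move=> p1; apply: bigO_at_transport.
- exact: disc_mobius_cont.
- apply: (@ccts_inv (fun w => rep_factor h (disc_mobius h^-1%g w))).
    exact: rep_factor_neq0.
  apply: (@ccts_comp _ (disc_mobius h^-1%g) (rep_factor h)).
    exact: disc_mobius_cont.
  by apply: rep_factor_cont; exact: disc_mobius_disc.
- exact: disc_mobius_lip.
Qed.

Lemma bigO_at0_coef f v : bergman s f ->
  bigO_at f 0 v <-> forall k, (k < v)%N -> coef f k = 0.
Proof.
move=> bf; split=> [[M [d [d0 hM]]]|h].
  apply: (psum_order (M := M) ltr01 d0 (coefP s_gt1 bf)) => w wd.
  by have := hM w; rewrite subr0; apply.
have [M [d [d0 hM]]] := psum_bigO ltr01 (coefP s_gt1 bf) h.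
by exists M, d; split=> // w; rewrite subr0; exact: hM.
Qed.

(** Multiplication by a nonvanishing factor and composition with a Moebius map preserve the
    estimate, so the point can be moved to 0. The condition becomes the vanishing of finitely many
    bounded functionals, hence is closed. *)
Lemma bigO_at_coef h f v : bergman s f ->
  bigO_at f (disc_mobius h 0) v <-> forall k, (k < v)%N -> coef (disc_rep h f) k = 0.
Proof.
move=> bf; have z1 : normc (0 : C) < 1 by rewrite normc0.
rewrite -bigO_at0_coef; last exact: disc_rep_bergman.
split; first exact: disc_rep_bigO.
have p1 := disc_mobius_disc h z1.
by move=> b; rewrite -(disc_rep_invK h bf); apply: disc_rep_inv_bigO => //; rewrite disc_mobiusK.
Qed.

Lemma disc_transitive p : normc p < 1 -> exists h, disc_mobius h 0 = p.
Proof.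
move=> p1; have [h hp] := mobius_transitive (cayley_inv_upper p1).
by exists h; rewrite /disc_mobius cayley_inv0 hp cayley_invK// disc_sub1_neq0.
Qed.

Lemma bigO_at_lim (F : nat -> C -> C) f p v : normc p < 1 ->
  (forall n, bergman s (F n)) -> bergman s f -> energy_lim s F f ->
  (forall n, bigO_at (F n) p v) -> bigO_at f p v.
Proof.
move=> /disc_transitive[h <-] bF bf lim bO; apply/bigO_at_coef => // k kv.
apply: normc_small_eq0 => e e0; have b0 := bweight_gt0 s_gt1 k.
have [|N HN] := lim (bw k * e ^+ 2); first by rewrite mulr_gt0 ?exprn_gt0.
have := HN N (leqnn N); rewrite -(disc_rep_energy h (bF N) bf) => lt.
have bTF := disc_rep_bergman h (bF N); have bTf := disc_rep_bergman h bf.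
have := coef_le_energy s_gt1 k (bergmanB s_gt1 bTF bTf).
rewrite (coefB s_gt1)// ((bigO_at_coef h v (bF N)).1 (bO N) k kv) sub0r normcN.
move=> /le_lt_trans/(_ lt); rewrite (ltr_pM2l b0) => lt2; apply: ltW.
by rewrite -(@ltr_pXn2r _ 2)// ?nnegrE ?normc_ge0//; exact: ltW.
Qed.

(** Division by z is bounded: [bw k <= s * bw k.+1], because k + s <= s (k + 1) for s > 1. *)
Lemma ell2_shift (A : nat -> C) m : ell2 s A -> ell2 s (fun k => A (m + k)%N).
Proof.
elim: m => // m IH /IH [M HM]; have s0 : 0 < s by exact: lt_trans s_gt1.
exists (s * M) => N; apply: le_trans (_ : s * \sum_(k < N) bw k.+1 * normc (A (m + k.+1)%N) ^+ 2 <= _).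
  rewrite mulr_sumr; apply: ler_sum => k _; rewrite addSnnS mulrA.
  apply: ler_wpM2r; first exact: sqr_ge0.
  have k1 : 0 < k.+1%:R :> R by rewrite ltr0n.
  rewrite -(ler_pM2r k1) -(bweightS s_gt1) mulrC -mulrA [s * (_ * _)]mulrCA.
  rewrite [leLHS]mulrC; apply: ler_wpM2l; first by apply: ltW; exact: bweight_gt0.
  rewrite -natr1; have : 0 <= k%:R :> R by [].
  by move: (k%:R) => x; move: s_gt1; nra.
apply: ler_wpM2l; first exact: ltW.
apply: le_trans (HM N.+1); rewrite big_ord_recl /=.
by rewrite lerDr; exact: (bw_term_ge0 s_gt1 (fun k => A (m + k)%N) 0).
Qed.

(* Dividing by the [m]-th power of the Blaschke factor of the point [disc_mobius h 0]. *)
Lemma divide_zero h f m : bergman s f ->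
  (forall k, (k < m)%N -> coef (disc_rep h f) k = 0) ->
  exists e, [/\ bergman s e,
    forall w, normc w < 1 -> f w = disc_mobius h^-1%g w ^+ m * e w &
    forall k, coef (disc_rep h e) k = coef (disc_rep h f) (m + k)%N].
Proof.
move=> bf A0; have bT := disc_rep_bergman h bf.
have [g bg gA] := ell2_bergman s_gt1 (ell2_shift m (coef_ell2 s_gt1 bT)).
have gE w : normc w < 1 -> disc_rep h f w = w ^+ m * g w.
  move=> w1; apply: (csum_unique (u := fun k => coef (disc_rep h f) (m + k)%N * w ^+ (m + k))).
    have := csum_shift m (coefP s_gt1 bT w1); rewrite big1 ?subr0// => i _.
    by rewrite A0 ?mul0r.
  apply: eq_csum (csumZ (w ^+ m) (coefP s_gt1 bg w1)) => k.
  by rewrite gA exprD; ring.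
exists (disc_rep_inv h g); split; first exact: disc_rep_inv_bergman.
  move=> w w1; rewrite -{1}(disc_rep_invK h bf) /disc_rep_inv /transport w1 gE.
    by rewrite mulrCA.
  exact: disc_mobius_disc.
by move=> k; rewrite disc_repK// gA.
Qed.

(** Away from its zero the Blaschke power has a continuous inverse, so dividing by it is a transport
    along the identity map. *)
Lemma bigO_at_divide h f e m p v : normc p < 1 -> p <> disc_mobius h 0 ->
  (forall w, normc w < 1 -> f w = disc_mobius h^-1%g w ^+ m * e w) ->
  bigO_at f p v -> bigO_at e p v.
Proof.
move=> p1 np fE fO; have z1 : normc (0 : C) < 1 by rewrite normc0.
have nz w : normc w < 1 -> w <> disc_mobius h 0 -> disc_mobius h^-1%g w != 0.
  by move=> w1 nw; apply/eqP => e0; apply: nw; rewrite -e0 disc_mobiusVK.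
pose J w := (disc_mobius h^-1%g w)^-1 ^+ m.
have cJ : ccts J p.
  apply: (@ccts_comp _ (fun w => (disc_mobius h^-1%g w)^-1) (fun z => z ^+ m)).
    by apply: ccts_inv; [exact: nz|exact: disc_mobius_cont].
  have [d hd] := cderivX m (cderiv_id (disc_mobius h^-1%g p)^-1).
  by apply/cctsP; exact: cderiv_cont hd.
have [M [d [d0 hM]]] : bigO_at (transport id J f) p v.
  apply: bigO_at_transport => //; first by move=> e' e'0; exists e'.
  by exists 1, 1; split=> // w _; rewrite mul1r.
have dp : 0 < normc (disc_mobius h 0 - p).
  by rewrite normc_gt0 subr_eq0 eq_sym; apply/eqP.
exists M, (Num.min (Num.min d (1 - normc p)) (normc (disc_mobius h 0 - p))).
split=> [|w]; first by rewrite !lt_min d0 subr_gt0 p1.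
rewrite !lt_min => /andP[/andP[wd w1] wp].
have w1' : normc w < 1.
  by rewrite -(subrK p w); apply: le_lt_trans (le_normcD _ _) _; rewrite -ltrBrDr.
have nw : disc_mobius h^-1%g w != 0 by apply: nz => // e0; move: wp; rewrite e0 ltxx.
have := hM w wd; rewrite /transport w1' fE// /J exprVn mulrA mulVf ?mul1r//.
by rewrite expf_neq0.
Qed.

End OrderInBergman.

(** * Functions vanishing along orbits *)

Section WanderingSubspace.
Variable R : realType.
Variable s : R.
Hypothesis s_gt1 : 1 < s.
Local Notation C := R[i].
Local Notation ip := (bergman_inner s).
Implicit Types (f g u : C -> C) (w : C) (h : PSL2 R).
Variables (l0 : C -> C) (l : PSL2 R -> C -> C).
Hypothesis l0_log : is_cayley_log l0.
Hypothesis l_log : is_cocycle_log l.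
Local Notation drep := (disc_rep s l0 l).
Local Notation drep_inv := (disc_rep_inv s l0 l).

Lemma exact_order h f : bergman s f -> f <> (fun=> 0) -> exists k,
  coef (drep h f) k != 0 /\ forall k', (k' < k)%N -> coef (drep h f) k' = 0.
Proof.
move=> bf f0; have bT := disc_rep_bergman s_gt1 l0_log l_log h bf.
have ex : exists k, coef (drep h f) k != 0.
  apply: contrapT => /forallNP c0; apply: f0.
  rewrite -(disc_rep_invK s_gt1 l0_log l_log h bf).
  have -> : drep h f = fun=> 0.
    apply: (bergman_eq s_gt1 bT (bergman0 s_gt1)); apply/funext => k.
    rewrite (coef_unique s_gt1 (A := fun=> 0) (bergman0 s_gt1)).
      by apply/eqP/negPn/negP; exact: c0.
    by move=> w _; apply: eq_csum (@csum0 R) => n; rewrite mul0r.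
  by apply/funext => w; rewrite /disc_rep_inv /transport mulr0; case: ifP.
exists (ex_minn ex); case: ex_minnP => k ck min; split=> // k'.
by rewrite ltnNge; apply: contraNeq; exact: min.
Qed.

(* The [j]-th function divides [f] by a power of the Blaschke factor of the
   point so as to leave a zero of order exactly [j] there. *)
Lemma prescribed_order h f v : bergman s f -> f <> (fun=> 0) ->
  bigO_at f (disc_mobius h 0) v ->
  exists e : nat -> C -> C, forall j, (j < v)%N -> [/\ bergman s (e j),
    exists m, forall w, normc w < 1 -> f w = disc_mobius h^-1%g w ^+ m * e j w,
    forall k, (k < j)%N -> coef (drep h (e j)) k = 0 &
    coef (drep h (e j)) j != 0].
Proof.
move=> bf f0 fO; have [k [ck cmin]] := exact_order h bf f0.
have vk : (v <= k)%N.
  rewrite leqNgt; apply: contraNN ck => kv; apply/eqP.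
  exact: (bigO_at_coef s_gt1 l0_log l_log h v bf).1.
suff ex j : exists e, (j < v)%N -> [/\ bergman s e,
    exists m, forall w, normc w < 1 -> f w = disc_mobius h^-1%g w ^+ m * e w,
    forall k, (k < j)%N -> coef (drep h e) k = 0 & coef (drep h e) j != 0].
  by have [e he] := choice ex; exists e.
have [jv|_] := ltnP j v; last by exists f.
have jk : (j <= k)%N by rewrite (leq_trans _ vk)// ltnW.
have [e [be fe ce]] : exists e, [/\ bergman s e,
    forall w, normc w < 1 -> f w = disc_mobius h^-1%g w ^+ (k - j) * e w &
    forall k', coef (drep h e) k' = coef (drep h f) (k - j + k')%N].
  apply: divide_zero => // k' h'; apply: cmin; apply: leq_trans h' _; exact: leq_subr.
exists e => _; split=> //; first by exists (k - j)%N.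
  by move=> k' kj; rewrite ce cmin// -{2}(subnK jk) ltn_add2l.
by rewrite ce subnK.
Qed.

Variables (n : nat) (p : 'I_n -> C) (v : 'I_n -> nat).
Hypothesis p_disc : forall i, normc (p i) < 1.

(** M and M' of the overview are the cases where [Q] consists of the elements of G that are at most
    1, or less than 1; for [Q = G] the set contains [f]. *)
Definition vanishing (Q : set (PSL2 R)) : set (C -> C) := [set u | bergman s u /\
  forall i (g : PSL2 R), Q g -> bigO_at u (disc_mobius g (p i)) (v i)].

Lemma vanishing_sub (Q Q' : set (PSL2 R)) : Q `<=` Q' -> vanishing Q' `<=` vanishing Q.
Proof. by move=> QQ u [bu h]; split=> // i g /QQ; exact: h. Qed.

Lemma vanishing0 Q : vanishing Q (fun=> 0).
Proof. by split; [exact: bergman0|move=> i g _; exact: bigO_at_eq0]. Qed.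

Lemma vanishingD Q f g : vanishing Q f -> vanishing Q g -> vanishing Q (fun w => f w + g w).
Proof.
move=> [bf hf] [bg hg]; split; first exact: bergmanD.
by move=> i h Qh; apply: bigO_atD; [exact: hf|exact: hg].
Qed.

Lemma vanishingZ Q a f : vanishing Q f -> vanishing Q (fun w => a * f w).
Proof.
move=> [bf hf]; split; first exact: bergmanZ.
by move=> i h Qh; apply: bigO_atZ; exact: hf.
Qed.

Lemma vanishingB Q f g : vanishing Q f -> vanishing Q g -> vanishing Q (fun w => f w - g w).
Proof.
move=> hf hg; rewrite (_ : (fun w => _) = fun w => f w + -1 * g w).
  by apply: vanishingD => //; exact: vanishingZ.
by apply/funext => w; rewrite mulN1r.
Qed.

Lemma vanishing_sum Q m (F : 'I_m -> C -> C) (c : 'I_m -> C) :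
  (forall i, vanishing Q (F i)) -> vanishing Q (fun w => \sum_i c i * F i w).
Proof.
elim: m F c => [|m IH] F c hF.
  rewrite (_ : (fun w => _) = fun=> 0); first exact: vanishing0.
  by apply/funext => w; rewrite big_ord0.
rewrite (_ : (fun w => _) = fun w => c ord0 * F ord0 w +
    \sum_i c (lift ord0 i) * F (lift ord0 i) w).
  by apply: vanishingD; [exact: vanishingZ|exact: (IH (fun i => F (lift ord0 i)))].
by apply/funext => w; rewrite big_ord_recl.
Qed.

Lemma vanishing_lim Q (F : nat -> C -> C) f : (forall k, vanishing Q (F k)) ->
  bergman s f -> energy_lim s F f -> vanishing Q f.
Proof.
move=> hF bf lim; split=> // i g Qg.
apply: (bigO_at_lim s_gt1 l0_log l_log _ _ bf lim).
- exact: disc_mobius_disc.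
- by move=> k; have [] := hF k.
- by move=> k; have [_] := hF k; apply.
Qed.

Lemma vanishing_projection Q f : bergman s f ->
  exists2 m, vanishing Q m & forall g, vanishing Q g -> ip (fun w => f w - m w) g = 0.
Proof.
apply: orthogonal_projection => //.
- by move=> u [].
- exact: vanishing0.
- exact: vanishingD.
- exact: vanishingZ.
- exact: vanishing_lim.
Qed.

(** A zero of [drep h u] at g p comes from a zero of [u] at h g p: the index set moves by left
    translation, which is what an order invariant on the left controls. *)
Lemma vanishing_rep Q Q' h u : (forall g : PSL2 R, Q' g -> Q (h * g)%g) ->
  vanishing Q u -> vanishing Q' (drep h u).
Proof.
move=> QQ [bu hu]; split; first exact: disc_rep_bergman.
move=> i g /QQ Qg; apply: disc_rep_bigO => //; first exact: disc_mobius_disc.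
by rewrite -disc_mobiusM//; exact: hu.
Qed.

Lemma vanishing_rep_inv Q Q' h u : (forall g : PSL2 R, Q' g -> Q (h^-1 * g)%g) ->
  vanishing Q u -> vanishing Q' (drep_inv h u).
Proof.
move=> QQ [bu hu]; split; first exact: disc_rep_inv_bergman.
move=> i g /QQ Qg; apply: disc_rep_inv_bigO => //; first exact: disc_mobius_disc.
by rewrite -disc_mobiusM//; exact: hu.
Qed.

(* By induction on [sig2 t]: the coefficient of order [sig2 t] of the combination
   at the point of index [sig1 t] only involves [c t]. *)
Lemma orders_independent (hp : 'I_n -> PSL2 R) (E : 'I_(\sum_i v i) -> C -> C)
    (c : 'I_(\sum_i v i) -> C) :
  (forall i, disc_mobius (hp i) 0 = p i) ->
  (forall t, bergman s (E t)) ->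
  (forall t i, i != tagnat.sig1 t -> bigO_at (E t) (p i) (v i)) ->
  (forall t k, (k < tagnat.sig2 t)%N -> coef (drep (hp (tagnat.sig1 t)) (E t)) k = 0) ->
  (forall t, coef (drep (hp (tagnat.sig1 t)) (E t)) (tagnat.sig2 t) != 0) ->
  (forall i, bigO_at (fun w => \sum_t c t * E t w) (p i) (v i)) ->
  forall t, c t = 0.
Proof.
move=> hp0 bE Eoff Elow Eeq uO.
have sum_coef h k : coef (drep h (fun w => \sum_t c t * E t w)) k =
    \sum_t c t * coef (drep h (E t)) k.
  have bs m (F : 'I_m -> C -> C) (d : 'I_m -> C) : (forall i, bergman s (F i)) ->
      bergman s (fun w => \sum_i d i * F i w) /\
      coef (drep h (fun w => \sum_i d i * F i w)) k =
        \sum_i d i * coef (drep h (F i)) k.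
    elim: m F d => [|m IH] F d bF.
      rewrite (_ : (fun w => _) = fun w => 0 * 0); last first.
        by apply/funext => w; rewrite big_ord0 mulr0.
      rewrite /disc_rep transportZ (coefZ s_gt1) ?mul0r ?big_ord0.
        by split=> //; exact: bergman0.
      exact: (disc_rep_bergman s_gt1 l0_log l_log h (bergman0 s_gt1)).
    have [b1 e1] := IH _ (fun i => d (lift ord0 i)) (fun i => bF (lift ord0 i)).
    have b0 := bergmanZ s_gt1 (d ord0) (bF ord0).
    rewrite (_ : (fun w => _) = fun w => d ord0 * F ord0 w +
      \sum_i d (lift ord0 i) * F (lift ord0 i) w); last first.
      by apply/funext => w; rewrite big_ord_recl.
    split; first exact: bergmanD.
    rewrite /disc_rep transportD (coefD s_gt1).
    - rewrite transportZ (coefZ s_gt1) ?big_ord_recl ?[in RHS]/= -?e1//.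
      exact: (disc_rep_bergman s_gt1 l0_log l_log).
    - exact: (disc_rep_bergman s_gt1 l0_log l_log).
    - exact: (disc_rep_bergman s_gt1 l0_log l_log).
  exact: (bs _ E c bE).2.
have bu : bergman s (fun w => \sum_t c t * E t w).
  by apply: (bergman_sum s_gt1 (F := fun t w => c t * E t w)) => t; exact: bergmanZ.
move=> t; have [k] := ubnP (tagnat.sig2 t : nat); elim: k t => // k IH t lt.
have := sum_coef (hp (tagnat.sig1 t)) (tagnat.sig2 t).
have := uO (tagnat.sig1 t); rewrite -hp0.
move=> /(bigO_at_coef s_gt1 l0_log l_log _ _ bu).1 -> //.
rewrite (bigD1 t)//= big1 ?addr0 => [/esym/eqP|t' tt'].
  by rewrite mulf_eq0 (negbTE (Eeq t)) orbF => /eqP.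
have [e1|n1] := eqVneq (tagnat.sig1 t) (tagnat.sig1 t'); last first.
  have := Eoff t' _ n1; rewrite -hp0.
  by move=> /(bigO_at_coef s_gt1 l0_log l_log _ _ (bE t')).1 -> //; rewrite mulr0.
have [lt'|gt'|e2] := ltngtP (tagnat.sig2 t : nat) (tagnat.sig2 t').
- by have := Elow t' _ lt'; rewrite -e1 => ->; rewrite mulr0.
- by rewrite IH ?mul0r//; apply: leq_trans gt' _; rewrite -ltnS.
- case/eqP: tt'; apply/val_inj.
  by rewrite /= [LHS]tagnat.rect [RHS]tagnat.rect e2 e1.
Qed.

End WanderingSubspace.

Local Close Scope complex_scope.

Theorem theorem6p2 (R : realType) (G : set (PSL2 R)) (s : R)
    (l0 : R[i] -> R[i]) (l : PSL2 R -> R[i] -> R[i])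
    (n : nat) (O : 'I_n -> set R[i]) (v : 'I_n -> nat) (f : R[i] -> R[i])
    (G_fuchsian : fuchsian G) (G_orderable : orderable G) (s_gt1 : 1 < s)
    (l0_log : is_cayley_log l0) (l_log : is_cocycle_log l)
    (O_orbit : forall i, is_disc_orbit G (O i))
    (O_disjoint : forall i j, i != j -> O i `&` O j = set0)
    (v_gt0 : forall i, (0 < v i)%N)
    (f_bergman : bergman s f) (f_neq0 : f <> (fun=> 0))
    (f_zero : forall i p, O i p -> zero_order_ge f p (v i)) :
  exists W : set (R[i] -> R[i]),
    [/\ W `<=` bergman s,
        subspace_of_dim W (\sum_i v i)%N,
        wandering s (bergman_rep s l0 l) G W &
        forall g, G g -> orthocomplement s W (bergman_rep s l0 l g f)].
Proof.
have [sG dG _] := G_fuchsian.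
have repE g u : bergman_rep s l0 l g u = disc_rep s l0 l g^-1%g u by exact: bergman_repE.
have [lt [irr tr tot inv]] := G_orderable.
have G1 := sG.1.
have ex_p i : exists p, normc p < 1 /\ O i = [set disc_mobius g p | g in G].
  by have [p /unit_discE p1 OE] := O_orbit i; exists p.
have [p hp] := choice ex_p; have p1 i := (hp i).1.
have ex_h i : exists h, disc_mobius h 0 = p i by exact: disc_transitive.
have [h hh] := choice ex_h.
have Op i g : G g -> O i (disc_mobius g (p i)) by rewrite (hp i).2 => Gg; exists g.
have fO i g : G g -> bigO_at f (disc_mobius g (p i)) (v i).
  by move=> /(Op i)/f_zero/zero_order_bigO.
(* For [i = i'] this is freeness of the action, for [i != i'] disjointness of the orbits. *)
have sep i i' g : G g -> (i = i' -> g <> 1%g) -> disc_mobius g (p i) <> p i'.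
  move=> Gg hi e; have [ii|ii] := eqVneq i i'.
    apply: (hi ii); apply: (free_action sG dG G_orderable Gg (cayley_inv_upper (p1 i))).
    have := congr1 (@cayley_inv R) e; rewrite /disc_mobius cayleyK ?ii//.
    exact/mobius_upper/cayley_inv_upper.
  have : (O i `&` O i') (p i').
    by split; [rewrite -e; exact: Op|rewrite -(disc_mobius1 (p1 i')); exact: Op].
  by rewrite O_disjoint.
have fOi i : bigO_at f (disc_mobius (h i) 0) (v i).
  by rewrite hh -(disc_mobius1 (p1 i)); exact: fO.
have ex_e i := prescribed_order s_gt1 l0_log l_log f_bergman f_neq0 (fOi i).
have [e he] := choice ex_e.
(* An index [t] below the sum of the [v i] encodes a pair of an orbit [tagnat.sig1 t] and an order
   [tagnat.sig2 t] less than its multiplicity. *)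
pose E (t : 'I_(\sum_i v i)%N) := e (tagnat.sig1 t) (tagnat.sig2 t).
have hE t := he (tagnat.sig1 t) (tagnat.sig2 t) (ltn_ord _).
have bE t : bergman s (E t) by have [] := hE t.
(* The division that produces [E t] lowers the order of [f] at the single point [p (tagnat.sig1 t)];
   at all other points of the orbits the zeros of [f] survive. *)
have EO t i g : G g -> (i = tagnat.sig1 t -> g <> 1%g) ->
    bigO_at (E t) (disc_mobius g (p i)) (v i).
  move=> Gg hi; have [_ [m fE] _ _] := hE t.
  apply: (bigO_at_divide (disc_mobius_disc g (p1 i)) _ fE); last exact: fO.
  by rewrite hh; exact: sep.
(* The [X t] below span a complement of the functions vanishing over [upto1] in
   those vanishing over [below1]. *)
pose below1 : set (PSL2 R) := [set g | G g /\ lt g 1%g].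
pose upto1 : set (PSL2 R) := [set g | G g /\ (g = 1%g \/ lt g 1%g)].
have Vle : vanishing s p v upto1 `<=` vanishing s p v below1.
  by apply: vanishing_sub => g [Gg lg]; split=> //; right.
have VE t : vanishing s p v below1 (E t).
  by split=> // i g [Gg lg]; apply: EO => // _ g1; apply: (irr g) => //; rewrite {2}g1.
have ex_P t : exists m, vanishing s p v upto1 m /\ forall g, vanishing s p v upto1 g ->
    bergman_inner s (fun w => E t w - m w) g = 0.
  suff [m h1 h2] : exists2 m, vanishing s p v upto1 m & forall g,
    vanishing s p v upto1 g -> bergman_inner s (fun w => E t w - m w) g = 0 by exists m.
  exact: (vanishing_projection s_gt1 l0_log l_log v p1 upto1 (bE t)).
have [P hP] := choice ex_P.
pose X t w := E t w - P t w.
have VX t : vanishing s p v below1 (X t).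
  by apply: vanishingB => //; apply: Vle; exact: (hP t).1.
have bX t : bergman s (X t) by have [] := VX t.
pose W : set (R[i] -> R[i]) := [set u | exists c, forall w, u w = \sum_t c t * X t w].
have WE u : W u -> exists c, u = fun w => \sum_t c t * X t w.
  by move=> [c hc]; exists c; exact/funext.
have VW : W `<=` vanishing s p v below1.
  by move=> u /WE[c ->]; exact: vanishing_sum.
have bW : W `<=` bergman s by move=> u /VW[].
have orth u m : W u -> vanishing s p v upto1 m -> bergman_inner s u m = 0.
  move=> /WE[c ->] Vm; have bm : bergman s m by have [] := Vm.
  rewrite (inner_sum s_gt1 (F := fun t w => c t * X t w))//.
    by rewrite big1// => t _; rewrite innerZ// (hP t).2// mulr0.
  by move=> t; exact: bergmanZ.
have orth' u m : W u -> vanishing s p v upto1 m -> bergman_inner s m u = 0.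
  move=> Wu Vm; have bm : bergman s m by have [] := Vm.
  by rewrite (innerC s_gt1 (bW _ Wu) bm) orth// conjc0.
exists W; split=> //.
(* If a combination of the [X t] is zero, the same combination of the [E t] equals that of the
   projections [P t]. It therefore vanishes to order [v i] at every [p i], and comparing orders
   kills the coefficients. *)
- exists X; split=> // c hc.
  apply: (orders_independent s_gt1 l0_log l_log hh bE).
  + by move=> t i /eqP it; rewrite -(disc_mobius1 (p1 i)); exact: EO.
  + by move=> t k; have [_ _ h1 _] := hE t; exact: h1.
  + by move=> t; have [] := hE t.
  move=> i; rewrite -(disc_mobius1 (p1 i)).
  have : vanishing s p v upto1 (fun w => \sum_t c t * P t w).
    by apply: vanishing_sum => // t; exact: (hP t).1.
  move=> [_ /(_ i 1%g) V1]; rewrite (_ : (fun w => _) = fun w => \sum_t c t * P t w).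
    by apply: V1; split=> //; left.
  apply/funext => w; apply/eqP; rewrite -subr_eq0 -sumrB -[X in _ == X](hc w).
  by apply/eqP; apply: eq_bigr => t _; rewrite -mulrBr.
- move=> g Gg g1 _ [u Wu <-]; rewrite repE.
  have GV : G g^-1%g by exact: subgroupV.
  split; first exact/disc_rep_bergman/bW.
  move=> w Ww; have [lg|lg] := tot g 1%g Gg G1 g1.
    (* For g < 1 the adjoint composes with g, and k <= 1 gives g k <= g < 1; so it maps [w] to a
       function vanishing over [upto1]. *)
    rewrite disc_rep_adjoint//; [|exact: bW|exact: bW].
    apply: orth => //; apply: (vanishing_rep_inv s_gt1 l0_log l_log p1) (VW _ Ww).
    move=> k [Gk lk]; rewrite invgK; split; first exact: subgroupM.
    have gk : k = 1%g \/ lt (g * k)%g (g * 1)%g.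
      by case: lk => [->|lk]; [left|right; exact: (inv k 1%g g Gk G1 Gg).1].
    case: gk => [->|]; rewrite mulg1//.
    by move=> gk; apply: tr gk lg => //; exact: subgroupM.
  (* For g > 1 the operator composes with g^-1, and k <= 1 < g gives g^-1 k < 1. *)
  apply: orth' => //; apply: (vanishing_rep s_gt1 l0_log l_log p1) (VW _ Wu).
  move=> k [Gk lk]; split; first exact: subgroupM.
  have kg : lt k g by case: lk => [->//|lk]; exact: tr lk lg.
  by rewrite -(mulVg g); exact: (inv k g g^-1%g Gk Gg GV).1.
- move=> g Gg; rewrite repE; split; first exact: disc_rep_bergman.
  move=> w Ww; apply: orth' => //.
  have Vf : vanishing s p v G f by split=> // i k; exact: fO.
  apply: (vanishing_rep s_gt1 l0_log l_log p1) Vf => k [Gk _].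
  by apply: subgroupM => //; exact: subgroupV.
Qed.
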